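(* Let $N\ge3$, let $D\subset\mathbb{S}^{N-1}$ be a smooth domain with spanned cone $\Sigma_D$, let $m>0$, and let $\Omega\subset\Sigma_D$ be a minimizer for $$\inf\{\lambda_1(\omega):\ \omega\subset\Sigma_D\text{ is quasi-open},\ |\omega|=m\}.$$ Then $\Omega$ is connected.
   Context: A smooth domain $D\subset\mathbb{S}^{N-1}$ is a connected open set with smooth (nonempty) boundary. $\Sigma_D=\{rq: r>0,\ q\in D\}\subset\mathbb{R}^N$ is assumed to be a uniformly Lipschitz set. Capacity: $\mathrm{cap}(E)=\inf\{\|v\|^2_{H^1(\mathbb{R}^N)}: v\ge1\text{ in a neighbourhood of }E\}$. A set $U\subset\mathbb{R}^N$ is quasi-open if for every $\varepsilon>0$ there is an open set $V_\varepsilon$ with $U\cup V_\varepsilon$ open and $\mathrm{cap}(V_\varepsilon)\le\varepsilon$; quasi-open sets are considered up to sets of zero capacity, and a minimizer is identified with its open representative (minimizers are known to be open). For a quasi-open $\Omega\subset\Sigma_D$, $H^1_0(\Omega;\Sigma_D)=\{u\in H^1(\Sigma_D): u=0\text{ q.e. in }\Sigma_D\setminus\Omega\}$ (q.e. = up to a set of zero capacity). For $\Omega$ quasi-open of finite measure, $\lambda_1(\Omega)=\inf\{\int_\Omega|\nabla v|^2dx: v\in H^1_0(\Omega;\Sigma_D),\ \|v\|_{L^2}=1\}$. *)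

(* Defs.v *)
From HB Require Import structures.
From mathcomp Require Import all_boot all_order all_algebra.
From mathcomp Require Import all_classical all_reals all_analysis.

Set Implicit Arguments.
Unset Strict Implicit.
Unset Printing Implicit Defensive.

Import Order.TTheory GRing.Theory Num.Theory.
Import numFieldNormedType.Exports.

Local Open Scope classical_set_scope.
Local Open Scope ring_scope.

Section euclidean.
Context {R : realType} {N : nat}.
Implicit Types x y : 'rV[R]_N.

(* The library norm on 'rV[R]_N is the sup norm, which gives the same topology
   but not the same sphere. *)
Definition dot x y : R := \sum_(i < N) x 0 i * y 0 i.
Definition enorm x : R := Num.sqrt (dot x x).
Definition eball x (r : R) : set 'rV[R]_N := [set y | enorm (y - x) < r].
Definition usphere : set 'rV[R]_N := [set x | enorm x = 1].

Definition unit_vec (i : 'I_N) : 'rV[R]_N := delta_mx 0 i.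

End euclidean.

(* Lebesgue measure on R^N: the Caratheodory restriction of the outer measure
   given by countable covers by half-open boxes. It is complete, so that it
   measures every quasi-open set. [None] stands for the empty box, which in
   dimension 0 is not of the form [Some (a, b)]. *)
Section lebesgue.
Context {R : realType} {N : nat}.
Implicit Types B : option ('rV[R]_N * 'rV[R]_N).

Definition box B : set 'rV[R]_N :=
  if B is Some (a, b)
  then [set x | forall i, a 0 i < x 0 i /\ x 0 i <= b 0 i] else set0.

Definition box_vol B : \bar R :=
  if B is Some (a, b)
  then (\prod_(i < N) Num.max 0 (b 0 i - a 0 i))%:E else 0%E.

Definition leb_outer (X : set 'rV[R]_N) : \bar R :=
  ereal_inf [set (\sum_(k <oo) box_vol (F k))%E
            | F in [set F : nat -> _ | X `<=` \bigcup_k box (F k)]].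

Local Open Scope ereal_scope.

Let box_vol_ge0 B : 0 <= box_vol B.
Proof.
case: B => [[a b]|] //=; rewrite lee_fin.
by apply: prodr_ge0 => i _; rewrite le_max lexx.
Qed.

Let leb_outer_ge0 X : 0 <= leb_outer X.
Proof.
by apply: le_ereal_inf_tmp => _ [F _ <-]; apply: nneseries_ge0 => n _ _.
Qed.

Let leb_outer0 : leb_outer set0 = 0.
Proof.
apply/eqP; rewrite eq_le leb_outer_ge0 andbT.
apply: ereal_inf_lbound; exists (fun=> None); first by move=> ? [].
by rewrite eseries0.
Qed.

Let le_leb_outer : {homo leb_outer : A B / A `<=` B >-> A <= B}.
Proof.
move=> A B AB; apply/ereal_inf_le_tmp => _ [F BF <-].
by exists F => //; apply: subset_trans AB BF.
Qed.

Let leb_outer_sigma_subadditive : sigma_subadditive leb_outer.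
Proof.
move=> A; have [[i ioo]|] := pselect (exists i, leb_outer (A i) = +oo).
  rewrite (eseries_pinfty _ _ ioo) ?leey// => n _.
  by rewrite -ltNye (lt_le_trans _ (leb_outer_ge0 _)).
rewrite -forallNE => Aoo.
suff add2e (e : {posnum R}) :
    leb_outer (\bigcup_n A n) <= \sum_(i <oo) leb_outer (A i) + e%:num%:E.
  by apply/lee_addgt0Pr => _/posnumP[].
rewrite (le_trans _ (epsilon_trick _ _ _))//.
pose P n (F : nat -> option ('rV[R]_N * 'rV[R]_N)) :=
  A n `<=` \bigcup_k box (F k) /\
  \sum_(k <oo) box_vol (F k) <=
    leb_outer (A n) + (e%:num / (2 ^ n.+1)%:R)%:E.
have [G PG] : {G & forall n, P n (G n)}.
  apply: (@choice _ _ P) => n; rewrite /P /leb_outer.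
  set S := (X in ereal_inf X); move infS : (ereal_inf S) => iS.
  case: iS infS => [r Sr|Soo|Soo].
  - have en1 : (0 < e%:num / (2 ^ n.+1)%:R)%R by [].
    have /(lb_ereal_inf_adherent en1) : ereal_inf S \is a fin_num by rewrite Sr.
    move=> [x [F AF <-] xS].
    by exists F; split => //; rewrite -Sr; exact/ltW.
  - by have := Aoo n; rewrite /leb_outer Soo.
  - by have := leb_outer_ge0 (A n); rewrite /leb_outer Soo.
pose g := uncurry G.
have g_ge0 x : 0 <= (box_vol \o g) x by exact: box_vol_ge0.
apply: (@le_trans _ _ (\esum_(i in setT) (box_vol \o g) i)).
  apply: ereal_inf_lbound => /=.
  have /card_esym/ppcard_eqP[f] := card_nat2.
  exists (g \o f).
    move=> t [i _ /(PG i).1[j _ Gt]].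
    by exists (f^-1%FUN (i, j)) => //=; rewrite invK ?inE.
  rewrite -(esum_pred_image (box_vol \o g) _ xpredT) ?[fun=> _]set_true//.
  by rewrite image_eq.
rewrite (_ : esum _ _ = \sum_(i <oo) \sum_(j <oo) box_vol (G i j)); last first.
  pose J : nat -> set (nat * nat) := fun i => [set (i, j) | j in setT].
  rewrite (_ : setT = \bigcup_k J k); last first.
    by rewrite predeqE => -[a b]; split => // _; exists a => //; exists b.
  rewrite esum_bigcupT /=; last 2 first.
    - apply/trivIsetP => i j _ _ ij.
      rewrite predeqE => -[n m] /=; split => //= -[] [_] _ [<-{n} _].
      by move=> [m' _] [] /esym/eqP; rewrite (negbTE ij).
    - by move=> [n m] /=; exact: box_vol_ge0.
  rewrite -(image_id [set: nat]) -fun_true esum_pred_image//; last first.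
    by move=> n _; exact: esum_ge0.
  apply: eq_eseriesr => /= j _.
  rewrite -(esum_pred_image (box_vol \o g) (pair j) predT)//=; last first.
    by move=> ? ? _ _; exact: (@can_inj _ _ _ snd).
  by congr esum; rewrite predeqE => -[a b]; split; move=> [i _ <-]; exists i.
apply: lee_lim.
- apply: is_cvg_nneseries => n *.
  by apply: nneseries_ge0 => m *; exact: (g_ge0 (n, m)).
- by apply: is_cvg_nneseries => n *; apply: adde_ge0.
by near=> n; apply: lee_sum => i _; exact: (PG i).2.
Unshelve. all: by end_near. Qed.

HB.instance Definition _ := isOuterMeasure.Build R 'rV[R]_N leb_outer
  leb_outer0 leb_outer_ge0 le_leb_outer leb_outer_sigma_subadditive.

End lebesgue.

Notation lebT R N := (caratheodory_type (@leb_outer R N)).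

Definition leb {R : realType} {N : nat} : set (lebT R N) -> \bar R :=
  @leb_outer R N.

HB.instance Definition _ (R : realType) (N : nat) :=
  isMeasure.Build _ (lebT R N) R (@leb R N)
    (@caratheodory_measure0 R _ (@leb_outer R N))
    (@caratheodory_measure_ge0 R _ (@leb_outer R N))
    (@caratheodory_measure_sigma_additive R _ (@leb_outer R N)).

Section smooth.
Context {R : realType} {N : nat}.
Implicit Types f : 'rV[R]_N -> R.

Fixpoint class_C (k : nat) f : Prop :=
  if k is k'.+1
  then continuous f /\
       forall i, (forall x, derivable f x (unit_vec i)) /\
                 class_C k' (fun x => 'D_(unit_vec i) f x)
  else continuous f.

Definition smooth f := forall k, class_C k f.

Definition test_function (U : set 'rV[R]_N) f :=
  smooth f /\
  exists K, [/\ compact K, K `<=` U & forall x, ~ K x -> f x = 0].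

End smooth.

Section sobolev.
Context {R : realType} {N : nat}.
Implicit Types (U S E Omega : set 'rV[R]_N).
Implicit Types (u v : 'rV[R]_N -> R) (g : 'rV[R]_N -> 'rV[R]_N).

Local Open Scope ereal_scope.

Definition sq_integrable U u :=
  measurable_fun (U : set (lebT R N)) u /\
  \int[leb]_(x in U) (u x ^+ 2)%:E < +oo.

Definition weak_gradient U u g :=
  forall (i : 'I_N) (phi : 'rV[R]_N -> R), test_function U phi ->
    \int[leb]_(x in U) (u x * 'D_(unit_vec i) phi x)%:E =
    - \int[leb]_(x in U) (g x 0%R i * phi x)%:E.

(* [H1 U u g]: the function u belongs to H^1(U), with weak gradient g. *)
Definition H1 U u g :=
  [/\ sq_integrable U u,
      forall i, sq_integrable U (fun x => g x 0%R i) &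
      weak_gradient U u g].

Definition capacity E : \bar R :=
  ereal_inf [set c | exists v g V,
    [/\ H1 setT v g,
        open V /\ E `<=` V,
        {ae @leb R N, forall x, V x -> (1 <= v x)%R} &
        c = \int[leb]_x (v x ^+ 2 + dot (g x) (g x))%:E]].

Definition quasi_open U :=
  forall e : R, (0 < e)%R ->
    exists V, [/\ open V, open (U `|` V) & capacity V <= e%:E].

Definition quasi_continuous S u :=
  forall e : R, (0 < e)%R ->
    exists V, [/\ open V, capacity V <= e%:E &
                  {within S `\` V, continuous u}].

(* Pointwise values of u up to capacity zero are those of a quasi-continuous
   representative, here ut. *)
Definition H10 S Omega u g :=
  H1 S u g /\
  exists ut, [/\ quasi_continuous S ut,
    {ae @leb R N, forall x, S x -> ut x = u x} &
    capacity [set x | (S `\` Omega) x /\ ut x <> 0%R] = 0].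

Definition lambda1 S Omega : \bar R :=
  ereal_inf [set c | exists u g,
    [/\ H10 S Omega u g,
        \int[leb]_(x in S) (u x ^+ 2)%:E = 1 &
        c = \int[leb]_(x in Omega) (dot (g x) (g x))%:E]].

Definition is_minimizer S (m : R) Omega :=
  [/\ Omega `<=` S, quasi_open Omega, leb Omega = m%:E &
      forall omega, omega `<=` S -> quasi_open omega -> leb omega = m%:E ->
        lambda1 S Omega <= lambda1 S omega].

(* Quasi-open sets are identified when they differ by a set of capacity zero. *)
Definition open_representative S Omega O :=
  [/\ open O, O `<=` S & capacity ((Omega `\` O) `|` (O `\` Omega)) = 0].

End sobolev.

Section cones.
Context {R : realType} {N : nat}.
Implicit Types D S : set 'rV[R]_N.

Definition sphere_boundary D := closure D `&` closure (usphere `\` D).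

(* The boundary is smooth when D is locally the sublevel set, in the sphere, of
   a smooth function with nonzero tangential gradient. *)
Definition smooth_domain D :=
  [/\ D `<=` usphere,
      exists2 U, open U & D = usphere `&` U,
      connected D,
      sphere_boundary D !=set0 &
      forall q, sphere_boundary D q ->
        exists W rho,
        [/\ open W, W q, smooth rho,
            D `&` W = usphere `&` W `&` [set x | rho x < 0] &
            exists2 v, dot v q = 0 & 'D_v rho q <> 0]].

Definition cone D : set 'rV[R]_N :=
  [set x | exists r q, [/\ 0 < r, D q & x = r *: q]].

(* Around every boundary point, in a ball of fixed radius, S is the epigraph in
   some unit direction e of a function on the hyperplane orthogonal to e, with
   a fixed Lipschitz constant. *)
Definition uniformly_lipschitz S :=
  exists r L : R, 0 < r /\
    forall x, (closure S `\` interior S) x ->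
      exists e (f : 'rV[R]_N -> R),
      [/\ enorm e = 1,
          forall y z, dot y e = 0 -> dot z e = 0 ->
            `|f y - f z| <= L * enorm (y - z) &
          S `&` eball x r =
            eball x r `&` [set y | f (y - dot y e *: e) < dot y e]].

End cones.

(* Main.v *)
From HB Require Import structures.
Require Import Defs.
From mathcomp Require Import all_boot all_order all_algebra.
From mathcomp Require Import ring lra.
From mathcomp Require Import all_classical all_reals all_analysis.
From mathcomp Require Import measurable_realfun.
Import Order.TTheory GRing.Theory Num.Theory.
Import numFieldNormedType.Exports.
Set Implicit Arguments.
Unset Strict Implicit.
Unset Printing Implicit Defensive.
Local Open Scope classical_set_scope.
Local Open Scope ring_scope.

(** A connected component of a disconnected minimizer could be dilated to the
    full volume, and this would lower the first eigenvalue.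

    Suppose that the open set O is the union of two disjoint nonempty open sets
    A and B. Take an admissible function u for Omega whose Rayleigh quotient is
    close to the eigenvalue l. Restricted to A and to B it gives two admissible
    functions, for A and for B, whose masses add up to the mass of u and whose
    Dirichlet energies add up to at most that of u, so that one of them, say the
    one on A, has a Rayleigh quotient no larger than that of u ([best_piece]). Both
    A and B have positive measure, so A has measure less than m, and some dilation
    of ratio t > 1 brings A to measure m. The cone is invariant under dilations, so
    the dilated set is a competitor, and its eigenvalue is at most t^-2 times the
    Rayleigh quotient of u on A ([lambda1_dilate]). As the ratio depends on A and B
    only and u is arbitrarily close to optimal, this contradicts minimality,
    provided that l is finite and positive ([minimizer_not_split]).

    Finiteness is easy, with a bump function inside O ([lambda1_finite]). Positivity
    is a Poincare inequality for functions of the cone carried by a set of finite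
    measure ([poincare]). The Lipschitz condition at the vertex, propagated by
    dilations, provides a solid cone of directions h with S + h contained in S
    ([cone_translations]). For such h the square mean of u(x + h) - u(x) over S is at
    most |h|^2 times the energy, up to a constant ([int_diff_sq_le]), while, on
    average over a large ball of such h, most of the mass of u(. + h) has left the
    carrier ([mass_escapes]).

    The delicate point is that the restriction of u to A has a weak gradient
    on the whole cone ([restriction_weak_gradient]): A is open, but the
    function u vanishes only quasi-everywhere off O. Off an open set E of small
    capacity, a representative ut of u is continuous and vanishes off A and B. Let
    v be a capacitary function of E, let G be a truncation that vanishes near 0 and
    let R be a cut-off that vanishes beyond 1. The product G(u) R(v) is carried, in
    any compact part of S, by a compact set on which |ut| is bounded below and
    which splits into a compact part of A and a compact part of B
    ([live_separation]). A short translation cannot lead from one to the other, so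
    the restriction to A commutes with difference quotients
    ([product_restriction]). Difference quotients of Sobolev functions
    converge locally in square mean ([diff_quotient_null]) and determine weak
    derivatives ([weak_derivative_of_quotients]). It remains to let the capacity of
    E tend to 0, so that R(v) disappears ([truncation_restriction]), and then to let
    G tend to the identity. *)

(** * Square-integrable functions *)

Ltac mfun := repeat first
  [ assumption
  | exact: measurable_id
  | exact: measurable_cst
  | apply: measurable_funD
  | apply: measurable_funB
  | apply: measurable_funM
  | apply: measurable_funX
  | apply: measurableT_comp; first exact: normr_measurable
  | apply: measurableT_comp; first exact: oppr_measurable
  | done ].

Section real_integrals.
Context d (T : measurableType d) (R : realType) (mu : {measure set T -> \bar R}).
Implicit Types (f g h : T -> R) (c : R).

Notation mf f := (measurable_fun [set: T] f).
Notation int f := (\int[mu]_x f x).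

(** Integrals are kept real-valued, so that linear arithmetic applies to them;
    finiteness is recorded separately. *)
Definition summable_fun f := mu.-integrable setT (EFin \o f).

Lemma summable_mf f : summable_fun f -> mf f.
Proof. by move=> /integrableP[/measurable_EFinP]. Qed.

Lemma summable_dom f h : mf f -> summable_fun h ->
  {ae mu, forall x, `|f x| <= h x} -> summable_fun f.
Proof.
move=> f_m h_i fh; apply/integrableP; split; first exact/measurable_EFinP.
have /integrableP[hm hoo] := h_i.
apply: le_lt_trans hoo; apply: ae_ge0_le_integral => //.
- by do 2 apply: measurableT_comp => //.
- by apply: measurableT_comp.
- apply: filterS fh => x fx _ /=; rewrite lee_fin (le_trans fx)//.
  exact: ler_norm.
Qed.

Lemma summable_fun_add f g : summable_fun f -> summable_fun g ->
  summable_fun (fun x => f x + g x).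
Proof. by move=> fi gi; exact: (integrableD measurableT fi gi). Qed.

Lemma summable_fun_sub f g : summable_fun f -> summable_fun g ->
  summable_fun (fun x => f x - g x).
Proof. by move=> fi gi; exact: (integrableB measurableT fi gi). Qed.

Lemma summableZ c f : summable_fun f -> summable_fun (fun x => c * f x).
Proof. by move=> fi; exact: (integrableZl measurableT c fi). Qed.

Lemma summable_fun_opp f : summable_fun f -> summable_fun (fun x => - f x).
Proof. by move=> fi; exact: (integrableN fi). Qed.

Lemma summable_norm f : summable_fun f -> summable_fun (fun x => `|f x|).
Proof. by move=> fi; exact: integrable_norm. Qed.

Lemma summable0 : summable_fun (fun=> 0).
Proof. exact: integrable0. Qed.

Lemma summable_bdM f h c : mf h -> (forall x, `|h x| <= c) -> summable_fun f ->
  summable_fun (fun x => h x * f x).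
Proof.
move=> hm hc fi; have f_m := summable_mf fi.
apply: (@summable_dom _ (fun x => c * `|f x|)); first by mfun.
  exact/summableZ/summable_norm.
by apply: aeW => x; rewrite normrM ler_wpM2r.
Qed.

Lemma intD f g : summable_fun f -> summable_fun g ->
  int (fun x => f x + g x) = int f + int g.
Proof. by move=> fi gi; rewrite RintegralD. Qed.

Lemma intB f g : summable_fun f -> summable_fun g ->
  int (fun x => f x - g x) = int f - int g.
Proof. by move=> fi gi; rewrite RintegralB. Qed.

Lemma intZ c f : summable_fun f -> int (fun x => c * f x) = c * int f.
Proof. by move=> fi; rewrite RintegralZl. Qed.

Lemma intN f : summable_fun f -> int (fun x => - f x) = - int f.
Proof.
move=> fi; rewrite -mulN1r -intZ//; apply: eq_Rintegral => x _.
by rewrite mulN1r.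
Qed.

Lemma le_int f g : summable_fun f -> summable_fun g ->
  {ae mu, forall x, f x <= g x} -> int f <= int g.
Proof.
move=> fi gi fg; rewrite -subr_ge0 -intB//.
have -> : int (fun x => g x - f x) = int (fun x => `|g x - f x|).
  rewrite /Rintegral; congr fine; apply: ae_eq_integral => //.
  - by apply/measurable_EFinP; apply: summable_mf; exact: summable_fun_sub.
  - apply/measurable_EFinP; apply: summable_mf.
    exact/summable_norm/summable_fun_sub.
  - by apply: filterS fg => x fgx _; rewrite ger0_norm// subr_ge0.
exact: Rintegral_ge0.
Qed.

Lemma eq_int f g : mf f -> mf g -> {ae mu, forall x, f x = g x} ->
  int f = int g.
Proof.
move=> f_m g_m fg; rewrite /Rintegral; congr fine; apply: ae_eq_integral => //.
- exact/measurable_EFinP.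
- exact/measurable_EFinP.
- by apply: filterS fg => x -> _.
Qed.

Lemma norm_int f : summable_fun f -> `|int f| <= int (fun x => `|f x|).
Proof. by move=> fi; exact: le_normr_Rintegral. Qed.

Lemma int_ge0 f : (forall x, 0 <= f x) -> 0 <= int f.
Proof. by move=> f0; exact: Rintegral_ge0. Qed.

Lemma EFin_int f : summable_fun f -> (int f)%:E = (\int[mu]_x (f x)%:E)%E.
Proof. by move=> fi; rewrite /Rintegral fineK// integrable_fin_num. Qed.

Definition sq_summable f := mf f /\ summable_fun (fun x => f x ^+ 2).

Lemma sq_summableP f : sq_summable f <->
  mf f /\ (\int[mu]_x (f x ^+ 2)%:E < +oo)%E.
Proof.
split=> -[f_m fi]; split=> //.
  exact: integrable_lty.
apply/integrableP; split; first by apply/measurable_EFinP; mfun.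
by under eq_integral => x _ do rewrite /= ger0_norm ?sqr_ge0//.
Qed.

Lemma sq_summable_mf f : sq_summable f -> mf f.
Proof. by case. Qed.

Lemma sq_summable_dom f g c : mf f -> sq_summable g ->
  {ae mu, forall x, `|f x| <= c * `|g x|} -> sq_summable f.
Proof.
move=> f_m [gm gi] fg; split=> //.
apply: (@summable_dom _ (fun x => c ^+ 2 * g x ^+ 2)); first by mfun.
  exact: summableZ.
apply: filterS fg => x fx; rewrite normrX -[g x ^+ 2]real_normK ?num_real//.
by rewrite -exprMn lerXn2r ?nnegrE// (le_trans _ fx).
Qed.

Lemma sq_summableM f g : sq_summable f -> sq_summable g ->
  summable_fun (fun x => f x * g x).
Proof.
move=> [f_m fi] [gm gi].
apply: (@summable_dom _ (fun x => f x ^+ 2 + g x ^+ 2)); first by mfun.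
  exact: summable_fun_add.
apply: aeW => x; rewrite normrM -[f x ^+ 2]real_normK ?num_real//.
rewrite -[g x ^+ 2]real_normK ?num_real//.
have := sqr_ge0 (`|f x| - `|g x|); have := sqr_ge0 (`|f x|).
by have := sqr_ge0 (`|g x|); nra.
Qed.

Lemma sq_summableD f g : sq_summable f -> sq_summable g ->
  sq_summable (fun x => f x + g x).
Proof.
move=> fs gs; have [f_m fi] := fs; have [gm gi] := gs; split; first by mfun.
have -> : (fun x => (f x + g x) ^+ 2) =
    (fun x => f x ^+ 2 + g x ^+ 2 + 2 * (f x * g x)).
  by apply/funext => x; ring.
by apply: summable_fun_add; [exact: summable_fun_add|apply: summableZ; exact: sq_summableM].
Qed.

Lemma sq_summableZ c f : sq_summable f -> sq_summable (fun x => c * f x).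
Proof.
move=> fs; apply: (@sq_summable_dom _ f `|c|) => //.
  by have [f_m _] := fs; mfun.
by apply: aeW => x; rewrite normrM.
Qed.

Lemma sq_summableN f : sq_summable f -> sq_summable (fun x => - f x).
Proof.
move=> fs; apply: (@sq_summable_dom _ f 1) => //.
  by have [f_m _] := fs; mfun.
by apply: aeW => x; rewrite normrN mul1r.
Qed.

Lemma sq_summableB f g : sq_summable f -> sq_summable g ->
  sq_summable (fun x => f x - g x).
Proof. by move=> fs gs; apply: sq_summableD => //; exact: sq_summableN. Qed.

Lemma sq_summable_bdM f h c : mf h -> (forall x, `|h x| <= c) -> sq_summable f ->
  sq_summable (fun x => h x * f x).
Proof.
move=> hm hc fs; have [f_m fi] := fs.
apply: (@sq_summable_dom _ f c) => //; first by mfun.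
by apply: aeW => x; rewrite normrM ler_wpM2r.
Qed.

Lemma int_sq_ge0 f : 0 <= int (fun x => f x ^+ 2).
Proof. by apply: int_ge0 => x; exact: sqr_ge0. Qed.

Lemma int_mul_le f g c : 0 < c -> sq_summable f -> sq_summable g ->
  2 * int (fun x => `|f x * g x|) <=
  c * int (fun x => f x ^+ 2) + c^-1 * int (fun x => g x ^+ 2).
Proof.
move=> c0 fs gs; have [f_m fi] := fs; have [gm gi] := gs.
rewrite -!intZ//; last exact/summable_norm/sq_summableM.
rewrite -intD; [|exact: summableZ|exact: summableZ].
apply: le_int.
- by apply: summableZ; exact/summable_norm/sq_summableM.
- by apply: summable_fun_add; exact: summableZ.
apply: aeW => x; rewrite normrM -[f x ^+ 2]real_normK ?num_real//.
rewrite -[g x ^+ 2]real_normK ?num_real//.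
set a := `|f x|; set b := `|g x|.
have -> : c * a ^+ 2 + c^-1 * b ^+ 2 = 2 * (a * b) + c^-1 * (c * a - b) ^+ 2.
  by field; rewrite gt_eqF.
by rewrite lerDl mulr_ge0 ?sqr_ge0 ?invr_ge0 ?ltW.
Qed.

Lemma int_sq_add_le f g : sq_summable f -> sq_summable g ->
  int (fun x => (f x + g x) ^+ 2) <=
  2 * int (fun x => f x ^+ 2) + 2 * int (fun x => g x ^+ 2).
Proof.
move=> fs gs; have [_ fi] := fs; have [_ gi] := gs.
rewrite -!intZ// -intD; [|exact: summableZ|exact: summableZ].
apply: le_int; first by have [] := sq_summableD fs gs.
  by apply: summable_fun_add; exact: summableZ.
by apply: aeW => x; have := sqr_ge0 (f x - g x); nra.
Qed.

Definition mean_null (f : nat -> T -> R) := (forall n, summable_fun (f n)) /\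
  (fun n => int (fun x => `|f n x|)) @ \oo --> (0 : R).

Definition sqmean_null (f : nat -> T -> R) := (forall n, sq_summable (f n)) /\
  (fun n => int (fun x => f n x ^+ 2)) @ \oo --> (0 : R).

Lemma cvg0_le (a b : nat -> R) : (forall n, 0 <= a n <= b n) ->
  b @ \oo --> (0 : R) -> a @ \oo --> (0 : R).
Proof.
move=> ab b0; apply: (@squeeze_cvgr _ _ _ _ (fun=> 0) b) => //.
  by apply: nearW.
exact: cvg_cst.
Qed.

Lemma cvg0Z (c : R) (a : nat -> R) : a @ \oo --> (0 : R) ->
  (fun n => c * a n) @ \oo --> (0 : R).
Proof. by move=> a0; have := cvgM (cvg_cst c) a0; rewrite mulr0; exact. Qed.

Lemma cvg0D (a b : nat -> R) : a @ \oo --> (0 : R) -> b @ \oo --> (0 : R) ->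
  (fun n => a n + b n) @ \oo --> (0 : R).
Proof. by move=> a0 b0; have := cvgD a0 b0; rewrite addr0; exact. Qed.

Lemma mean_null_cvg (f : nat -> T -> R) g : summable_fun g ->
  mean_null (fun n x => f n x - g x) ->
  (fun n => int (f n)) @ \oo --> int g.
Proof.
move=> gi [fi f0]; apply/cvgrPdist_lt => e e0.
move/cvgrPdist_lt : f0 => /(_ _ e0); apply: filterS => n.
rewrite sub0r normrN ger0_norm; last by apply: int_ge0.
apply: le_lt_trans.
have fni : summable_fun (f n).
  have -> : f n = fun x => (f n x - g x) + g x by apply/funext => x; rewrite subrK.
  exact: summable_fun_add.
by rewrite distrC -intB//; exact: norm_int.
Qed.

Lemma mean_null_dom (f h : nat -> T -> R) : (forall n, mf (f n)) -> mean_null h ->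
  (forall n, {ae mu, forall x, `|f n x| <= h n x}) -> mean_null f.
Proof.
move=> f_m [hi h0] fh; have fi n : summable_fun (f n) by exact: summable_dom (fh n).
split=> //; apply: cvg0_le h0 => n; apply/andP; split; first exact: int_ge0.
apply: le_int; [exact: summable_norm|exact: summable_norm|].
by apply: filterS (fh n) => x /le_trans; apply; exact: ler_norm.
Qed.

Lemma mean_nullD (f h : nat -> T -> R) : mean_null f -> mean_null h ->
  mean_null (fun n x => f n x + h n x).
Proof.
move=> [fi f0] [hi h0]; split=> [n|]; first exact: summable_fun_add.
apply: cvg0_le (cvg0D f0 h0) => n.
apply/andP; split; first exact: int_ge0.
rewrite -intD; [|exact: summable_norm|exact: summable_norm].
apply: le_int; first exact/summable_norm/summable_fun_add.
  by apply: summable_fun_add; exact: summable_norm.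
by apply: aeW => x; exact: ler_normD.
Qed.

Lemma mean_nullZ c (f : nat -> T -> R) : mean_null f ->
  mean_null (fun n x => c * f n x).
Proof.
move=> [fi f0]; split=> [n|]; first exact: summableZ.
apply: cvg0_le (cvg0Z `|c| f0) => n; apply/andP; split; first exact: int_ge0.
rewrite -intZ; last exact: summable_norm.
under eq_Rintegral do rewrite normrM.
by [].
Qed.

Lemma sqmean_null_sq (f : nat -> T -> R) : sqmean_null f ->
  mean_null (fun n x => f n x ^+ 2).
Proof.
move=> [fi f0]; split=> [n|]; first by have [] := fi n.
apply: cvg0_le f0 => n; apply/andP; split; first exact: int_ge0.
have [_ fi2] := fi n; apply: le_int => //; first exact: summable_norm.
by apply: aeW => x; rewrite ger0_norm// sqr_ge0.
Qed.

(** Products of a null sequence with a bounded one: the Cauchy-Schwarz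
    inequality in the weighted form [2ab <= c a^2 + b^2/c]. *)
Lemma sqmean_nullM (f h : nat -> T -> R) M : sqmean_null f ->
  (forall n, sq_summable (h n)) -> (forall n, int (fun x => h n x ^+ 2) <= M) ->
  mean_null (fun n x => f n x * h n x).
Proof.
move=> [fi f0] hi hM; split=> [n|]; first exact: sq_summableM.
apply/cvgr0Pnorm_lt => e e0.
pose M' := `|M| + 1; have M'0 : 0 < M' by rewrite ltr_wpDl.
pose c := M' / e; have c0 : 0 < c by rewrite divr_gt0.
have e1 : 0 < e / c by rewrite divr_gt0.
move/cvgr0Pnorm_lt : f0 => /(_ _ e1); apply: filterS => n.
rewrite ger0_norm; last exact: int_sq_ge0.
rewrite ger0_norm; last exact: int_ge0.
rewrite ltr_pdivlMr// => h1.
have := int_mul_le c0 (fi n) (hi n).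
have : c^-1 * int (fun x => h n x ^+ 2) <= e.
  rewrite /c invf_div mulrC mulrCA ger_pMr// ler_pdivrMr// mul1r.
  by rewrite (le_trans (hM n))// (le_trans (ler_norm _))// /M' lerDl.
by move: h1 => *; lra.
Qed.

Lemma mean_null_dct (f : nat -> T -> R) h : (forall n, mf (f n)) ->
  summable_fun h -> (forall n, {ae mu, forall x, `|f n x| <= h x}) ->
  {ae mu, forall x, (f ^~ x) @ \oo --> (0 : R)} -> mean_null f.
Proof.
move=> f_m hi fh f0.
have fi n : summable_fun (f n) by exact: summable_dom (fh n).
split=> //.
have [|||||_ + _] := @dominated_convergence _ _ _ mu setT measurableT
   (fun n x => (f n x)%:E) (cst 0%E) (EFin \o h).
- by move=> n; exact/measurable_EFinP.
- by [].
- by apply: filterS f0 => x fx _; apply/fine_cvgP; split; [exact: nearW|exact: fx].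
- exact: hi.
- have : {ae mu, forall x, forall n, `|f n x| <= h x} by apply/ae_foralln.
  by apply: filterS => x fx n _; rewrite lee_fin.
move=> /fine_cvgP[_ /=]; rewrite /Rintegral.
apply: cvg_trans; apply: near_eq_cvg; near=> n => /=.
by congr fine; apply: eq_integral => x _; rewrite subr0.
Unshelve. all: by end_near. Qed.

Lemma sqmean_null_dct (f : nat -> T -> R) h : (forall n, mf (f n)) ->
  sq_summable h -> (forall n, {ae mu, forall x, `|f n x| <= `|h x|}) ->
  {ae mu, forall x, (f ^~ x) @ \oo --> (0 : R)} -> sqmean_null f.
Proof.
move=> f_m [hm hi] fh f0.
have [||||fi fc] := @mean_null_dct (fun n x => f n x ^+ 2) (fun x => h x ^+ 2).
- by move=> n; mfun.
- exact: hi.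
- move=> n; apply: filterS (fh n) => x fx; rewrite normrX.
  by rewrite -[h x ^+ 2]real_normK ?num_real// lerXn2r ?nnegrE.
- apply: filterS f0 => x fx.
  by have := cvgM fx fx; rewrite mulr0; exact.
split=> [n|]; first by split.
apply: cvg0_le fc => n; apply/andP; split; first exact: int_sq_ge0.
apply: le_int => //; first exact: summable_norm.
by apply: aeW => x; exact: ler_norm.
Qed.

End real_integrals.

(** * Lebesgue measure under dilations and translations *)

Section lebesgue_measure_facts.
Context {R : realType} {N : nat}.
Implicit Types (x y h : 'rV[R]_N) (t r : R).
Notation leb_outer := (@leb_outer R N).
Notation T := (lebT R N).
Notation mu := (@leb R N).

Definition dilate t h x := t *: x + h.

Lemma dilateK t h : t != 0 -> cancel (dilate t^-1 (- (t^-1 *: h))) (dilate t h).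
Proof.
move=> t0 x; rewrite /dilate scalerDr scalerN !scalerA divff// !scale1r.
by rewrite subrK.
Qed.

Lemma dilateKV t h : t != 0 -> cancel (dilate t h) (dilate t^-1 (- (t^-1 *: h))).
Proof. by move=> t0 x; rewrite /dilate scalerDr scalerA mulVf// scale1r addrK. Qed.

Lemma rat_near (a e : R) : 0 < e -> exists q : rat, `|a - ratr q| < e.
Proof.
move=> e0; have ae : a - e < a + e by lra.
have [q] := rat_in_itvoo ae; rewrite in_itv/= => /andP[? ?].
by exists q; rewrite ltr_norml; apply/andP; split; lra.
Qed.

Lemma box_vol_ge0 (B : option ('rV[R]_N * 'rV[R]_N)) : (0 <= box_vol B)%E.
Proof.
case: B => [[a b]|] //=; rewrite lee_fin.
by apply: prodr_ge0 => i _; rewrite le_max lexx.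
Qed.

(** The preimages of the boxes of a cover are boxes, with volumes multiplied by
    [t^-1 ^+ N]. *)
Lemma leb_outer_dilate_le t h (X : set 'rV[R]_N) : 0 < t ->
  (leb_outer (dilate t h @^-1` X) <= (t^-1 ^+ N)%:E * leb_outer X)%E.
Proof.
move=> t0; have c0 : 0 < t ^+ N by rewrite exprn_gt0.
rewrite exprVn -lee_pdivrMl ?invr_gt0// invrK.
apply: le_ereal_inf_tmp => _ [F XF <-].
rewrite -lee_pdivlMl// -nneseriesZl; last by move=> i _; exact: box_vol_ge0.
apply: ge_ereal_inf.
pose F' k := omap (fun ab => (dilate t^-1 (- (t^-1 *: h)) ab.1,
                              dilate t^-1 (- (t^-1 *: h)) ab.2)) (F k).
exists (\sum_(k <oo) box_vol (F' k))%E.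
  exists F' => // x /XF[k _ Fx]; exists k => //; rewrite /F'.
  case: (F k) Fx => [[a b]|]//= Fx i; have [] := Fx i; rewrite !mxE => ai bi.
  by rewrite -!mulrBr ler_pdivlMl// ltr_pdivrMl//; split; lra.
rewrite le_eqVlt; apply/orP; left; apply/eqP; apply: eq_eseriesr => k _.
rewrite /F'; case: (F k) => [[a b]|] /=; last by rewrite mule0.
rewrite -EFinM -exprVn -[X in _ ^+ X]card_ord -prodr_const -big_split/=.
congr EFin; apply: eq_bigr => i _; rewrite !mxE.
rewrite maxr_pMr ?invr_ge0 ?ltW// mulr0; congr Num.max; ring.
Qed.

Lemma leb_outer_dilate t h (X : set 'rV[R]_N) : 0 < t ->
  leb_outer (dilate t h @^-1` X) = ((t^-1 ^+ N)%:E * leb_outer X)%E.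
Proof.
move=> t0; apply/eqP; rewrite eq_le leb_outer_dilate_le//=.
have c0 : 0 < t ^+ N by rewrite exprn_gt0.
rewrite exprVn lee_pdivrMl//.
have t'0 : 0 < t^-1 by rewrite invr_gt0.
have := leb_outer_dilate_le (- (t^-1 *: h)) (dilate t h @^-1` X) t'0.
rewrite -comp_preimage invrK.
rewrite (_ : _ \o _ = id)//; apply/funext => x /=.
by rewrite dilateK// gt_eqF.
Qed.

Lemma dilate_measurable t h : 0 < t -> measurable_fun [set: T] (dilate t h : T -> T).
Proof.
move=> t0 _ Y mY; rewrite setTI.
suff : leb_outer.-caratheodory (dilate t h @^-1` Y) by [].
move=> X; have {}mY : leb_outer.-caratheodory Y by exact: mY.
have tn0 : t != 0 by rewrite gt_eqF.
have XE : X = dilate t h @^-1` (dilate t^-1 (- (t^-1 *: h)) @^-1` X).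
  rewrite -comp_preimage (_ : _ \o _ = id)//; apply/funext => x /=.
  by rewrite dilateKV.
rewrite {}XE preimage_setC -!preimage_setI !(leb_outer_dilate _ _ t0).
move: (_ @^-1` X) => Z.
rewrite -muleDr//; last by apply: ge0_adde_def; rewrite inE outer_measure_ge0.
by congr (_ * _)%E; exact: mY.
Qed.

Definition scale_factor t (t0 : 0 < t) : {nonneg R} :=
  NngNum (exprn_ge0 N (ltW (eq_ind_r (fun b => is_true b) t0 (invr_gt0 t)))).

Lemma ge0_int_dilate t h (f : T -> \bar R) : 0 < t ->
  measurable_fun [set: T] f -> (forall x, 0 <= f x)%E ->
  (\int[mu]_x f (dilate t h x) = (t^-1 ^+ N)%:E * \int[mu]_x f x)%E.
Proof.
move=> t0 mf f0; have mt := dilate_measurable h t0.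
have := @ge0_integral_pushforward _ _ _ _ R _ mt mu setT f measurableT mf (fun y _ => f0 y).
rewrite preimage_setT => <-.
rewrite (eq_measure_integral (mscale (scale_factor t0) mu)); last first.
  by move=> A mA _; exact: leb_outer_dilate.
by rewrite ge0_integral_mscale.
Qed.

Lemma summable_dilate t h (f : T -> R) : 0 < t -> summable_fun mu f ->
  summable_fun mu (fun x => f (dilate t h x)).
Proof.
move=> t0 fi; have /integrableP[mf foo] := fi.
apply/integrableP; split.
  exact: (measurableT_comp mf (dilate_measurable h t0)).
have := @ge0_int_dilate t h (fun x => `|(EFin \o f) x|%E) t0.
move=> -> //.
  apply: lte_mul_pinfty => //; first by rewrite lee_fin exprn_ge0 ?invr_ge0 ?ltW.
by apply: measurableT_comp.
Qed.

Lemma int_dilate t h (f : T -> R) : 0 < t -> summable_fun mu f ->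
  \int[mu]_x f (dilate t h x) = t^-1 ^+ N * \int[mu]_x f x.
Proof.
move=> t0 fi; have /integrableP[mf foo] := fi.
have mt := dilate_measurable h t0.
have fn : summable_fun mu f^\- by exact: integrable_funrneg.
have fp : summable_fun mu f^\+ by exact: integrable_funrpos.
have fE : f = fun x => f^\+ x - f^\- x by
  by apply/funext => x; rewrite -[in LHS](funrposBneg f).
have pos g : summable_fun mu g -> (forall x, 0 <= g x) ->
   \int[mu]_x g (dilate t h x) = t^-1 ^+ N * \int[mu]_x g x.
  move=> gi g0; rewrite /Rintegral (@ge0_int_dilate t h (fun x => (g x)%:E))//.
  - by rewrite fineM//; exact: integrable_fin_num.
  by case/integrableP : gi.
rewrite [in LHS]fE [in RHS]fE !intB//; [|exact: summable_dilate..].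
by rewrite mulrBr !pos.
Qed.

Lemma dilate1 h : dilate 1 h = fun x => x + h.
Proof. by apply/funext => x; rewrite /dilate scale1r. Qed.

Lemma shift_measurable h : measurable_fun [set: T] ((fun x => x + h) : T -> T).
Proof. by rewrite -dilate1; exact: dilate_measurable. Qed.

Lemma summable_shift h (f : T -> R) : summable_fun mu f ->
  summable_fun mu (fun x => f (x + h)).
Proof.
move=> fi; have := summable_dilate h ltr01 fi.
by congr (summable_fun _); apply/funext => x; rewrite dilate1.
Qed.

Lemma int_shift h (f : T -> R) : summable_fun mu f ->
  \int[mu]_x f (x + h) = \int[mu]_x f x.
Proof.
move=> fi; have := int_dilate h ltr01 fi.
rewrite invr1 expr1n mul1r => <-.
by under [in RHS]eq_Rintegral do rewrite dilate1.
Qed.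

Lemma mf_shift h (f : T -> R) : measurable_fun [set: T] f ->
  measurable_fun [set: T] (fun x => f (x + h)).
Proof. by move=> mf; apply: (measurableT_comp mf); exact: shift_measurable. Qed.

Lemma sq_summable_shift h (f : T -> R) : sq_summable mu f ->
  sq_summable mu (fun x => f (x + h)).
Proof.
move=> [mf fi]; split; first exact: mf_shift.
exact: (@summable_shift h (fun x => f x ^+ 2)).
Qed.

(** A hyperplane orthogonal to an axis cuts every box of a cover into two boxes of
    the same total volume, which is the criterion of Caratheodory. *)
Lemma measurable_halfspace (i : 'I_N) (c : R) :
  measurable ([set x | x 0 i <= c] : set T).
Proof.
apply: le_caratheodory_measurable => X.
apply: le_ereal_inf_tmp => _ [F XF <-].
pose upd (a : 'rV[R]_N) v : 'rV[R]_N := \row_j (if j == i then v else a 0 j).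
pose F1 k := omap (fun ab => (ab.1, upd ab.2 (Num.min (ab.2 0 i) c))) (F k).
pose F2 k := omap (fun ab => (upd ab.1 (Num.max (ab.1 0 i) c), ab.2)) (F k).
apply: (@le_trans _ _
  (\sum_(k <oo) box_vol (F1 k) + \sum_(k <oo) box_vol (F2 k))%E).
  apply: leeD.
  - apply: ereal_inf_lbound; exists F1 => // x [/XF[k _ Fx] xc]; exists k => //.
    rewrite /F1; case: (F k) Fx => [[a b]|]//= Fx j; have [? ?] := Fx j.
    split=> //; rewrite mxE; case: eqP => // ->; rewrite le_min xc andbT.
    by have [] := Fx i.
  - apply: ereal_inf_lbound; exists F2 => // x [/XF[k _ Fx] xc]; exists k => //.
    rewrite /F2; case: (F k) Fx => [[a b]|]//= Fx j; have [? ?] := Fx j.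
    split=> //; rewrite mxE; case: eqP => // ->; rewrite gt_max.
    by have [-> _] := Fx i; move/negP : xc; rewrite -ltNge.
rewrite -nneseriesD; [|by move=> *; exact: box_vol_ge0..].
apply: lee_nneseries => k _; first by rewrite adde_ge0// box_vol_ge0.
rewrite /F1 /F2; case: (F k) => [[a b]|]/=; last by rewrite adde0.
rewrite -EFinD lee_fin [X in X + _](bigD1 i)//= [X in _ + X](bigD1 i)//= [leRHS](bigD1 i)//=.
rewrite !mxE eqxx.
have eqp (u : 'rV[R]_N) v (w : 'rV[R]_N) :
    \prod_(j < N | j != i) Num.max 0 ((upd u v) 0 j - w 0 j) =
    \prod_(j < N | j != i) Num.max 0 (u 0 j - w 0 j).
  by apply: eq_bigr => j /negbTE ji; rewrite mxE ji.
have eqp' (u : 'rV[R]_N) v (w : 'rV[R]_N) :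
    \prod_(j < N | j != i) Num.max 0 (w 0 j - (upd u v) 0 j) =
    \prod_(j < N | j != i) Num.max 0 (w 0 j - u 0 j).
  by apply: eq_bigr => j /negbTE ji; rewrite mxE ji.
rewrite eqp eqp' -mulrDl ler_wpM2r//.
  by apply: prodr_ge0 => j _; rewrite le_max lexx.
move: (a 0 i) (b 0 i) => u v; rewrite /Num.max /Num.min.
by repeat case: ifP => ?; lra.
Qed.

Lemma mf_coord (i : 'I_N) : measurable_fun [set: T] (fun x : T => x 0 i : R).
Proof.
apply: (measurability _ (RGenOInfty.measurableE R)) => //.
move=> _ [_ [c ->] <-]; rewrite setTI.
rewrite (_ : _ @^-1` _ = ~` [set x : T | x 0 i <= c]); last first.
  apply/seteqP; split=> x /=; rewrite in_itv/= andbT ltNge; first by move/negP.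
  by move=> ?; apply/negP.
exact/measurableC/measurable_halfspace.
Qed.

Lemma normv_ltP x r : reflect (0 < r /\ forall i, `|x 0 i| < r) (`|x| < r).
Proof.
have bE : (ball (0 : 'rV[R]_N) r x : Prop) <-> `|x| < r.
  by rewrite -ball_normE /ball_ /= sub0r normrN.
apply: (iffP idP).
  move/bE => [r0 xr]; split=> // i; have := xr 0 i.
  by rewrite /ball/= mxE sub0r normrN.
move=> [r0 xr]; apply/bE; split=> // i j; rewrite (ord1 i) /ball/= mxE.
by rewrite sub0r normrN.
Qed.

Lemma normv_leP x r : 0 <= r -> (forall i, `|x 0 i| <= r) -> `|x| <= r.
Proof.
move=> r0 xr; apply/ler_addgt0Pr => e e0; apply/ltW/normv_ltP.
by split=> [|i]; [rewrite ltr_wpDl|rewrite (le_lt_trans (xr i))// ltrDl].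
Qed.

Lemma coord_le_normv x (i : 'I_N) : `|x 0 i| <= `|x|.
Proof.
apply/ler_addgt0Pr => e e0; apply/ltW.
by have /normv_ltP[_ ] : `|x| < `|x| + e by rewrite ltrDl.
Qed.

Lemma measurable_vball x r : measurable ([set y | `|y - x| < r] : set T).
Proof.
have [r0|r0] := ltP 0 r; last first.
  rewrite (_ : [set y | _] = set0)//; apply/seteqP; split=> y //=.
  by rewrite ltNge (le_trans r0).
rewrite (_ : [set y | _] =
  \bigcap_(i in [set: 'I_N]) ((fun y : T => y 0 i - x 0 i) @^-1` [set s : R | `|s| < r])).
  apply: fin_bigcap_measurable => // i _; rewrite -[X in measurable X]setTI.
  apply: (measurable_funB (mf_coord i) (measurable_cst _)) => //.
  rewrite (_ : [set s | _] = `]-r, r[%classic); first exact: measurable_itv.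
  by apply/seteqP; split=> s /=; rewrite in_itv/= ltr_norml.
apply/seteqP; split=> y /=.
  by move=> /normv_ltP[_ yr] i _ /=; have := yr i; rewrite !mxE.
by move=> yr; apply/normv_ltP; split=> // i; have := yr i I; rewrite !mxE.
Qed.

(** Balls with rational centres and radii [1/(n+1)]; a nonpositive radius encodes an
    index that is not used. *)
Lemma open_ball_cover (U : set 'rV[R]_N) : open U ->
  exists (c : nat -> 'rV[R]_N) (r : nat -> R),
    U = \bigcup_k [set y | `|y - c k| < r k] /\
    forall k y, 0 < r k -> `|y - c k| <= r k -> U y.
Proof.
move=> oU.
pose ctr (qn : 'rV[rat]_N * nat) : 'rV[R]_N := map_mx ratr qn.1.
pose good (qn : 'rV[rat]_N * nat) := `[< forall y, `|y - ctr qn| <= qn.2.+1%:R^-1 -> U y >].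
pose dec k : option ('rV[rat]_N * nat) :=
  obind (fun qn => if good qn then Some qn else None) (unpickle k).
exists (fun k => oapp ctr 0 (dec k)), (fun k => oapp (fun qn => qn.2.+1%:R^-1) 0 (dec k)).
have inU k y : 0 < oapp (fun qn => qn.2.+1%:R^-1) 0 (dec k) :> R ->
    `|y - oapp ctr 0 (dec k)| <= oapp (fun qn => qn.2.+1%:R^-1) 0 (dec k) -> U y.
  rewrite /dec; case: unpickle => [qn|]/=; last by rewrite ltxx.
  by case: ifPn => /=; [move=> /asboolP gd _; exact: gd|rewrite ltxx].
split=> //; apply/seteqP; split=> x; last first.
  by move=> [k _ /= xk]; apply: (inU k) (ltW xk); rewrite (le_lt_trans _ xk).
move=> Ux; have /nbhs_ballP[e /= e0 eU] : nbhs x U by exact: open_nbhs_nbhs.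
have [n _ /(_ _ (leqnn n)) ne] := near_infty_natSinv_lt (PosNum (divr_gt0 e0 (ltr0Sn R 1))).
have n0 : 0 < n.+1%:R^-1 :> R by [].
have /choice[q xq] (i : 'I_N) : exists q : rat, `|x 0 i - ratr q| < n.+1%:R^-1.
  exact: rat_near.
pose qn : 'rV[rat]_N * nat := (\row_i q i, n).
have xc : `|x - ctr qn| < n.+1%:R^-1.
  by apply/normv_ltP; split=> // i; rewrite !mxE.
exists (pickle qn) => //=; rewrite /dec pickleK/=.
have -> : good qn.
  apply/asboolP => y /= yc; apply: eU; rewrite -ball_normE /ball_/=.
  rewrite -(subrKA (ctr qn)) (le_lt_trans (ler_normD _ _))// distrC -[X in _ + X]normrN opprB.
  move: ne xc yc => /=; rewrite distrC; set s := n.+1%:R^-1.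
  by move=> ne xc yc; lra.
exact: xc.
Qed.

Lemma measurable_open (U : set 'rV[R]_N) : open U -> measurable (U : set T).
Proof.
move=> /open_ball_cover[c [r [-> _]]].
by apply: bigcupT_measurable => k; exact: measurable_vball.
Qed.

Lemma mf_continuous (f : 'rV[R]_N -> R) : continuous f ->
  measurable_fun [set: T] (f : T -> R).
Proof.
move=> cf; apply: (measurability _ (RGenOInfty.measurableE R)) => //.
move=> _ [_ [a ->] <-]; rewrite setTI; apply: measurable_open.
by apply: (@open_comp _ _ f) => //; move=> x _; exact: cf.
Qed.

Lemma leb_outer_null_measurable (X : set 'rV[R]_N) : leb_outer X = 0%E ->
  measurable (X : set T).
Proof.
move=> X0; apply: le_caratheodory_measurable => Y.
rewrite (_ : Defs_leb_outer__canonical__measure_extension_OuterMeasure (Y `&` X) = 0%E).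
  by rewrite add0e le_outer_measure.
  apply/eqP; rewrite eq_le outer_measure_ge0 andbT -X0.
exact: le_outer_measure.
Qed.

Lemma box_measurable B : measurable (box B : set T).
Proof.
case: B => [[a b]|] /=; last exact: measurable0.
rewrite (_ : (fun x => _) = \bigcap_(i in [set: 'I_N])
   (~` [set y : T | y 0 i <= a 0 i] `&` [set y : T | y 0 i <= b 0 i])).
  apply: fin_bigcap_measurable => // i _; apply: measurableI.
    exact/measurableC/measurable_halfspace.
  exact: measurable_halfspace.
apply/seteqP; split=> y /=.
  by move=> yr i _; have [? ?] := yr i; split=> //=; apply/negP; rewrite -ltNge.
by move=> yr i; have [/negP + ?] := yr i I; rewrite -ltNge.
Qed.

Lemma leb_box_le B : (leb_outer (box B) <= box_vol B)%E.
Proof.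
apply: ge_ereal_inf; exists (\sum_(k <oo) box_vol ((fun k => if k is 0%N then B else None) k))%E.
  by eexists; last reflexivity; move=> x Bx; exists 0%N.
rewrite (@nneseriesD1 _ _ 0)//; last by move=> k _; exact: box_vol_ge0.
rewrite eseries0 ?adde0// => k _ /= k0.
by case: k k0.
Qed.

Lemma leb_ball_lty x r : (mu [set y | (`|y - x| < r)%R] < +oo)%E.
Proof.
have := leb_box_le (Some (\row_i (x 0 i - r), \row_i (x 0 i + r))).
move=> /le_lt_trans; set B := box _ => h.
apply: (@le_lt_trans _ _ (leb_outer B)); last exact/h/ltry.
apply: le_outer_measure => y /normv_ltP[r0 yr] i; have := yr i.
by rewrite !mxE ltr_norml => /andP[? ?]; split; lra.
Qed.

Lemma leb_sigma_finite : sigma_finite [set: T] mu.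
Proof.
exists (fun n => [set y | `|y - 0| < n%:R] : set T).
  apply/esym/seteqP; split=> // x _.
  have [n _ /(_ _ (leqnn n)) xn] := nbhs_infty_gtr `|x|.
  by exists n => //=; rewrite subr0.
by move=> n; split; [exact: measurable_vball|exact: leb_ball_lty].
Qed.

(** Were a nonempty open set null, its rational translates would cover the whole
    space by null sets. *)
Lemma leb_open_gt0 (U : set 'rV[R]_N) : open U -> U !=set0 ->
  (0 < leb_outer [set: 'rV[R]_N])%E -> (0 < leb_outer U)%E.
Proof.
move=> oU [x Ux] T0; rewrite lt0e outer_measure_ge0 andbT; apply/eqP => U0.
have /nbhs_ballP[e /= e0 eU] : nbhs x U by exact: open_nbhs_nbhs.
pose F k : set 'rV[R]_N :=
  if unpickle k is Some q then dilate 1 (- map_mx ratr (q : 'rV[rat]_N)) @^-1` U else set0.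
have F0 k : leb_outer (F k) = 0%E.
  rewrite /F; case: unpickle => [q|]; last exact: outer_measure0.
  by rewrite leb_outer_dilate// U0 mule0.
suff FT : [set: 'rV[R]_N] `<=` \bigcup_k F k.
  have := outer_measure_sigma_subadditive leb_outer F.
  rewrite eseries0; last by move=> k _ _; exact: F0.
  move=> /(le_trans (le_outer_measure leb_outer _ _ FT)).
  by rewrite leNgt T0.
move=> y _.
have /choice[q xq] (i : 'I_N) : exists q : rat, `|(y - x) 0 i - ratr q| < e.
  exact: rat_near.
exists (pickle (\row_i q i : 'rV[rat]_N)) => //; rewrite /F pickleK /=.
apply: eU; rewrite -ball_normE /ball_/= /dilate scale1r; apply/normv_ltP.
split=> // i; have := xq i; rewrite !mxE distrC; congr (`| _ | < _).
ring.
Qed.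

End lebesgue_measure_facts.

(** * Integration against Lebesgue measure *)

Section lebesgue_integration.
Context {R : realType} {N : nat}.
Notation V := 'rV[R]_N.
Notation T := (lebT R N).
Notation mu := (@leb R N).
Implicit Types (f g : V -> R) (c : R).

(** The same notions for functions on row vectors. They are sealed at the end of
    this part, because unfolding integrals in unification problems is prohibitive. *)
Definition Lset (A : set V) := measurable (A : set T).
Definition Lmeas f := measurable_fun [set: T] f.
Definition Lsummable f := summable_fun mu f.
Definition Lsq f := sq_summable mu f.
Definition Lint f := \int[mu]_x f x.
Definition Lae (P : V -> Prop) := {ae mu, forall x, P x}.
Definition Lmean_null (f : nat -> V -> R) := mean_null mu f.
Definition Lsqmean_null (f : nat -> V -> R) := sqmean_null mu f.

Lemma Lsummable_mf f : Lsummable f -> Lmeas f.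
Proof. exact (@summable_mf _ T _ mu f). Qed.

Lemma Lsummable_dom f h : Lmeas f -> Lsummable h ->
  Lae (fun x => `|f x| <= h x) -> Lsummable f.
Proof. exact (@summable_dom _ T _ mu f h). Qed.

Lemma LsummableD f g : Lsummable f -> Lsummable g ->
  Lsummable (fun x => f x + g x).
Proof. exact (@summable_fun_add _ T _ mu f g). Qed.

Lemma LsummableB f g : Lsummable f -> Lsummable g ->
  Lsummable (fun x => f x - g x).
Proof. exact (@summable_fun_sub _ T _ mu f g). Qed.

Lemma LsummableZ c f : Lsummable f -> Lsummable (fun x => c * f x).
Proof. exact (@summableZ _ T _ mu c f). Qed.

Lemma LsummableN f : Lsummable f -> Lsummable (fun x => - f x).
Proof. exact (@summable_fun_opp _ T _ mu f). Qed.

Lemma Lsummable_norm f : Lsummable f -> Lsummable (fun x => `|f x|).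
Proof. exact (@summable_norm _ T _ mu f). Qed.

Lemma Lsummable0 : Lsummable (fun=> 0).
Proof. exact (@summable0 _ T _ mu). Qed.

Lemma Lsummable_bdM f h c : Lmeas h -> (forall x, `|h x| <= c) -> Lsummable f ->
  Lsummable (fun x => h x * f x).
Proof. exact (@summable_bdM _ T _ mu f h c). Qed.

Lemma LintD f g : Lsummable f -> Lsummable g ->
  Lint (fun x => f x + g x) = Lint f + Lint g.
Proof. exact (@intD _ T _ mu f g). Qed.

Lemma LintB f g : Lsummable f -> Lsummable g ->
  Lint (fun x => f x - g x) = Lint f - Lint g.
Proof. exact (@intB _ T _ mu f g). Qed.

Lemma LintZ c f : Lsummable f -> Lint (fun x => c * f x) = c * Lint f.
Proof. exact (@intZ _ T _ mu c f). Qed.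

Lemma LintN f : Lsummable f -> Lint (fun x => - f x) = - Lint f.
Proof. exact (@intN _ T _ mu f). Qed.

Lemma Lle_int f g : Lsummable f -> Lsummable g ->
  Lae (fun x => f x <= g x) -> Lint f <= Lint g.
Proof. exact (@le_int _ T _ mu f g). Qed.

Lemma Leq_int f g : Lmeas f -> Lmeas g -> Lae (fun x => f x = g x) ->
  Lint f = Lint g.
Proof. exact (@eq_int _ T _ mu f g). Qed.

Lemma Lnorm_int f : Lsummable f -> `|Lint f| <= Lint (fun x => `|f x|).
Proof. exact (@norm_int _ T _ mu f). Qed.

Lemma Lint_ge0 f : (forall x, 0 <= f x) -> 0 <= Lint f.
Proof. exact (@int_ge0 _ T _ mu f). Qed.

Lemma LEFin_int f : Lsummable f -> (Lint f)%:E = (\int[mu]_x (f x)%:E)%E.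
Proof. exact (@EFin_int _ T _ mu f). Qed.

Lemma LsqP f : Lsq f <->
  Lmeas f /\ (\int[mu]_x (f x ^+ 2)%:E < +oo)%E.
Proof. exact (@sq_summableP _ T _ mu f). Qed.

Lemma Lsq_mf f : Lsq f -> Lmeas f.
Proof. exact (@sq_summable_mf _ T _ mu f). Qed.

Lemma Lsq_dom f g c : Lmeas f -> Lsq g ->
  Lae (fun x => `|f x| <= c * `|g x|) -> Lsq f.
Proof. exact (@sq_summable_dom _ T _ mu f g c). Qed.

Lemma LsqM f g : Lsq f -> Lsq g ->
  Lsummable (fun x => f x * g x).
Proof. exact (@sq_summableM _ T _ mu f g). Qed.

Lemma LsqD f g : Lsq f -> Lsq g ->
  Lsq (fun x => f x + g x).
Proof. exact (@sq_summableD _ T _ mu f g). Qed.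

Lemma LsqZ c f : Lsq f -> Lsq (fun x => c * f x).
Proof. exact (@sq_summableZ _ T _ mu c f). Qed.

Lemma LsqN f : Lsq f -> Lsq (fun x => - f x).
Proof. exact (@sq_summableN _ T _ mu f). Qed.

Lemma LsqB f g : Lsq f -> Lsq g ->
  Lsq (fun x => f x - g x).
Proof. exact (@sq_summableB _ T _ mu f g). Qed.

Lemma Lsq_bdM f h c : Lmeas h -> (forall x, `|h x| <= c) -> Lsq f ->
  Lsq (fun x => h x * f x).
Proof. exact (@sq_summable_bdM _ T _ mu f h c). Qed.

Lemma Lint_sq_ge0 f : 0 <= Lint (fun x => f x ^+ 2).
Proof. exact (@int_sq_ge0 _ T _ mu f). Qed.

Lemma Lint_mul_le f g c : 0 < c -> Lsq f -> Lsq g ->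
  2 * Lint (fun x => `|f x * g x|) <=
  c * Lint (fun x => f x ^+ 2) + c^-1 * Lint (fun x => g x ^+ 2).
Proof. exact (@int_mul_le _ T _ mu f g c). Qed.

Lemma Lint_sq_add_le f g : Lsq f -> Lsq g ->
  Lint (fun x => (f x + g x) ^+ 2) <=
  2 * Lint (fun x => f x ^+ 2) + 2 * Lint (fun x => g x ^+ 2).
Proof. exact (@int_sq_add_le _ T _ mu f g). Qed.

Lemma Lmean_null_cvg (f : nat -> V -> R) g : Lsummable g ->
  Lmean_null (fun n x => f n x - g x) ->
  (fun n => Lint (f n)) @ \oo --> Lint g.
Proof. exact (@mean_null_cvg _ T _ mu f g). Qed.

Lemma Lmean_null_dom (f h : nat -> V -> R) : (forall n, Lmeas (f n)) -> Lmean_null h ->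
  (forall n, Lae (fun x => `|f n x| <= h n x)) -> Lmean_null f.
Proof. exact (@mean_null_dom _ T _ mu f h). Qed.

Lemma Lmean_nullD (f h : nat -> V -> R) : Lmean_null f -> Lmean_null h ->
  Lmean_null (fun n x => f n x + h n x).
Proof. exact (@mean_nullD _ T _ mu f h). Qed.

Lemma Lmean_nullZ c (f : nat -> V -> R) : Lmean_null f ->
  Lmean_null (fun n x => c * f n x).
Proof. exact (@mean_nullZ _ T _ mu c f). Qed.

Lemma Lsqmean_null_sq (f : nat -> V -> R) : Lsqmean_null f ->
  Lmean_null (fun n x => f n x ^+ 2).
Proof. exact (@sqmean_null_sq _ T _ mu f). Qed.

Lemma Lsqmean_nullM (f h : nat -> V -> R) M : Lsqmean_null f ->
  (forall n, Lsq (h n)) -> (forall n, Lint (fun x => h n x ^+ 2) <= M) ->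
  Lmean_null (fun n x => f n x * h n x).
Proof. exact (@sqmean_nullM _ T _ mu f h M). Qed.

Lemma Lmean_null_dct (f : nat -> V -> R) h : (forall n, Lmeas (f n)) ->
  Lsummable h -> (forall n, Lae (fun x => `|f n x| <= h x)) ->
  Lae (fun x => (f ^~ x) @ \oo --> (0 : R)) -> Lmean_null f.
Proof. exact (@mean_null_dct _ T _ mu f h). Qed.

Lemma Lsqmean_null_dct (f : nat -> V -> R) h : (forall n, Lmeas (f n)) ->
  Lsq h -> (forall n, Lae (fun x => `|f n x| <= `|h x|)) ->
  Lae (fun x => (f ^~ x) @ \oo --> (0 : R)) -> Lsqmean_null f.
Proof. exact (@sqmean_null_dct _ T _ mu f h). Qed.

Lemma Lsq_summable f : Lsq f -> Lsummable (fun x => f x ^+ 2).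
Proof. by case. Qed.

Lemma Lmean_nullE (f : nat -> V -> R) : Lmean_null f <->
  (forall n, Lsummable (f n)) /\ (fun n => Lint (fun x => `|f n x|)) @ \oo --> (0 : R).
Proof. by []. Qed.

Lemma Lsqmean_nullE (f : nat -> V -> R) : Lsqmean_null f <->
  (forall n, Lsq (f n)) /\ (fun n => Lint (fun x => f n x ^+ 2)) @ \oo --> (0 : R).
Proof. by []. Qed.

Lemma Lint0 : Lint (fun=> 0) = 0.
Proof. by rewrite /Lint Rintegral_cst// mul0r. Qed.

Lemma LmeasD f g : Lmeas f -> Lmeas g -> Lmeas (fun x => f x + g x).
Proof. exact: measurable_funD. Qed.

Lemma LmeasB f g : Lmeas f -> Lmeas g -> Lmeas (fun x => f x - g x).
Proof. exact: measurable_funB. Qed.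

Lemma LmeasM f g : Lmeas f -> Lmeas g -> Lmeas (fun x => f x * g x).
Proof. exact: measurable_funM. Qed.

Lemma LmeasX f n : Lmeas f -> Lmeas (fun x => f x ^+ n).
Proof. exact: measurable_funX. Qed.

Lemma Lmeas_cst c : Lmeas (fun=> c).
Proof. exact: measurable_cst. Qed.

Lemma Lmeas_comp (G : R -> R) f : continuous G -> Lmeas f -> Lmeas (fun x => G (f x)).
Proof.
by move=> cG mf; apply: (measurableT_comp _ mf); exact: continuous_measurable_fun.
Qed.

Lemma Lmeas_norm f : Lmeas f -> Lmeas (fun x => `|f x|).
Proof. by apply: Lmeas_comp; exact: norm_continuous. Qed.

Lemma LmeasN f : Lmeas f -> Lmeas (fun x => - f x).
Proof. by apply: Lmeas_comp; exact: opp_continuous. Qed.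

Lemma Lmeas_shift (h : V) f : Lmeas f -> Lmeas (fun x => f (x + h)).
Proof. exact: mf_shift. Qed.

Lemma Lmeas_continuous f : continuous f -> Lmeas f.
Proof. exact: mf_continuous. Qed.

Lemma Lmeas_cvg (f_ : nat -> V -> R) f : (forall n, Lmeas (f_ n)) ->
  (forall x, (f_ ^~ x) @ \oo --> f x) -> Lmeas f.
Proof. by move=> mf fl; apply: (measurable_fun_cvg mf) => x _; exact: fl. Qed.

Lemma Lset_open (U : set V) : open U -> Lset U.
Proof. exact: measurable_open. Qed.

Lemma Lset_ball (x : V) r : Lset [set y | `|y - x| < r].
Proof. exact: measurable_vball. Qed.

Lemma LsetI A B : Lset A -> Lset B -> Lset (A `&` B).
Proof. exact: measurableI. Qed.

Lemma LsetD A B : Lset A -> Lset B -> Lset (A `\` B).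
Proof. exact: measurableD. Qed.

Lemma LsetU A B : Lset A -> Lset B -> Lset (A `|` B).
Proof. exact: measurableU. Qed.

Lemma LsetT : Lset [set: V].
Proof. exact: measurableT. Qed.

Lemma Lset_bigcup (F : nat -> set V) : (forall k, Lset (F k)) -> Lset (\bigcup_k F k).
Proof. by move=> mF; exact: bigcupT_measurable. Qed.

Lemma Lset_box B : Lset (box B).
Proof. exact: box_measurable. Qed.

Lemma LsetP (A : set V) : Lset A <-> measurable (A : set T).
Proof. by []. Qed.

Lemma LmeasP f : Lmeas f <-> measurable_fun [set: T] f.
Proof. by []. Qed.

Lemma Lmeas_indic (A : set V) : Lset A -> Lmeas \1_A.
Proof. exact: measurable_indic. Qed.

Lemma LaeW (P : V -> Prop) : (forall x, P x) -> Lae P.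
Proof. exact (@aeW _ T _ mu P). Qed.

Lemma LaeS (P Q : V -> Prop) : (forall x, P x -> Q x) -> Lae P -> Lae Q.
Proof. by move=> PQ h; exact: (@filterS T (almost_everywhere mu) _ P Q PQ h). Qed.

Lemma LaeS2 (P Q S : V -> Prop) : (forall x, P x -> Q x -> S x) ->
  Lae P -> Lae Q -> Lae S.
Proof.
by move=> PQS h1 h2; exact: (@filterS2 T (almost_everywhere mu) _ P Q S PQS h1 h2).
Qed.

Lemma Lae_shift (P : V -> Prop) (h : V) : Lae P -> Lae (fun x => P (x + h)).
Proof.
move=> [A [mA A0 PA]].
have B0 : @leb_outer R N (dilate 1 h @^-1` A) = 0%E.
  by rewrite leb_outer_dilate//; move: A0; rewrite /leb => ->; rewrite mule0.
exists (dilate 1 h @^-1` A); split=> //; first exact: leb_outer_null_measurable.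
by move=> x nP; apply: PA => /=; rewrite /dilate scale1r.
Qed.

Lemma LaeP (P : V -> Prop) : Lae P <-> {ae mu, forall x, P x}.
Proof. by []. Qed.

Lemma Lsummable_shift (h : V) f : Lsummable f -> Lsummable (fun x => f (x + h)).
Proof. exact: summable_shift. Qed.

Lemma Lsq_shift (h : V) f : Lsq f -> Lsq (fun x => f (x + h)).
Proof. exact: sq_summable_shift. Qed.

Lemma Lint_shift (h : V) f : Lsummable f -> Lint (fun x => f (x + h)) = Lint f.
Proof. exact: int_shift. Qed.

Lemma Lint_ext f g : (forall x, f x = g x) -> Lint f = Lint g.
Proof. by move=> /funext ->. Qed.

Lemma indic01 (A : set V) x : 0 <= (\1_A x : R) <= 1.
Proof. by rewrite indicE; case: (_ \in _) => /=; rewrite lexx ler01. Qed.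

Lemma Lsummable_indic (A : set V) : Lset A -> (mu A < +oo)%E -> Lsummable \1_A.
Proof.
move=> mA Aoo; apply/integrableP; split.
  by apply/measurable_EFinP; exact: measurable_indic.
under eq_integral => x _ do rewrite /= ger0_norm//.
by rewrite integral_indic// setIT.
Qed.

Lemma EFin_Lint_indic (A : set V) : Lset A -> (mu A < +oo)%E ->
  (Lint \1_A)%:E = mu A.
Proof.
move=> mA Aoo; rewrite LEFin_int; last exact: Lsummable_indic.
by rewrite integral_indic// setIT.
Qed.

Lemma Lsummable_ball f (c : V) (r M : R) : Lmeas f -> (forall x, `|f x| <= M) ->
  (forall x, r <= `|x - c| -> f x = 0) -> Lsummable f.
Proof.
move=> mf fM f0; pose B : set V := [set y | `|y - c| < r].
have Bi : Lsummable \1_B by apply: Lsummable_indic; [exact: Lset_ball|exact: leb_ball_lty].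
apply: (Lsummable_dom mf (LsummableZ M Bi)); apply: LaeW => x.
rewrite indicE; case: (boolP (x \in B)) => xB; rewrite ?mulr1//.
rewrite mulr0 f0 ?normr0// leNgt; apply/negP => h; move/negP : xB; apply.
exact/mem_set.
Qed.

Lemma Lsummable_sum (I : Type) (s : seq I) (F : I -> V -> R) :
  (forall i, Lsummable (F i)) -> Lsummable (fun x => \sum_(i <- s) F i x).
Proof.
move=> FF; elim: s => [|i s IH].
  by under eq_fun do rewrite big_nil; exact: Lsummable0.
by under eq_fun do rewrite big_cons; exact: LsummableD.
Qed.

Lemma Lint_sum (I : Type) (s : seq I) (F : I -> V -> R) :
  (forall i, Lsummable (F i)) ->
  Lint (fun x => \sum_(i <- s) F i x) = \sum_(i <- s) Lint (F i).
Proof.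
move=> FF; elim: s => [|i s IH].
  by under eq_fun do rewrite big_nil; rewrite big_nil Lint0.
under eq_fun do rewrite big_cons.
by rewrite big_cons -IH LintD//; exact: Lsummable_sum.
Qed.

Lemma Lsq_sum (I : Type) (s : seq I) (F : I -> V -> R) :
  (forall i, Lsq (F i)) -> Lsq (fun x => \sum_(i <- s) F i x).
Proof.
move=> FF; elim: s => [|i s IH].
  under eq_fun do rewrite big_nil; split; first exact: Lmeas_cst.
  by under eq_fun do rewrite expr0n; exact: Lsummable0.
by under eq_fun do rewrite big_cons; exact: LsqD.
Qed.

Lemma Lsq_norm f : Lsq f -> Lsq (fun x => `|f x|).
Proof.
move=> sf; apply: (@Lsq_dom _ f 1) => //; first by apply: Lmeas_norm; exact: Lsq_mf.
by apply: LaeW => x; rewrite normr_id mul1r.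
Qed.

Lemma Lsq_ball_indic (c : V) (r M : R) : Lsq (fun x => M * \1_[set y | `|y - c| < r] x).
Proof.
set B := [set y | _]; apply: LsqZ; split; first exact/Lmeas_indic/Lset_ball.
apply: (@Lsummable_ball _ c r 1) => [|x|x xr].
- by apply: LmeasX; exact/Lmeas_indic/Lset_ball.
- rewrite normrX exprn_ile1//.
  by have /andP[? ?] := indic01 B x; rewrite ger0_norm.
by rewrite indicE memNset ?expr0n// /B /= => xr'; move: xr; rewrite leNgt xr'.
Qed.

Lemma Lint_mul_le1 f g : Lsq f -> Lsq g ->
  2 * Lint (fun x => f x * g x) <= Lint (fun x => f x ^+ 2) + Lint (fun x => g x ^+ 2).
Proof.
move=> sf sg; have := Lint_mul_le ltr01 sf sg; rewrite invr1 !mul1r.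
apply: le_trans; rewrite ler_wpM2l// (le_trans (ler_norm _))//.
by apply: Lnorm_int; exact: LsqM.
Qed.

(** Meant for integrals of [u x * phi (x - s *: h)], where the compact support of
    [phi] supplies the dominating function. *)
Lemma Lderive_under (f f' : R -> V -> R) (G : V -> R) (lo hi a : R) :
  lo < a < hi -> (forall s, lo < s < hi -> Lsummable (f s)) ->
  (forall s x, lo < s < hi -> is_derive s 1 (f ^~ x) (f' s x)) ->
  Lsummable G -> (forall s x, lo < s < hi -> `|f' s x| <= G x) ->
  is_derive a 1 (fun s => Lint (f s)) (Lint (f' a)).
Proof.
move=> a_in fi df Gi f'G.
have Ia : `]lo, hi[%classic a by rewrite /= in_itv/= a_in.
have h1 s : `]lo, hi[%classic s -> mu.-integrable setT (EFin \o f s).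
  by rewrite /= in_itv/= => /fi.
have h2 s x : `]lo, hi[%classic s -> [set: T] x -> derivable (f ^~ x) s 1.
  by rewrite /= in_itv/= => sI _; have [] := df s x sI.
have G0 x : 0 <= G x by rewrite (le_trans _ (f'G a x a_in)).
have h3 s x : `]lo, hi[%classic s -> [set: T] x -> `|partial1of2 f s x| <= G x.
  rewrite /= in_itv/= => sI _; rewrite partial1of2E.
  by have [_ ->] := df s x sI; exact: f'G.
have h4 := derivable_under_integral measurableT Ia h1 h2 G0 Gi h3.
have h5 := differentiation_under_integral measurableT Ia h1 h2 G0 Gi h3.
split; first exact: h4.
rewrite -derive1E h5; apply: eq_Rintegral => x _; rewrite partial1of2E.
by have [_ ->] := df a x a_in.
Qed.

End lebesgue_integration.

Section scale_layer.
Context {R : realType} {N : nat}.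
Notation V := 'rV[R]_N.
Notation mu := (@leb R N).
Variable s : R.
Hypothesis s0 : 0 < s.
Implicit Types (f : V -> R) (A : set V).

Let dilate_scale : dilate s 0 = fun x : V => s *: x.
Proof. by apply/funext => x; rewrite /dilate addr0. Qed.

Lemma Lsummable_scale f : Lsummable f -> Lsummable (fun x => f (s *: x)).
Proof. by move=> /(summable_dilate 0 s0); rewrite dilate_scale. Qed.

Lemma Lint_scale f : Lsummable f -> Lint (fun x => f (s *: x)) = s ^- N * Lint f.
Proof.
by move=> /(int_dilate 0 s0); rewrite dilate_scale exprVn => <-.
Qed.

Lemma Lmeas_scale f : Lmeas f -> Lmeas (fun x => f (s *: x)).
Proof.
move=> mf; have ms : measurable_fun [set: lebT R N] ((fun x : V => s *: x) : lebT R N -> lebT R N).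
  by have := @dilate_measurable R N s 0 s0; congr measurable_fun; exact: dilate_scale.
exact: (measurableT_comp mf ms).
Qed.

Lemma leb_outer_scale A : @leb_outer R N [set x | A (s *: x)] = ((s ^- N)%:E * leb_outer A)%E.
Proof. by have := leb_outer_dilate 0 A s0; rewrite dilate_scale exprVn. Qed.

Lemma Lae_scale (P : V -> Prop) : Lae P -> Lae (fun x => P (s *: x)).
Proof.
move=> [A [mA A0 PA]].
have B0 : @leb_outer R N [set x | A (s *: x)] = 0%E.
  by rewrite leb_outer_scale; move: A0; rewrite /leb => ->; rewrite mule0.
exists [set x | A (s *: x)]; split=> //; first exact: leb_outer_null_measurable.
by move=> x nP; apply: PA.
Qed.

Lemma Lsq_scale f : Lsq f -> Lsq (fun x => f (s *: x)).
Proof.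
move=> sf; split; first exact/Lmeas_scale/Lsq_mf.
exact: (Lsummable_scale (Lsq_summable sf)).
Qed.

End scale_layer.

(* The notions above are used only through the preceding lemmas. *)
#[global] Opaque Lset Lmeas Lsummable Lsq Lint Lae Lmean_null Lsqmean_null.

Ltac lmeas := repeat match goal with
  | |- Lmeas (fun=> ?c) => exact: (Lmeas_cst c)
  | |- Lmeas (fun x => @?f x - @?g x) => refine (@LmeasB _ _ f g _ _)
  | |- Lmeas (fun x => @?f x + @?g x) => refine (@LmeasD _ _ f g _ _)
  | |- Lmeas (fun x => - @?f x) => refine (@LmeasN _ _ f _)
  | |- Lmeas (fun x => @?f x * @?g x) => refine (@LmeasM _ _ f g _ _)
  | |- Lmeas (fun x => (@?f x) ^+ ?n) => refine (@LmeasX _ _ f n _)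
  | |- Lmeas (fun x => `|@?f x|) => refine (@Lmeas_norm _ _ f _)
  | |- Lmeas (fun x => ?f (x + ?h)) => refine (@Lmeas_shift _ _ h f _)
  | H : Lmeas ?f |- Lmeas ?f => exact H
  | H : Lmeas ?f |- Lmeas (fun x => ?f x) => exact H
  | H : forall n, Lmeas _ |- Lmeas _ => exact (H _)
  | |- Lmeas \1_ _ => apply: Lmeas_indic
  end.

(** * Smooth functions with compact support *)

Section flat_functions.
Context {R : realType}.
Implicit Types (P : {poly R}) (t x y : R).

(** All derivatives are given at once, so that differentiation only shifts the
    sequence. *)
Definition smooth1 (f : R -> R) := exists F : nat -> R -> R,
  F 0%N = f /\ forall k x, is_derive x 1 (F k) (F k.+1 x).

(** Polynomials in [1/t] times [exp(- 1/t)], extended by [0]: the successive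
    derivatives of the standard flat function are all of this form. *)
Definition flat P t := if 0 < t then P.[t^-1] * expR (- t^-1) else 0.
Definition flat_next P := 'X^2 * (P - P^`()).

Lemma expn_expRN_bounded n y : 0 < y -> y ^+ n * expR (- y) <= n`!%:R.
Proof.
move=> y0; rewrite expRN ler_pdivrMr ?expR_gt0//.
case: n => [|n]; first by rewrite expr0 fact0 mul1r -expR0 ler_expR ltW.
rewrite -ler_pdivrMl ?ltr0n ?fact_gt0// mulrC.
by rewrite (le_trans _ (expR_ge1Dxn n (ltW y0)))// lerDr.
Qed.

Lemma poly_expRN_bounded P n : exists2 C, 0 <= C &
  forall y, 0 < y -> `|P.[y]| * y ^+ n * expR (- y) <= C.
Proof.
elim/poly_ind: P n => [|P c IH] n.
  by exists 0 => // y y0; rewrite horner0 normr0 !mul0r.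
have [C C0 PC] := IH n.+1; exists (C + `|c| * n`!%:R).
  by rewrite addr_ge0// mulr_ge0.
move=> y y0; rewrite hornerMXaddC.
have := PC _ y0; rewrite exprS => h1; have := expn_expRN_bounded n y0 => h2.
have h3 : `|P.[y] * y + c| <= `|P.[y]| * y + `|c|.
  by rewrite (le_trans (ler_normD _ _))// normrM (ger0_norm (ltW y0)).
have e0 := expR_ge0 (- y); have yn0 : 0 <= y ^+ n by rewrite exprn_ge0// ltW.
apply: (@le_trans _ _ ((`|P.[y]| * y + `|c|) * y ^+ n * expR (- y))).
  by rewrite ler_wpM2r// ler_wpM2r.
rewrite !mulrDl lerD//; first by rewrite mulrA in h1.
by rewrite -mulrA ler_wpM2l.
Qed.

(** This bound makes the derivative at [0] exist and vanish. *)
Lemma flat_le_sq P : exists2 C, 0 <= C & forall t, `|flat P t| <= C * t ^+ 2.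
Proof.
have [C C0 PC] := poly_expRN_bounded P 2; exists C => // t.
rewrite /flat; case: ifPn => [t0|_]; last by rewrite normr0 mulr_ge0// sqr_ge0.
have t'0 : 0 < t^-1 by rewrite invr_gt0.
have t2 : 0 < t ^+ 2 by rewrite exprn_gt0.
rewrite normrM (ger0_norm (expR_ge0 _)) -ler_pdivrMr//.
by have := PC _ t'0; rewrite exprVn mulrAC.
Qed.

Lemma is_derive_flat P x : is_derive x 1 (flat P) (flat (flat_next P) x).
Proof.
have [x0|x0|x0] := ltgtP x 0.
- have -> : flat (flat_next P) x = 0 by rewrite /flat ltNge ltW.
  apply: (@near_eq_is_derive _ _ _ (cst 0)).
  near=> y; rewrite /flat ifF//; apply/negbTE; rewrite -leNgt ltW//.
  by near: y; exact: lt_nbhsl.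
- apply: (@near_eq_is_derive _ _ _ (fun t => P.[t^-1] * expR (- t^-1))).
  + by near=> y; rewrite /flat ifT//; near: y; exact: lt_nbhsr.
  have xn0 : x != 0 by rewrite gt_eqF.
  have dV : is_derive x 1 (fun t : R => t^-1) (- (x ^- 2)).
    apply: is_derive_eq; first exact: (@is_deriveV _ id).
    by rewrite /= scaler1.
  have dP : is_derive x 1 (fun t => P.[t^-1]) (P^`().[x^-1] * - (x ^- 2)).
    by have := is_derive1_comp (is_derive_poly P x^-1) dV; exact.
  have dE : is_derive x 1 (fun t => expR (- t^-1)) (expR (- x^-1) * (x ^- 2)).
    have := @is_derive1_comp R expR (fun t => - t^-1) x _ _ (is_derive_expR (- x^-1)) (is_deriveN dV).
    by rewrite opprK; exact.
  have := is_deriveM dP dE; set d := (X in is_derive _ _ _ X) => h.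
  suff <- : d = flat (flat_next P) x by exact: h.
  rewrite /d /flat x0 /flat_next hornerM hornerXn hornerD hornerN /GRing.scale/=.
  by rewrite exprVn; ring.
- rewrite x0 /flat ltxx; have [C C0 PC] := flat_le_sq P.
  suff lim0 : (fun h : R => h^-1 *: (flat P (h *: 1 + 0) - flat P 0)) @ 0^' --> (0 : R).
    by apply: DeriveDef; [apply/cvg_ex; exists 0|exact/cvg_lim].
  apply/cvgr0Pnorm_le => e e0; near=> h.
  have h0 : h != 0 by near: h; exact: nbhs_dnbhs_neq.
  rewrite /flat ltxx subr0 -/(flat P _) addr0 scaler1 normrZ normfV.
  rewrite ler_pdivrMl ?normr_gt0// (le_trans (PC _))//.
  rewrite -[h ^+ 2]real_normK ?num_real// expr2 mulrA [leRHS]mulrC.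
  rewrite ler_wpM2r//; near: h.
  have C1 : 0 < C + 1 by rewrite ltr_wpDl.
  apply: filterS (dnbhs0_le (divr_gt0 e0 C1)) => h.
  rewrite ler_pdivlMr// mulrC => /(le_trans _); apply.
  by rewrite ler_wpM2r// lerDl.
Unshelve. all: by end_near. Qed.

Lemma smooth1_flat P : smooth1 (flat P).
Proof.
exists (fun k => flat (iter k flat_next P)); split=> // k x.
exact: is_derive_flat.
Qed.

Lemma smooth1_affine (f : R -> R) (a b : R) : smooth1 f ->
  smooth1 (fun t => f (a * t + b)).
Proof.
move=> [F [F0 FF]]; exists (fun k t => a ^+ k * F k (a * t + b)).
split; first by apply/funext => t; rewrite expr0 mul1r F0.
move=> k x; have := FF k (a * x + b) => dF.
have dl : is_derive x 1 (fun t : R => a * t + b) a.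
  apply: is_derive_eq; rewrite addr0 /GRing.scale /= mulr1.
  reflexivity.
have dc : is_derive x 1 (fun t => F k (a * t + b)) (a * F k.+1 (a * x + b)).
  by have := @is_derive1_comp R (F k) (fun t => a * t + b) x _ _ dF dl; rewrite [_ * a]mulrC; exact.
have := is_deriveZ (a ^+ k) dc; set d := (X in is_derive _ _ _ X) => h.
suff <- : d = a ^+ k.+1 * F k.+1 (a * x + b) by exact: h.
by rewrite /d /GRing.scale /= exprS mulrA [_ * a]mulrC.
Qed.

Definition psi t : R := flat 1 t.

Lemma psi_ge0 t : 0 <= psi t.
Proof. by rewrite /psi /flat; case: ifP => // _; rewrite hornerC mul1r expR_ge0. Qed.

Lemma psi_gt0 t : (0 < psi t) = (0 < t).
Proof.
rewrite /psi /flat; case: ifP => t0; first by rewrite hornerC mul1r expR_gt0.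
by rewrite ltxx.
Qed.

Lemma psi_le1 t : psi t <= 1.
Proof.
rewrite /psi /flat; case: ifP => // t0; rewrite hornerC mul1r expR_le1.
by rewrite oppr_le0 invr_ge0 ltW.
Qed.

Lemma psi_eq0 t : t <= 0 -> psi t = 0.
Proof. by move=> t0; rewrite /psi /flat ltNge t0. Qed.

End flat_functions.

Section test_functions.
Context {R : realType} {N : nat}.
Notation V := 'rV[R]_N.
Implicit Types (f g : V -> R) (U : set V).

(** The smooth functions obtained from smooth functions of one coordinate by
    sums and products: this class is stable under partial derivatives by
    construction, and rich enough for density. *)
Inductive elementary : (V -> R) -> Prop :=
| elementary_coord i (f : R -> R) : smooth1 f -> elementary (fun x => f (x 0 i))
| elementary_cst c : elementary (fun=> c)
| elementaryD f g : elementary f -> elementary g -> elementary (fun x => f x + g x)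
| elementaryM f g : elementary f -> elementary g -> elementary (fun x => f x * g x).

Lemma elementary_differentiable f : elementary f -> forall x, differentiable f x.
Proof.
elim=> {f} [i f [F [<- FF]]|c|f g _ df _ dg|f g _ df _ dg] x.
- apply: (@differentiable_comp _ _ _ _ (fun x : V => x 0 i) (F 0%N)).
    exact: differentiable_coord.
  by apply/derivable1_diffP; have [] := FF 0%N (x 0 i).
- exact: differentiable_cst.
- exact: (differentiableD (df x) (dg x)).
- exact: (differentiableM (df x) (dg x)).
Qed.

Lemma elementary_derivable f x v : elementary f -> derivable f x v.
Proof. by move=> /elementary_differentiable df; exact: diff_derivable. Qed.

Lemma elementary_continuous f : elementary f -> continuous f.
Proof. by move=> ef x; exact/differentiable_continuous/elementary_differentiable. Qed.

Lemma elementary_derive f i : elementary f ->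
  elementary (fun x => 'D_(unit_vec i) f x).
Proof.
elim=> {f} [j f [F [F0 FF]]|c|f g ef df eg dg|f g ef df eg dg].
- have [ij|ij] := eqVneq i j.
    have -> : 'D_(unit_vec i) (fun x : V => f (x 0 j)) = fun x => F 1%N (x 0 j); last first.
      by apply: elementary_coord; exists (fun k => F k.+1); split.
    apply/funext => x; have := FF 0%N (x 0 j); rewrite F0 => -[_ <-].
    rewrite /derive; set A := (X in lim (X @ _)).
    set B := (X in _ = lim (X @ _)); suff -> : A = B by [].
    apply/funext => h; rewrite /A /B /=.
    by rewrite !mxE ij !eqxx.
  have -> : 'D_(unit_vec i) (fun x : V => f (x 0 j)) = fun=> 0; last exact: elementary_cst.
  apply/funext => x; rewrite /derive; set A := (X in lim (X @ _)).
  have -> : A = fun=> 0; last first.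
    exact: lim_cst.
  apply/funext => h; rewrite /A /= !mxE eqxx/= [j == i]eq_sym (negbTE ij) mulr0 add0r.
  by rewrite subrr scaler0.
- have -> : 'D_(unit_vec i) (fun=> c) = (fun=> 0) :> (V -> R).
    by apply/funext => x; exact: derive_cst.
  exact: elementary_cst.
- have -> : 'D_(unit_vec i) (fun x => f x + g x) =
    (fun x => 'D_(unit_vec i) f x + 'D_(unit_vec i) g x); last exact: elementaryD.
  apply/funext => x; rewrite (@deriveD _ _ _ f g)//; exact: elementary_derivable.
- have -> : 'D_(unit_vec i) (fun x => f x * g x) =
    (fun x => f x * 'D_(unit_vec i) g x + g x * 'D_(unit_vec i) f x); last first.
    by apply: elementaryD; exact: elementaryM.
  apply/funext => x; rewrite (@deriveM _ _ f g)//; exact: elementary_derivable.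
Qed.

Lemma elementary_smooth f : elementary f -> smooth f.
Proof.
move=> ef k; elim: k f ef => [|k IH] f ef /=; first exact: elementary_continuous.
split; first exact: elementary_continuous.
move=> i; split; first by move=> x; exact: elementary_derivable.
exact/IH/elementary_derive.
Qed.

Lemma elementary_derive_dir f x v : elementary f ->
  'D_v f x = \sum_(i < N) v 0 i * 'D_(unit_vec i) f x.
Proof.
move=> /elementary_differentiable/(_ x) df; rewrite deriveE//.
rewrite {1}[v]row_sum_delta linear_sum; apply: eq_bigr => i _.
by rewrite linearZ/= deriveE.
Qed.

Lemma elementary_prod (I : Type) (s : seq I) (F : I -> V -> R) :
  (forall i, elementary (F i)) -> elementary (fun x => \prod_(i <- s) F i x).
Proof.
move=> eF; elim: s => [|i s IH].
  by rewrite (_ : (fun x => _) = fun=> 1);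
    [exact: elementary_cst|apply/funext => x; rewrite big_nil].
rewrite (_ : (fun x => _) = fun x => F i x * \prod_(j <- s) F j x).
  exact: elementaryM.
by apply/funext => x; rewrite big_cons.
Qed.

(** A product over the coordinates, because the balls of the sup norm are cubes. *)
Definition bump (c : V) (r : R) (x : V) : R :=
  \prod_(i < N) (psi (x 0 i - (c 0 i - r)) * psi (c 0 i + r - x 0 i)).

Lemma bump_elementary c r : elementary (bump c r).
Proof.
apply: elementary_prod => i; apply: elementaryM.
  apply: (@elementary_coord i (fun t => psi (t - (c 0 i - r)))).
  have := smooth1_affine 1 (- (c 0 i - r)) (smooth1_flat 1).
  by congr smooth1; apply/funext => t; rewrite mul1r.
apply: (@elementary_coord i (fun t => psi (c 0 i + r - t))).
have := smooth1_affine (-1) (c 0 i + r) (smooth1_flat 1).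
by congr smooth1; apply/funext => t; rewrite mulN1r addrC.
Qed.

Lemma bump_ge0 c r x : 0 <= bump c r x.
Proof. by apply: prodr_ge0 => i _; rewrite mulr_ge0// psi_ge0. Qed.

Lemma bump_le1 c r x : bump c r x <= 1.
Proof.
apply: prodr_ile1 => i _; rewrite mulr_ge0 ?psi_ge0//= mulr_ile1 ?psi_ge0//;
  exact: psi_le1.
Qed.

Lemma bump_gt0 c r x : `|x - c| < r -> 0 < bump c r x.
Proof.
move=> /normv_ltP[_ xr]; apply: prodr_gt0 => i _; rewrite mulr_gt0// psi_gt0;
  have := xr i; rewrite !mxE ltr_norml => /andP[? ?]; lra.
Qed.

Lemma bump_eq0 c r x : 0 < r -> r <= `|x - c| -> bump c r x = 0.
Proof.
move=> r0 xr.
have [i xi] : exists i, r <= `|x 0 i - c 0 i|.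
  apply: contrapT => /forallNP h; have : `|x - c| < r.
    apply/normv_ltP; split=> // i; have /negP := h i.
    by rewrite -ltNge !mxE.
  by rewrite ltNge xr.
rewrite /bump (bigD1 i)//=; apply/eqP; rewrite mulf_eq0; apply/orP; left.
move: xi; rewrite ler_normr => /orP[xi|xi]; rewrite mulf_eq0; apply/orP.
  by right; rewrite psi_eq0//; lra.
by left; rewrite psi_eq0//; lra.
Qed.

Lemma closed_ball_compact (c : V) (r : R) : compact [set y : V | `|y - c| <= r].
Proof.
apply: bounded_closed_compact.
  exists (`|c| + `|r|); split; first exact: num_real.
  move=> M cM y /= yr; apply/ltW; apply: le_lt_trans cM.
  rewrite -(subrK c y) (le_trans (ler_normD _ _))// addrC lerD2l (le_trans yr)//.
  exact: ler_norm.
rewrite (_ : [set y | _] = (fun y : V => `|y - c|) @^-1` [set t | t <= r])//.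
apply: closed_comp; last exact: closed_le.
by move=> y _; exact: (cvg_norm (cvgB cvg_id (cvg_cst c))).
Qed.

Definition bump_class U f := elementary f /\
  exists K, [/\ compact K, K `<=` U & forall x, ~ K x -> f x = 0].

Lemma bump_class_test U f : bump_class U f -> test_function U f.
Proof. by move=> [ef KP]; split=> //; exact: elementary_smooth. Qed.

Lemma bump_class0 U : bump_class U (fun=> 0).
Proof.
by split; [exact: elementary_cst|exists set0; split=> //; exact: compact0].
Qed.

Lemma bump_class_bump U c r : 0 < r -> (forall y, `|y - c| <= r -> U y) ->
  bump_class U (bump c r).
Proof.
move=> r0 rU; split; first exact: bump_elementary.
exists [set y : V | `|y - c| <= r]; split=> //; first exact: closed_ball_compact.
by move=> x /negP; rewrite -ltNge => /ltW; exact: bump_eq0.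
Qed.

Lemma bump_classD U f g : bump_class U f -> bump_class U g ->
  bump_class U (fun x => f x + g x).
Proof.
move=> [ef [K [cK KU f0]]] [eg [L [cL LU g0]]]; split; first exact: elementaryD.
exists (K `|` L); split=> //; first exact: compactU.
  by move=> x [/KU|/LU].
by move=> x /not_orP[/f0 -> /g0 ->]; rewrite addr0.
Qed.

Lemma bump_classM U f g : bump_class U f -> elementary g ->
  bump_class U (fun x => f x * g x).
Proof.
move=> [ef [K [cK KU f0]]] eg; split; first exact: elementaryM.
by exists K; split=> // x /f0 ->; rewrite mul0r.
Qed.

Lemma elementaryZ c f : elementary f -> elementary (fun x => c * f x).
Proof. by move=> ef; apply: elementaryM => //; exact: elementary_cst. Qed.

(** A smooth substitute for the maximum of finitely many functions. *)
Lemma bump_class_cut U (J : nat) (F : nat -> V -> R) :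
  (forall j, bump_class U (F j)) ->
  bump_class U (fun x => 1 - \prod_(j < J) (1 - F j x)).
Proof.
move=> FU; elim: J => [|J IH].
  rewrite (_ : (fun x => _) = fun=> 0); first exact: bump_class0.
  by apply/funext => x; rewrite big_ord0 subrr.
rewrite (_ : (fun x => _) = fun x => (1 - \prod_(j < J) (1 - F j x)) +
   F J x * (1 + -1 * (1 - \prod_(j < J) (1 - F j x)))).
  apply: bump_classD => //; apply: bump_classM => //.
  apply: elementaryD; first exact: elementary_cst.
  by apply: elementaryZ; have [] := IH.
by apply/funext => x; rewrite big_ord_recr/=; ring.
Qed.

(** Cut-offs built from a countable cover of [U] by balls that stay inside [U]. *)
Lemma cutoff_sequence U : open U -> exists chi : nat -> V -> R,
  [/\ forall n, bump_class U (chi n),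
      forall n x, 0 <= chi n x <= 1 &
      forall x, U x -> (chi ^~ x) @ \oo --> (1 : R)].
Proof.
move=> /open_ball_cover[c [r [UE UI]]].
pose b j : V -> R := if 0 < r j then bump (c j) (r j) else fun=> 0.
have b01 j x : 0 <= b j x <= 1.
  by rewrite /b; case: ifP => _; rewrite ?bump_ge0 ?bump_le1// lexx ler01.
have bU j : bump_class U (b j).
  rewrite /b; case: ifP => rj; last exact: bump_class0.
  by apply: bump_class_bump => // y; exact: UI.
have bn01 n j x : 0 <= (1 - b j x) ^+ n <= 1.
  have /andP[? ?] := b01 j x.
  by rewrite exprn_ge0 ?subr_ge0//= exprn_ile1 ?subr_ge0// lerBlDr lerDl.
(* The power [n] drives [1 - b j x] to [0] as soon as [b j x] is positive. *)
pose chi n x := 1 - \prod_(j < n) (1 - (1 - (1 - b j x) ^+ n)).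
exists chi; split.
- move=> n; apply: (@bump_class_cut U n (fun j x => 1 - (1 - b j x) ^+ n)) => j.
  have := @bump_class_cut U n (fun=> b j) (fun=> bU j).
  by congr bump_class; apply/funext => x; rewrite prodr_const card_ord.
- move=> n x; rewrite subr_ge0 lerBlDr lerDl prodr_ge0 ?prodr_ile1// => j _.
    by rewrite subKr; exact: bn01.
  by rewrite subKr; have /andP[] := bn01 n j x.
move=> x; rewrite {1}UE => -[k _ /= xk].
have rk : 0 < r k by rewrite (le_lt_trans _ xk).
have bk : 0 < b k x by rewrite /b rk bump_gt0.
have /andP[_ bk1] := b01 k x.
have lim0 : (fun n => (1 - b k x) ^+ n) @ \oo --> (0 : R).
  by apply: cvg_expr; rewrite ger0_norm ?subr_ge0// ltrBlDr ltrDl.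
rewrite -[X in _ --> X]subr0; apply: cvgB; first exact: cvg_cst.
apply: (@squeeze_cvgr _ _ _ _ (fun=> 0) (fun n => (1 - b k x) ^+ n)) => //; last exact: cvg_cst.
near=> n; have kn : (k < n)%N by near: n; exact: nbhs_infty_gt.
rewrite prodr_ge0/=; last by move=> j _; rewrite subKr; have /andP[] := bn01 n j x.
rewrite (bigD1 (Ordinal kn))//= subKr -[leRHS]mulr1 ler_wpM2l//.
  by have /andP[] := bn01 n k x.
by apply: prodr_ile1 => j _; rewrite subKr; exact: bn01.
Unshelve. all: by end_near. Qed.

Lemma compact_in_ball (K : set V) : compact K -> exists2 r, 0 < r &
  K `<=` [set y : V | `|y - 0| < r].
Proof.
move=> /compact_bounded[M [_ KM]]; exists (`|M| + 1 + 1).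
  by rewrite ltr_wpDl// addr_ge0.
move=> y Ky /=; rewrite subr0; have := KM (`|M| + 1) _ y Ky.
move=> h; apply: (@le_lt_trans _ _ (`|M| + 1)); last by rewrite ltrDl.
by apply: h; rewrite (le_lt_trans (ler_norm _))// ltrDl.
Qed.

Lemma continuous_compact_support_bounded f K : continuous f -> compact K ->
  (forall x, ~ K x -> f x = 0) -> exists2 M, 0 <= M & forall x, `|f x| <= M.
Proof.
move=> cf cK f0; have : compact (f @` K).
  by apply: continuous_compact => //; exact: continuous_subspaceT.
move=> /compact_bounded[M [_ KM]]; exists (`|M| + 1) => [|x]; first by rewrite addr_ge0.
have [Kx|/f0 ->] := pselect (K x); last by rewrite normr0 addr_ge0.
apply: (KM (`|M| + 1)); last by exists x.
by rewrite (le_lt_trans (ler_norm _))// ltrDl.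
Qed.

Lemma bump_class_meas U f : bump_class U f -> Lmeas f.
Proof. by move=> [/elementary_continuous/Lmeas_continuous]. Qed.

Lemma Lsummable_compact_support f K : continuous f -> compact K ->
  (forall x, ~ K x -> f x = 0) -> Lsummable f.
Proof.
move=> cf cK f0; have [M M0 fM] := continuous_compact_support_bounded cf cK f0.
have [r r0 Kr] := compact_in_ball cK.
apply: (@Lsummable_ball _ _ _ 0 r M) => //; first exact: Lmeas_continuous.
by move=> x xr; apply: f0 => /Kr /=; rewrite ltNge xr.
Qed.

Lemma Lsq_compact_support f K : continuous f -> compact K ->
  (forall x, ~ K x -> f x = 0) -> Lsq f.
Proof.
move=> cf cK f0; split; first exact: mf_continuous.
apply: (@Lsummable_compact_support (fun x : V => f x ^+ 2) K) => // [x|x /f0 ->].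
  exact: (cvgM (cf x) (cf x)).
by rewrite expr0n.
Qed.

Lemma bump_class_Lsq U f : bump_class U f -> Lsq f.
Proof.
move=> [ef [K [cK _ f0]]]; apply: (@Lsq_compact_support _ K) => //.
exact: elementary_continuous.
Qed.

End test_functions.

(** * Density of test functions *)

Section density.
Import HBNNSimple.
Context {R : realType} {N : nat}.
Notation V := 'rV[R]_N.
Notation T := (lebT R N).
Notation mu := (@leb R N).
Implicit Types (f g : V -> R) (U : set V) (e : R).

Section weighted.
Variable chi : V -> R.
Variable U : set V.
Hypothesis chiU : bump_class U chi.
Hypothesis chi01 : forall x, 0 <= chi x <= 1.

(** Approximation by smooth functions in the square mean with weight [chi];
    multiplication by [chi] turns the approximating functions into test functions. *)
Definition approximable f := Lsq (fun x => chi x * f x) /\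
  forall e, 0 < e -> exists2 phi, elementary phi &
    Lint (fun x => (chi x * f x - chi x * phi x) ^+ 2) < e.

Let chi_s : Lsq chi. Proof. exact: bump_class_Lsq chiU. Qed.

Let chi_norm x : `|chi x| = chi x.
Proof. by rewrite ger0_norm//; have /andP[] := chi01 x. Qed.

Let chiM_s phi : elementary phi -> Lsq (fun x => chi x * phi x).
Proof. by move=> ephi; exact: (bump_class_Lsq (bump_classM chiU ephi)). Qed.

Lemma approximable_lim (f_ : nat -> V -> R) f :
  (forall n, approximable (f_ n)) -> Lsq (fun x => chi x * f x) ->
  Lsqmean_null (fun n x => chi x * f x - chi x * f_ n x) -> approximable f.
Proof.
move=> af sf /Lsqmean_nullE[_ f0]; split=> // e e0.
move/cvgr0Pnorm_lt : f0 => /(_ (e / 4)) []; first by rewrite divr_gt0.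
move=> n _ /(_ _ (leqnn n)); rewrite ger0_norm ?Lint_sq_ge0// => fn.
have [sn /(_ (e / 4))[|phi ephi phin]] := af n; first by rewrite divr_gt0.
exists phi => //; have := Lint_sq_add_le (LsqB sf sn) (LsqB sn (chiM_s ephi)).
under Lint_ext do rewrite addrA subrK.
by move=> h; apply: (le_lt_trans h); lra.
Qed.

Lemma approximable_dct (f_ : nat -> V -> R) f :
  (forall n, Lmeas (f_ n)) ->
  (forall n x, 0 <= f_ n x <= 1) -> (forall x, 0 <= f x <= 1) ->
  (forall x, (f_ ^~ x) @ \oo --> f x) ->
  (forall n, approximable (f_ n)) -> approximable f.
Proof.
move=> mf_ f01_ f01 fl af.
have mf : Lmeas f by apply: Lmeas_cvg mf_ _.
have mchi := Lsq_mf chi_s.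
apply: (approximable_lim af).
  apply: (@Lsq_dom _ _ _ chi 1) => //; first by lmeas.
  apply: LaeW => x; rewrite mul1r normrM ler_piMr//.
  by have /andP[f0 f1] := f01 x; rewrite ger0_norm.
apply: (Lsqmean_null_dct _ chi_s).
- by move=> n; lmeas.
- move=> n; apply: LaeW => x; rewrite -mulrBr normrM ler_piMr// ler_norml.
  by have /andP[? ?] := f01 x; have /andP[? ?] := f01_ n x; apply/andP; split; lra.
apply: LaeW => x; under eq_fun do rewrite -mulrBr.
by apply: cvg0Z; have := cvgB (cvg_cst (f x)) (fl x); rewrite subrr; exact.
Qed.

Definition smooth_limit f := exists s : nat -> V -> R,
  [/\ forall n, elementary (s n), forall n x, 0 <= s n x <= 1 &
      forall x, (s ^~ x) @ \oo --> f x].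

(** [1 - (1 - p)^n] tends to the indicator of the set where [p] is positive, for
    [p] between [0] and [1]. *)
Lemma smooth_limit_halfspace (i : 'I_N) (c : R) :
  smooth_limit (fun x => (c < x 0 i)%R%:R).
Proof.
pose p (x : V) := psi (x 0 i - c).
have p01 x : 0 <= 1 - p x <= 1.
  by rewrite /p subr_ge0 psi_le1 lerBlDr lerDl psi_ge0.
exists (fun n x => 1 - (1 - p x) ^+ n); split.
- move=> n; rewrite (_ : (fun x => _) = fun x => 1 + -1 * \prod_(j < n) (1 + -1 * p x)).
    apply: elementaryD; first exact: elementary_cst.
    apply: elementaryZ; apply: (@elementary_prod _ _ _ _ (fun _ x => _)) => _.
    apply: elementaryD; first exact: elementary_cst.
    apply: elementaryZ; apply: (@elementary_coord _ _ i (fun t => psi (t - c))).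
    have := smooth1_affine 1 (- c) (smooth1_flat 1).
    by congr smooth1; apply/funext => t; rewrite mul1r.
  by apply/funext => x; rewrite prodr_const card_ord !mulN1r.
- move=> n x; have /andP[? ?] := p01 x.
  by rewrite subr_ge0 exprn_ile1//= lerBlDr lerDl exprn_ge0.
move=> x; have [cx|xc] := ltP c (x 0 i).
  rewrite -[X in _ --> X]subr0; apply: cvgB; first exact: cvg_cst.
  have /andP[p0 p1] := p01 x; apply: cvg_expr; rewrite ger0_norm//.
  by rewrite ltrBlDr ltrDl psi_gt0 subr_gt0.
rewrite (_ : (fun n => _) = fun=> 0); first exact: cvg_cst.
by apply/funext => n; rewrite /p psi_eq0 ?subr_le0// subr0 expr1n subrr.
Qed.

Lemma smooth_limitC f : smooth_limit f -> smooth_limit (fun x => 1 - f x).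
Proof.
move=> [s [es s01 sf]]; exists (fun n x => 1 - s n x); split.
- move=> n; rewrite (_ : (fun x => _) = fun x => 1 + -1 * s n x).
    by apply: elementaryD; [exact: elementary_cst|exact: elementaryZ].
  by apply/funext => x; rewrite mulN1r.
- by move=> n x; have /andP[? ?] := s01 n x; rewrite subr_ge0 lerBlDr lerDl; apply/andP.
by move=> x; apply: cvgB; [exact: cvg_cst|exact: sf].
Qed.

Lemma smooth_limit_prod (I : Type) (r : seq I) (F : I -> V -> R) :
  (forall i, smooth_limit (F i)) -> smooth_limit (fun x => \prod_(i <- r) F i x).
Proof.
move=> FF; elim: r => [|i r [s [es s01 sF]]].
  exists (fun _ _ => 1); split=> [_|_ x|x]; first exact: elementary_cst.
    by rewrite ler01 lexx.
  by rewrite big_nil; exact: cvg_cst.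
have [s' [es' s01' sF']] := FF i.
exists (fun n x => s' n x * s n x); split.
- by move=> n; exact: elementaryM.
- move=> n x; have /andP[? ?] := s01 n x; have /andP[? ?] := s01' n x.
  by rewrite mulr_ge0//= mulr_ile1.
by move=> x; rewrite big_cons; exact: cvgM.
Qed.

Lemma smooth_limit_approximable f : (forall x, 0 <= f x <= 1) -> smooth_limit f ->
  approximable f.
Proof.
move=> f01 [s [es s01 sf]]; apply: (approximable_dct _ s01 f01 sf).
  by move=> n; exact/Lmeas_continuous/elementary_continuous.
move=> n; split; first exact: chiM_s.
move=> e e0; exists (s n) => //; under Lint_ext do rewrite subrr expr0n.
by rewrite Lint0.
Qed.

(** Boxes are finite intersections of half-spaces and of complements of
    half-spaces, and a countable union of boxes is a limit of finite unions. *)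
Lemma approximable_cover (F : nat -> option (V * V)) :
  approximable \1_(\bigcup_k box (F k)).
Proof.
pose f_ n (x : V) : R := \1_(\bigcup_(k in `I_n) box (F k)) x.
have fE n x : f_ n x = 1 - \prod_(k < n) (1 - \1_(box (F k)) x).
  elim: n => [|n IH].
    by rewrite /f_ bigcup_mkord !big_ord0 subrr indic0.
  move: IH; rewrite /f_ !bigcup_mkord !big_ord_recr/= !indicE => IH.
  rewrite in_setU; move: IH; case: (x \in \big[setU/set0]_(i < n) _) => /= IH.
    have -> : \prod_(i < n) (1 - (x \in box (F i))%:R) = 0 :> R by lra.
    by rewrite mul0r subr0.
  have -> : \prod_(i < n) (1 - (x \in box (F i))%:R) = 1 :> R by lra.
  by rewrite mul1r; case: (_ \in _) => /=; lra.
have bE k : smooth_limit (fun x => 1 - \1_(box (F k)) x).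
  apply: smooth_limitC; case: (F k) => [[a b]|] /=; last first.
    exists (fun _ _ => 0); split=> [_|_ x|x]; first exact: elementary_cst.
      by rewrite lexx ler01.
    by rewrite indic0; exact: cvg_cst.
  have := @smooth_limit_prod 'I_N (index_enum 'I_N)
    (fun i x => \prod_(c <- [:: true; false]) (if c then (a 0 i < x 0 i)%R%:R
       else 1 - (b 0 i < x 0 i)%R%:R)).
  pose Q : set V := [set x | forall i, a 0 i < x 0 i /\ x 0 i <= b 0 i].
  rewrite (_ : (fun x : V => _) = \1_Q).
    apply=> i; apply: (@smooth_limit_prod _ _ (fun c x => if c then (a 0 i < x 0 i)%R%:R
       else 1 - (b 0 i < x 0 i)%R%:R)) => -[].
      exact: smooth_limit_halfspace.
    exact/smooth_limitC/smooth_limit_halfspace.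
  apply/funext => x; rewrite indicE.
  case: (boolP (x \in Q)) => [/set_mem /= xab|/negP xab].
    rewrite big1// => i _; have [-> xb] := xab i.
    by rewrite !big_cons big_nil ltNge xb /= subr0 !mulr1.
  have /existsNP[i xi] : ~ forall i, a 0 i < x 0 i /\ x 0 i <= b 0 i.
    by move=> h; apply: xab; exact: mem_set.
  rewrite (bigD1 i)//= !big_cons big_nil mulr1.
  have [ai|ai] := ltP (a 0 i) (x 0 i); last by rewrite !mul0r.
  have [bi|bi] := ltP (b 0 i) (x 0 i); last by exfalso; apply: xi.
  by rewrite subrr mulr0 mul0r.
apply: (@approximable_dct f_).
- move=> n; apply: Lmeas_indic; apply: bigcup_measurable => k _.
  exact: box_measurable.
- by move=> n x; exact: indic01.
- by move=> x; exact: indic01.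
- move=> x; rewrite indicE; case: (boolP (x \in _)) => [/set_mem[k _ xk]|/negP xk].
    apply: cvg_near_cst; near=> n; rewrite /f_ indicE mem_set//.
    by exists k => //=; near: n; exact: nbhs_infty_gt.
  apply: cvg_near_cst; near=> n; rewrite /f_ indicE memNset// => -[k _ xFk].
  by apply: xk; apply: mem_set; exists k.
move=> n; apply: smooth_limit_approximable; first by move=> x; exact: indic01.
rewrite (_ : f_ n = fun x => 1 - \prod_(k < n) (1 - \1_(box (F k)) x)).
  exact/smooth_limitC/smooth_limit_prod.
by apply/funext => x; exact: fE.
Unshelve. all: by end_near. Qed.

(** Lebesgue measure is outer regular with respect to countable unions of boxes. *)
Lemma approximable_finite_measure (E : set V) : Lset E -> (mu E < +oo)%E ->
  approximable \1_E.
Proof.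
move=> mE Eoo; have /LsetP mE' := mE; have Efin : mu E \is a fin_num by rewrite ge0_fin_numE.
have /choice[F FP] (n : nat) : exists F : nat -> option (V * V),
    E `<=` \bigcup_k box (F k) /\
    (mu (\bigcup_k box (F k) `\` E) <= (n.+1%:R^-1)%:E)%E.
  have n0 : (0 < n.+1%:R^-1 :> R) by [].
  have [_ [F EF <-] Fn] := lb_ereal_inf_adherent n0 Efin.
  have mG : measurable (\bigcup_k box (F k) : set T).
    by apply: bigcupT_measurable => k; exact: box_measurable.
  have GFn : (mu (\bigcup_k box (F k)) <= mu E + (n.+1%:R^-1)%:E)%E.
    apply: le_trans (ltW Fn).
    have := outer_measure_sigma_subadditive (@leb_outer R N) (fun k => box (F k)).
    move=> /le_trans; apply; apply: lee_nneseries => [k _ _|k _].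
      exact: (outer_measure_ge0 (@leb_outer R N)).
    exact: leb_box_le.
  exists F; split=> //; rewrite measureD//; last first.
    by apply: le_lt_trans GFn _; rewrite lte_add_pinfty// ltry.
  rewrite setIidr//; first by rewrite leeBlDr// addeC.
apply: (@approximable_lim (fun n => \1_(\bigcup_k box (F n k)))).
- by move=> n; exact: approximable_cover.
- apply: (@Lsq_dom _ _ _ chi 1) => //.
    by apply: measurable_funM; [exact: Lsq_mf chi_s|exact: Lmeas_indic].
  apply: LaeW => x; rewrite mul1r normrM ler_piMr//.
  by have /andP[? ?] := indic01 E x; rewrite ger0_norm.
have mG n : Lset (\bigcup_k box (F n k)).
  by apply: Lset_bigcup => k; exact: Lset_box.
have sG n : Lsummable \1_(\bigcup_k box (F n k) `\` E).
  apply: Lsummable_indic; first by apply: LsetD => //; exact: mG.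
  by apply: le_lt_trans (proj2 (FP n)) _; exact: ltry.
have sD n : Lsq (fun x => chi x * \1_E x - chi x * \1_(\bigcup_k box (F n k)) x).
  have mG' : Lmeas (\1_(\bigcup_k box (F n k)) : V -> R) by exact: Lmeas_indic.
  have mE1 : Lmeas (\1_E : V -> R) by exact: Lmeas_indic.
  have mchi := Lsq_mf chi_s.
  apply: (@Lsq_dom _ _ _ chi 1) => //; first by lmeas.
  apply: LaeW => x; rewrite mul1r -mulrBr normrM ler_piMr// ler_norml.
  have /andP[? ?] := indic01 E x; have /andP[? ?] := indic01 (\bigcup_k box (F n k)) x.
  by apply/andP; split; lra.
apply/Lsqmean_nullE; split=> //.
apply: cvg0_le (cvg_harmonic) => n; rewrite Lint_sq_ge0 /= /harmonic.
have [EF Fn] := FP n.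
apply: (@le_trans _ _ (Lint (\1_(\bigcup_k box (F n k) `\` E) : V -> R))).
  apply: Lle_int => //; first by have [] := sD n.
  apply: LaeW => x; rewrite !indicE in_setD.
  have /andP[c0 c1] := chi01 x.
  case: (boolP (x \in E)) => [/set_mem xE|xE].
    by rewrite mem_set ?subrr ?expr0n//; exact: EF.
  rewrite mulr0 andbT sub0r sqrrN; case: (_ \in _); rewrite /= ?mulr1 ?mulr0 ?expr0n//.
  by rewrite exprn_ile1.
rewrite -lee_fin EFin_Lint_indic//; first by apply: LsetD => //; exact: mG.
by apply: le_lt_trans Fn _; exact: ltry.
Qed.

Lemma approximable_indic (E : set V) : Lset E -> approximable \1_E.
Proof.
move=> mE; have [_ [K [cK _ chi0]]] := chiU.
have [r r0 Kr] := compact_in_ball cK.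
pose B : set V := [set y : V | `|y - 0| < r].
have mB : Lset B by exact: Lset_ball.
have EB : (fun x => chi x * \1_E x) = (fun x => chi x * \1_(E `&` B) x).
  apply/funext => x; rewrite !indicE in_setI.
  have [xB|xB] := boolP (x \in B); first by rewrite andbT.
  rewrite chi0 ?mul0r// => /Kr xr; move/negP : xB; apply; exact: mem_set.
have [] := @approximable_finite_measure (E `&` B); first exact: LsetI.
  apply: le_lt_trans (leb_ball_lty 0 r); apply: (le_outer_measure (@leb_outer R N)).
  exact: subIsetr.
rewrite -EB => s h; split=> // e /h[phi ephi].
move=> pe; exists phi => //; move: pe; congr (_ < _).
by apply: Lint_ext => x; have /(congr1 (fun f => f x)) /= -> := EB.
Qed.

Lemma approximableD f g : approximable f -> approximable g ->
  approximable (fun x => f x + g x).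
Proof.
move=> [sf fe] [sg ge]; split.
  by under eq_fun do rewrite mulrDr; exact: LsqD.
move=> e e0; have e4 : 0 < e / 4 by rewrite divr_gt0.
have [p ep pe] := fe _ e4; have [q eq qe] := ge _ e4.
exists (fun x => p x + q x); first exact: elementaryD.
have := Lint_sq_add_le (LsqB sf (chiM_s ep)) (LsqB sg (chiM_s eq)).
under Lint_ext do rewrite addrACA -opprD -!mulrDr.
by move=> h; apply: (le_lt_trans h); lra.
Qed.

Lemma approximableZ c f : approximable f -> approximable (fun x => c * f x).
Proof.
move=> [sf fe]; split.
  by under eq_fun do rewrite mulrCA; exact: LsqZ.
move=> e e0; have c0 : 0 < c ^+ 2 + 1 by rewrite ltr_wpDl// sqr_ge0.
have [p ep pe] := fe _ (divr_gt0 e0 c0).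
exists (fun x => c * p x); first exact: elementaryZ.
under Lint_ext do rewrite !(mulrCA (chi _)) -mulrBr exprMn.
have si := Lsq_summable (LsqB sf (chiM_s ep)).
rewrite LintZ//; move: pe; rewrite ltr_pdivlMr//.
have := Lint_sq_ge0 (fun x => chi x * f x - chi x * p x).
set I := Lint _ => I0 h.
by apply: (le_lt_trans _ h); rewrite mulrC ler_wpM2l// lerDl.
Qed.

Lemma approximable_ge0 f : Lsq f -> (forall x, 0 <= f x) ->
  approximable f.
Proof.
move=> sf f0; have mf := Lsq_mf sf.
have mfE : measurable_fun [set: lebT R N] (EFin \o f : T -> \bar R) by exact/measurable_EFinP.
pose sn n : {nnsfun (lebT R N) >-> R} := nnsfun_approx measurableT mfE n.
pose s n : V -> R := fun x => sn n x.
have sl x : (fun n => s n x) @ \oo --> f x.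
  have h0 (t : T) : [set: T] t -> (0 <= (EFin \o f) t)%E by rewrite lee_fin.
  by have /fine_cvgP[_] := cvg_nnsfun_approx measurableT mfE h0 (I : [set: T] x).
have sle n x : 0 <= s n x <= f x.
  apply/andP; split; first exact: fun_ge0.
  have nd : nondecreasing_seq (fun n => s n x).
    by move=> a b ab; have /lefP := nd_nnsfun_approx measurableT mfE ab; exact.
  by have := nondecreasing_cvgn_le nd (cvgP _ (sl x)) n; rewrite (cvg_lim _ (sl x)).
have mchi := Lsq_mf chi_s.
have chile x : `|chi x| <= 1 by rewrite chi_norm; have /andP[] := chi01 x.
apply: (@approximable_lim (fun n x => s n x)).
- move=> n.
  have [l sE] : exists l : seq R, forall x,
      s n x = \sum_(y <- l) y * \1_(s n @^-1` [set y]) x.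
    exists (finmap.enum_fset (fset_set (range (sn n)))) => x.
    by rewrite /s (fimfunE (sn n)) fsbig_finite.
  rewrite (_ : (fun x => _) = (fun x => \sum_(y <- l) y * \1_(s n @^-1` [set y]) x)).
    2: by apply/funext.
  elim: l {sE} => [|y l IH].
    rewrite (_ : (fun x => _) = (fun x : V => 0 * \1_[set: V] x)).
      exact: (approximableZ 0 (approximable_indic LsetT)).
    by apply/funext => x; rewrite big_nil mul0r.
  rewrite (_ : (fun x => _) = (fun x => y * \1_(s n @^-1` [set y]) x +
     \sum_(y <- l) y * \1_(s n @^-1` [set y]) x)); last first.
    by apply/funext => x; rewrite big_cons.
  have my : Lset (s n @^-1` [set y]).
    by apply/LsetP; exact: (@measurable_sfunP _ _ _ _ (sn n)).
  exact: (approximableD (approximableZ y (approximable_indic my)) IH).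
- exact: (Lsq_bdM mchi chile).
apply: (Lsqmean_null_dct _ sf).
- move=> n; have ms : Lmeas (s n) by apply/LmeasP; exact: (@measurable_funPT _ _ _ _ (sn n)).
  by lmeas.
- move=> n; apply: LaeW => x; have /andP[s0 sx] := sle n x.
  rewrite -mulrBr normrM -[leRHS]mul1r ler_pM// ger0_norm ?subr_ge0//.
  by rewrite ger0_norm// lerBlDr lerDl.
apply: LaeW => x; under eq_fun do rewrite -mulrBr.
by apply: cvg0Z; have := cvgB (cvg_cst (f x)) (sl x); rewrite subrr; exact.
Qed.

Lemma Lsq_approximable f : Lsq f -> approximable f.
Proof.
move=> sf; have mf := Lsq_mf sf.
pose p x := 2^-1 * (`|f x| + f x); pose q x := 2^-1 * (`|f x| - f x).
have mp : Lmeas p by rewrite /p; lmeas.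
have mq : Lmeas q by rewrite /q; lmeas.
have hn x : - `|f x| <= f x <= `|f x| by rewrite -ler_norml.
have ap : approximable p.
  apply: approximable_ge0 => [|x]; last by have /andP[? ?] := hn x; rewrite /p; lra.
  apply: (@Lsq_dom _ _ _ f 1) => //; apply: LaeW => x.
  by have /andP[? ?] := hn x; rewrite mul1r /p ger0_norm; lra.
have aq : approximable q.
  apply: approximable_ge0 => [|x]; last by have /andP[? ?] := hn x; rewrite /q; lra.
  apply: (@Lsq_dom _ _ _ f 1) => //; apply: LaeW => x.
  by have /andP[? ?] := hn x; rewrite mul1r /q ger0_norm; lra.
have -> : f = fun x => p x + -1 * q x by apply/funext => x; rewrite /p /q; lra.
exact/approximableD/approximableZ.
Qed.

End weighted.

(** The cut-off that brings [f] to compact support in [U] also serves as the weight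
    in the smooth approximation. *)
Lemma bump_class_dense U f e : open U -> Lsq f ->
  (forall x, ~ U x -> f x = 0) -> 0 < e ->
  exists2 phi, bump_class U phi & Lint (fun x => (f x - phi x) ^+ 2) < e.
Proof.
move=> oU sf f0 e0; have [chi [chiU chi01 chi1]] := cutoff_sequence oU.
have mf := Lsq_mf sf.
have chile n x : `|chi n x| <= 1.
  by have /andP[? ?] := chi01 n x; rewrite ger0_norm.
have mchi n : Lmeas (chi n) by exact: bump_class_meas (chiU n).
have scf n : Lsq (fun x => chi n x * f x) := Lsq_bdM (mchi n) (chile n) sf.
have /Lsqmean_nullE[_] : Lsqmean_null (fun n x => f x - chi n x * f x).
  apply: (Lsqmean_null_dct _ sf) => [n|n|]; first by lmeas.
    apply: LaeW => x; rewrite -{1}[f x]mul1r -mulrBl normrM ler_piMl//.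
    by have /andP[? ?] := chi01 n x; rewrite ler_norml; apply/andP; split; lra.
  apply: LaeW => x; have [Ux|Ux] := pselect (U x); last first.
    by rewrite f0//; under eq_fun do rewrite mulr0 subrr; exact: cvg_cst.
  have := cvgB (cvg_cst (f x)) (cvgM (chi1 x Ux) (cvg_cst (f x))).
  by rewrite mul1r subrr; exact.
have e4 : 0 < e / 4 by rewrite divr_gt0.
move/cvgr0Pnorm_lt => /(_ _ e4)[n _ /(_ _ (leqnn n))].
rewrite ger0_norm ?Lint_sq_ge0// => fn.
have [_ /(_ _ e4)[phi ephi pe]] := Lsq_approximable (chiU n) (chi01 n) sf.
exists (fun x => chi n x * phi x); first exact: bump_classM.
have sp := bump_class_Lsq (bump_classM (chiU n) ephi).
have := Lint_sq_add_le (LsqB sf (scf n)) (LsqB (scf n) sp).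
under Lint_ext do rewrite addrA subrK.
by move=> h; apply: (le_lt_trans h); lra.
Qed.

(** Testing against [phi] in the form [2 w phi <= A + phi^2] bounds the norm of
    [w] without any square root: take [phi] close to [w]. *)
Lemma int_sq_le_dual U w A : open U -> Lsq w ->
  (forall x, ~ U x -> w x = 0) ->
  (forall phi, bump_class U phi -> 2 * Lint (fun x => w x * phi x) <=
     A + Lint (fun x => phi x ^+ 2)) ->
  Lint (fun x => w x ^+ 2) <= A.
Proof.
move=> oU sw w0 h; apply/ler_addgt0Pr => e e0.
have [phi bphi pe] := bump_class_dense oU sw w0 e0.
have sp := bump_class_Lsq bphi; have wi := Lsq_summable (sw); have pi := Lsq_summable (sp).
have := h _ bphi; have wpi := Lsq_summable (LsqB sw sp).
have -> : Lint (fun x => phi x ^+ 2) =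
    Lint (fun x => (w x - phi x) ^+ 2) - Lint (fun x => w x ^+ 2) + 2 * Lint (fun x => w x * phi x).
  rewrite -LintZ; last exact: LsqM.
  rewrite -LintB// -LintD; [|exact: LsummableB|exact/LsummableZ/LsqM].
  by apply: Lint_ext => x; ring.
by move=> ?; lra.
Qed.

(** By density it suffices to translate a test function, and then dominated
    convergence applies. *)
Lemma shift_continuous f e : Lsq f -> 0 < e -> exists2 d, 0 < d &
  forall h : V, `|h| < d -> Lint (fun x => (f (x + h) - f x) ^+ 2) < e.
Proof.
move=> sf e0; have e16 : 0 < e / 16 by rewrite divr_gt0.
have [phi bphi fphi] := @bump_class_dense setT f _ openT sf (fun x n => False_ind _ (n I)) e16.
have sp := bump_class_Lsq bphi.
suff [d d0 dP] : exists2 d, 0 < d & forall h : V, `|h| < d ->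
    Lint (fun x => (phi (x + h) - phi x) ^+ 2) < e / 16.
  exists d => // h hd; have := dP h hd.
  have s1 := LsqB sf sp; have s2 := Lsq_shift h s1.
  have s3 := LsqB (Lsq_shift h sp) sp.
  have e2 : Lint (fun x => (f (x + h) - phi (x + h)) ^+ 2) < e / 16.
    by have i1 := Lsq_summable (s1); rewrite (Lint_shift h i1).
  have h1 := Lint_sq_add_le s2 s3; have h2 := Lint_sq_add_le (LsqD s2 s3) (LsqN s1).
  rewrite /= in h1 h2.
  have e3 : Lint (fun x => (f (x + h) - f x) ^+ 2) =
      Lint (fun x => (f (x + h) - phi (x + h) + (phi (x + h) - phi x) + - (f x - phi x)) ^+ 2).
    by apply: Lint_ext => x; congr (_ ^+ 2); ring.
  have e4 : Lint (fun x => (- (f x - phi x)) ^+ 2) = Lint (fun x => (f x - phi x) ^+ 2).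
    by apply: Lint_ext => x; rewrite sqrrN.
  by rewrite e3; rewrite e4 in h2; lra.
apply: contrapT => /forall2NP nd.
have /choice[h hP] (n : nat) : exists h : V, `|h| < n.+1%:R^-1 /\
    e / 16 <= Lint (fun x => (phi (x + h) - phi x) ^+ 2).
  have [//|/existsNP[h /not_implyP[hn /negP]]] := nd n.+1%:R^-1.
  by rewrite -leNgt; exists h.
have [ephi [K [cK _ phi0]]] := bphi.
have cphi := elementary_continuous ephi.
have [M M0 phiM] := continuous_compact_support_bounded cphi cK phi0.
have [r r0 Kr] := compact_in_ball cK.
have h1 n : `|h n| <= 1.
  have [/ltW hn _] := hP n; rewrite (le_trans hn)// invf_le1//.
  by rewrite ler1n.
pose B : set V := [set y : V | `|y - 0| < r + 1].
have mB : Lset B by exact: Lset_ball.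
have mI : Lmeas (\1_B : V -> R) by exact: Lmeas_indic.
have sB : Lsq (fun x : V => (2 * M) * \1_B x).
  apply: LsqZ; split=> //.
  apply: (@Lsummable_ball _ _ _ 0 (r + 1) 1) => //; first by lmeas.
    move=> x; rewrite normrX exprn_ile1//.
    by have /andP[? ?] := indic01 B x; rewrite ger0_norm.
  move=> x xr; rewrite indicE memNset ?expr0n//= /B /= => xr'.
  by move: xr; rewrite leNgt xr'.
have mphi := Lsq_mf sp.
have /Lsqmean_nullE[_] : Lsqmean_null (fun n x => phi (x + h n) - phi x).
  apply: (Lsqmean_null_dct _ sB) => [n|n|].
  - by lmeas.
  - apply: LaeW => x; rewrite indicE; case: (boolP (x \in B)) => [_|/negP xB] /=.
      rewrite mulr1 [leRHS]ger0_norm ?mulr_ge0//.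
      have := phiM x; have := phiM (x + h n); have := ler_normB (phi (x + h n)) (phi x).
      by move=> *; lra.
    have xr : r + 1 <= `|x|.
      by rewrite leNgt; apply/negP => h2; apply: xB; apply: mem_set; rewrite /B/= subr0.
    rewrite !phi0 ?subrr ?normr0//.
      by move=> /Kr /=; rewrite subr0; apply/negP; rewrite -leNgt (le_trans _ xr)// lerDl.
    move=> /Kr /=; rewrite subr0; apply/negP; rewrite -leNgt.
    have := ler_normB (x + h n) (h n); rewrite addrK => h2.
    by have := h1 n; lra.
  apply: LaeW => x; have hl : h @ \oo --> (0 : V).
    apply/cvgr0Pnorm_lt => e' e'0.
    have [m _ mP] := near_infty_natSinv_lt (PosNum e'0).
    exists m => // n /mP /=; have [hn _] := hP n; exact: lt_trans.
  have hl' : (fun n => x + h n) @ \oo --> x.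
    by rewrite -[X in _ --> X]addr0; apply: cvgD => //; exact: cvg_cst.
  have := cvgB (cvg_comp _ _ hl' (cphi x)) (cvg_cst (phi x)).
  by rewrite subrr; exact.
move/cvgr0Pnorm_lt => /(_ _ e16)[n _ /(_ _ (leqnn n))].
rewrite ger0_norm ?Lint_sq_ge0//; apply/negP; rewrite -leNgt.
by have [] := hP n.
Qed.

End density.

(** * Weak gradients and difference quotients *)

Section weak_gradients.
Context {R : realType} {N : nat}.
Notation V := 'rV[R]_N.
Notation mu := (@leb R N).
Implicit Types (u w : V -> R) (g : 'I_N -> V -> R) (S U W : set V) (h : V).

Lemma derive_off_support (f : V -> R) (K : set V) (v x : V) : compact K ->
  (forall x, ~ K x -> f x = 0) -> ~ K x -> 'D_v f x = 0.
Proof.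
move=> cK f0 Kx.
have cl : closed K by apply: compact_closed => //; exact: norm_hausdorff.
rewrite (@near_eq_derive _ _ _ f (cst 0)); first exact: derive_cst.
have : nbhs x (~` K) by apply: open_nbhs_nbhs; split=> //; exact: closed_openC.
by apply: filterS => y /f0.
Qed.

Lemma test_Lsq U f : test_function U f -> Lsq f.
Proof.
by move=> [sf [K [cK _ f0]]]; apply: (@Lsq_compact_support _ _ _ K) => //; exact: (sf 0%N).
Qed.

Lemma test_derive_continuous U f i : test_function U f ->
  continuous (fun x => 'D_(unit_vec i) f x).
Proof. by move=> [sf _]; have [_ /(_ i)[_ ]] := sf 1%N. Qed.

Lemma test_derive_Lsq U f i : test_function U f -> Lsq (fun x => 'D_(unit_vec i) f x).
Proof.
move=> tf; have [_ [K [cK _ f0]]] := tf.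
apply: (@Lsq_compact_support _ _ _ K) => //; first exact: test_derive_continuous tf.
by move=> x; exact: derive_off_support.
Qed.

(** A function of [H^1(S)] with its weak gradient, both extended by zero: translations
    and difference quotients then make sense in the whole space. *)
Definition H1ext S u g :=
  [/\ Lsq u, forall i, Lsq (g i), forall x, ~ S x -> u x = 0,
      forall i x, ~ S x -> g i x = 0 &
      forall i phi, test_function S phi ->
        Lint (fun x => u x * 'D_(unit_vec i) phi x) = - Lint (fun x => g i x * phi x)].

Lemma sq_integrable_ext S u : open S -> sq_integrable S u -> Lsq (u \_ S).
Proof.
move=> oS [mu_ iu]; apply/LsqP; split.
  by apply/LmeasP; exact: ((@measurable_restrictT _ _ (lebT R N) R S u (measurable_open oS)).1 mu_).
rewrite integral_mkcond in iu; apply: le_lt_trans iu.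
rewrite le_eqVlt; apply/orP; left; apply/eqP; apply: eq_integral => x _.
by rewrite !patchE; case: ifP => // _; rewrite expr0n.
Qed.

Lemma H1_ext S u (g : V -> V) : open S -> H1 S u g ->
  H1ext S (u \_ S) (fun i => (fun x => g x 0 i) \_ S).
Proof.
move=> oS [su sg wg]; split.
- exact: sq_integrable_ext.
- by move=> i; exact: sq_integrable_ext.
- by move=> x Sx; rewrite patchE memNset.
- by move=> i x Sx; rewrite patchE memNset.
move=> i phi tphi; have := wg i phi tphi.
rewrite [X in X = _]integral_mkcond [in X in _ = X]integral_mkcond => h.
have fin : forall (F G : V -> \bar R), F =1 G -> (\int[mu]_x F x = \int[mu]_x G x)%E.
  by move=> F G /funext ->.
have -> : Lint (fun x => (u \_ S) x * 'D_(unit_vec i) phi x) =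
    fine (\int[mu]_x ((fun x => (u x * 'D_(unit_vec i) phi x)%:E) \_ S) x)%E.
  congr fine; apply: fin => x; rewrite !patchE; case: ifP => // _.
  by rewrite mul0r.
rewrite h fineN; congr (- fine _); apply: fin => x; rewrite !patchE.
by case: ifP => // _; rewrite mul0r.
Qed.

Lemma Lint_setE S (f : V -> R) : Lsummable f -> (forall x, ~ S x -> f x = 0) ->
  (\int[mu]_(x in S) (f x)%:E)%E = (Lint f)%:E.
Proof.
move=> fi f0; rewrite LEFin_int// integral_mkcond; apply: eq_integral => x _.
by rewrite patchE; case: (boolP (x \in S)) => // /negP Sx; rewrite f0// => /mem_set.
Qed.

Lemma Lsq_sq_integrable S u : open S -> Lsq u -> (forall x, ~ S x -> u x = 0) ->
  sq_integrable S u.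
Proof.
move=> oS su u0; split.
  by apply: (@measurable_funS _ _ _ _ setT) => //; apply/LmeasP; exact: Lsq_mf.
rewrite Lint_setE ?ltry//; first exact: Lsq_summable.
by move=> x /u0 ->; rewrite expr0n.
Qed.

Lemma ext_H1 S u g : open S -> H1ext S u g -> H1 S u (fun x => \row_i g i x).
Proof.
move=> oS [su sg u0 g0 wg]; split.
- exact: Lsq_sq_integrable.
- move=> i; rewrite (_ : (fun x => _) = g i); last by apply/funext => x; rewrite mxE.
  by apply: Lsq_sq_integrable => //; exact: g0.
move=> i phi tphi.
have s1 := test_Lsq tphi; have s2 := test_derive_Lsq i tphi.
rewrite Lint_setE; [|exact: LsqM|by move=> x /u0 ->; rewrite mul0r].
rewrite (_ : (fun x => _) = (fun x => (g i x * phi x)%:E)).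
  2: by apply/funext => x; rewrite mxE.
rewrite Lint_setE; [|exact: LsqM|by move=> x /g0 ->; rewrite mul0r].
by rewrite wg// EFinN.
Qed.

Lemma derive_shift (f : V -> R) (v a x : V) :
  'D_v (fun x => f (x + a)) x = 'D_v f (x + a).
Proof.
rewrite /derive; set A := (X in lim (X @ _)).
set B := (X in _ = lim (X @ _)); suff -> : A = B by [].
by apply/funext => t; rewrite /A /B /= addrA.
Qed.

Lemma elementary_shift (f : V -> R) (a : V) : elementary f ->
  elementary (fun x => f (x + a)).
Proof.
elim=> {f} [i f sf|c|f1 f2 _ e1 _ e2|f1 f2 _ e1 _ e2].
- rewrite (_ : (fun x : V => _) = fun x : V => (fun t => f (t + a 0 i)) (x 0 i)).
    apply: (@elementary_coord _ _ i (fun t => f (t + a 0 i))); have := smooth1_affine 1 (a 0 i) sf.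
    by congr smooth1; apply/funext => t; rewrite mul1r.
  by apply/funext => x; rewrite mxE.
- exact: elementary_cst.
- exact: elementaryD.
- exact: elementaryM.
Qed.

Lemma is_derive_line (f : V -> R) (x v : V) (s : R) :
  derivable f (x + s *: v) v ->
  is_derive s 1 (fun s => f (x + s *: v)) ('D_v f (x + s *: v)).
Proof.
move=> df.
have E : (fun h : R => h^-1 *: (((fun s => f (x + s *: v)) \o shift s) (h *: 1) - f (x + s *: v)))
  = (fun h : R => h^-1 *: ((f \o shift (x + s *: v)) (h *: v) - f (x + s *: v))).
  apply/funext => h /=; congr (_ *: (f _ - _)).
  by rewrite scalerDl scaler1 addrCA.
by split; [rewrite /derivable E|rewrite /derive E].
Qed.

Definition dirsum h g (x : V) := \sum_(i < N) h 0 i * g i x.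

Lemma dirsum_Lsq h g : (forall i, Lsq (g i)) -> Lsq (dirsum h g).
Proof. by move=> sg; apply: Lsq_sum => i; exact: LsqZ. Qed.

(** The integral of [u phi(. - s h)] is a differentiable function of [s], whose
    derivative is the integral of [(h . grad u) phi(. - s h)]: the mean value
    theorem between [0] and [1]. *)
Lemma weak_mean_value S u g phi h K : H1ext S u g -> elementary phi ->
  compact K -> (forall x, ~ K x -> phi x = 0) ->
  (forall s x, 0 <= s <= 1 -> K x -> S (x + s *: h)) ->
  exists2 xi, 0 <= xi <= 1 &
    Lint (fun x => u x * (phi (x - h) - phi x)) =
    Lint (fun x => dirsum h g x * phi (x - xi *: h)).
Proof.
move=> [su sg u0 g0 wg] ephi cK phi0 KS.
have cphi := elementary_continuous ephi.
pose dphi (x : V) := \sum_(i < N) (- h) 0 i * 'D_(unit_vec i) phi x.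
have edphi : elementary dphi.
  rewrite /dphi; elim: (index_enum _) => [|i l IH].
    by under eq_fun do rewrite big_nil; exact: elementary_cst.
  under eq_fun do rewrite big_cons; apply: elementaryD => //.
  exact/elementaryZ/elementary_derive.
have dphi0 x : ~ K x -> dphi x = 0.
  move=> Kx; rewrite /dphi big1// => i _.
  by rewrite (derive_off_support _ cK phi0 Kx) mulr0.
have [M M0 dphiM] := continuous_compact_support_bounded (elementary_continuous edphi) cK dphi0.
have [r r0 Kr] := compact_in_ball cK.
pose phi_ (s : R) (x : V) := phi (x + s *: - h).
have ephi_ s : elementary (phi_ s) by exact: elementary_shift.
have phi_Lsq s : Lsq (phi_ s).
  by apply: (@Lsq_shift _ _ (s *: - h)); apply: (Lsq_compact_support cphi cK phi0).
have tphi_ s : 0 <= s <= 1 -> test_function S (phi_ s).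
  move=> s01; apply: bump_class_test; split=> //.
  exists [set x + s *: h | x in K]; split.
  - apply: continuous_compact => //; apply: continuous_subspaceT => x.
    exact: (cvgD cvg_id (cvg_cst (s *: h))).
  - by move=> _ [x Kx <-]; exact: KS.
  - move=> x Kx; rewrite /phi_ phi0// => Kx'; apply: Kx; exists (x + s *: - h) => //.
    by rewrite scalerN subrK.
pose F (s : R) := Lint (fun x => u x * phi_ s x).
have dF (s : R) : 0 <= s <= 1 -> is_derive s (1 : R) F (Lint (fun x => dirsum h g x * phi_ s x)).
  move=> s01.
  have -> : Lint (fun x => dirsum h g x * phi_ s x) = Lint (fun x => u x * dphi (x + s *: - h)).
    have -> : Lint (fun x => u x * dphi (x + s *: - h)) =
        Lint (fun x => \sum_(i < N) (- h) 0 i * (u x * 'D_(unit_vec i) (phi_ s) x)).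
      apply: Lint_ext => x; rewrite mulr_sumr; apply: eq_bigr => i _.
      by rewrite derive_shift mulrCA.
    have su' i : Lsummable (fun x => u x * 'D_(unit_vec i) (phi_ s) x).
      by exact: (LsqM su (test_derive_Lsq i (tphi_ s s01))).
    have sg' i : Lsummable (fun x => g i x * phi_ s x) by exact: LsqM.
    rewrite Lint_sum; last by move=> i; exact: LsummableZ.
    have -> : Lint (fun x => dirsum h g x * phi_ s x) =
        Lint (fun x => \sum_(i < N) h 0 i * (g i x * phi_ s x)).
      by apply: Lint_ext => x; rewrite mulr_suml; apply: eq_bigr => i _; rewrite mulrA.
    rewrite Lint_sum; last by move=> i; exact: LsummableZ.
    apply: eq_bigr => i _; rewrite !LintZ// wg; last exact: tphi_.
    by rewrite mxE mulrNN.
  have s12 : -1 < s < 2 by have /andP[? ?] := s01; apply/andP; split; lra.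
  pose B := [set y : V | `|y - 0| < r + 2 * `|h|].
  apply: (@Lderive_under _ _ (fun s x => u x * phi_ s x)
    (fun s x => u x * dphi (x + s *: - h)) (fun x => `|u x| * (M * \1_B x)) (-1) 2) => //.
  - by move=> t _; exact: LsqM.
  - move=> t x _.
    have := is_derive_line (@elementary_derivable _ _ phi (x + t *: - h) (- h) ephi).
    rewrite elementary_derive_dir// -/(dphi _) => d.
    exact: (is_deriveZ (u x) d).
  - by apply: LsqM; [exact: Lsq_norm|exact: Lsq_ball_indic].
  move=> t x /andP[t1 t2]; rewrite normrM ler_wpM2l//.
  have [Kx|Kx] := pselect (K (x + t *: - h)); last first.
    by rewrite dphi0// normr0 mulr_ge0//; have /andP[] := indic01 B x.
  have xB : B x.
    rewrite /B /= subr0; have := Kr _ Kx; rewrite /= subr0 scalerN => hr.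
    rewrite -(subrK (t *: h) x) (le_lt_trans (ler_normD _ _))// normrZ ltr_leD//.
    by rewrite ler_wpM2r// ler_norml; apply/andP; split; lra.
  by rewrite indicE mem_set// mulr1.
have [||xi xi01 E] := @MVT _ F (fun s => Lint (fun x => dirsum h g x * phi_ s x)) 0 1 ltr01.
- move=> s; rewrite in_itv/= => /andP[/ltW ? /ltW ?]; apply: dF; exact/andP.
- apply: derivable_within_continuous => s; rewrite in_itv/= => s01.
  by have [] := dF s s01.
exists xi; first by move: xi01; rewrite in_itv/= => /andP[/ltW -> /ltW ->].
have -> : Lint (fun x => dirsum h g x * phi (x - xi *: h)) =
   Lint (fun x => dirsum h g x * phi_ xi x) by apply: Lint_ext => x; rewrite /phi_ scalerN.
move: E; rewrite subr0 mulr1 => <-; rewrite /F -LintB; [|exact: LsqM..].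
by apply: Lint_ext => x; rewrite /phi_ scale1r scale0r addr0 mulrBr.
Qed.

Section difference.
Variables (S W : set V) (u : V -> R) (g : 'I_N -> V -> R) (h : V).
Hypotheses (ug : H1ext S u g) (oW : open W).
Hypothesis WS : forall s x, 0 <= s <= 1 -> W x -> S (x + s *: h).

Let su : Lsq u. Proof. by case: ug. Qed.
Let sg i : Lsq (g i). Proof. by case: ug. Qed.

Lemma Lsq_indicM (A : set V) f : Lset A -> Lsq f -> Lsq (fun x => \1_A x * f x).
Proof.
move=> mA; apply: (@Lsq_bdM _ _ _ _ 1); first exact: Lmeas_indic.
by move=> x; have /andP[? ?] := indic01 A x; rewrite ger0_norm.
Qed.

Let test_diff phi : bump_class W phi -> exists2 xi, 0 <= xi <= 1 &
    Lint (fun x => (u (x + h) - u x) * phi x) =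
    Lint (fun x => dirsum h g (x + xi *: h) * phi x).
Proof.
move=> bphi; have [ephi [K [cK KW phi0]]] := bphi; have sp := bump_class_Lsq bphi.
have [|xi xi01 E] := weak_mean_value ug ephi cK phi0 (h := h).
  by move=> s x s01 /KW; exact: WS.
exists xi => //.
have sh f (a : V) : Lsq f -> Lint (fun x => f (x + a) * phi x) = Lint (fun x => f x * phi (x - a)).
  move=> sf; have fi : Lsummable (fun x => f (x + a) * phi x).
    exact: (LsqM (Lsq_shift a sf) sp).
  by rewrite -(Lint_shift (- a) fi); apply: Lint_ext => x; rewrite subrK.
rewrite sh; last exact: dirsum_Lsq.
rewrite -E.
have -> : Lint (fun x => (u (x + h) - u x) * phi x) =
    Lint (fun x => u (x + h) * phi x) - Lint (fun x => u x * phi x).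
  rewrite -LintB; [|exact: (LsqM (Lsq_shift h su) sp)|exact: LsqM].
  by apply: Lint_ext => x; rewrite mulrBl.
rewrite sh// -LintB; [|exact: (LsqM su (Lsq_shift (- h) sp))|exact: LsqM].
by apply: Lint_ext => x; rewrite mulrBr.
Qed.

Let indic_phi f phi : bump_class W phi ->
  Lint (fun x => \1_W x * f x * phi x) = Lint (fun x => f x * phi x).
Proof.
move=> [_ [K [_ KW phi0]]]; apply: Lint_ext => x; rewrite indicE.
have [Wx|Wx] := pselect (W x); first by rewrite mem_set// mul1r.
by rewrite phi0 ?mulr0// => /KW.
Qed.

Let indic_off (f : V -> R) x : ~ W x -> \1_W x * f x = 0.
Proof. by move=> Wx; rewrite indicE memNset// mul0r. Qed.

(** By duality: the mean value theorem turns the pairing of [u (x + h) - u x] with a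
    test function on [W] into that of the directional derivative of [u] with a
    translate of the test function. *)
Lemma int_diff_sq_le :
  Lint (fun x => (\1_W x * (u (x + h) - u x)) ^+ 2) <=
  Lint (fun x => dirsum h g x ^+ 2).
Proof.
have sd := dirsum_Lsq h sg.
apply: (@int_sq_le_dual _ _ W (fun x => \1_W x * (u (x + h) - u x))).
- exact: oW.
- by apply: Lsq_indicM; [exact: Lset_open|exact: (LsqB (Lsq_shift h su) su)].
- by move=> x; exact: (indic_off (fun x => u (x + h) - u x)).
move=> phi bphi; rewrite (indic_phi (fun x => u (x + h) - u x))//.
have [xi _ ->] := test_diff bphi.
have := Lint_mul_le1 (Lsq_shift (xi *: h) sd) (bump_class_Lsq bphi).
by rewrite (Lint_shift _ (Lsq_summable sd)).
Qed.

(** The same duality, after subtraction of the directional derivative; [A] controls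
    how much that derivative changes under the translations involved. *)
Lemma int_diff_quotient_le A :
  (forall s, 0 <= s <= 1 ->
     Lint (fun x => (dirsum h g (x + s *: h) - dirsum h g x) ^+ 2) <= A) ->
  Lint (fun x => (\1_W x * (u (x + h) - u x - dirsum h g x)) ^+ 2) <= A.
Proof.
move=> gA; have sd := dirsum_Lsq h sg.
have sB : Lsq (fun x => u (x + h) - u x) by exact: (LsqB (Lsq_shift h su) su).
apply: (@int_sq_le_dual _ _ W (fun x => \1_W x * (u (x + h) - u x - dirsum h g x))).
- exact: oW.
- by apply: Lsq_indicM; [exact: Lset_open|exact: LsqB].
- by move=> x; exact: (indic_off (fun x => u (x + h) - u x - dirsum h g x)).
move=> phi bphi; rewrite (indic_phi (fun x => u (x + h) - u x - dirsum h g x))//.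
have sp := bump_class_Lsq bphi.
have [xi xi01 E] := test_diff bphi.
have -> : Lint (fun x => (u (x + h) - u x - dirsum h g x) * phi x) =
   Lint (fun x => (dirsum h g (x + xi *: h) - dirsum h g x) * phi x).
  have sd' := Lsq_shift (xi *: h) sd.
  transitivity (Lint (fun x => (u (x + h) - u x) * phi x) - Lint (fun x => dirsum h g x * phi x)).
    rewrite -LintB; [|exact: LsqM|exact: LsqM].
    by apply: Lint_ext => x; rewrite mulrBl.
  rewrite E -LintB; [|exact: LsqM|exact: LsqM].
  by apply: Lint_ext => x; rewrite mulrBl.
have := Lint_mul_le1 (LsqB (Lsq_shift (xi *: h) sd) sd) sp.
by move=> /le_trans; apply; rewrite lerD2r; exact: gA.
Qed.

End difference.

Lemma dirsum_unit (t : R) i g x : dirsum (t *: unit_vec i) g x = t * g i x.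
Proof.
rewrite /dirsum (bigD1 i)//= big1 => [|j ji]; rewrite !mxE !eqxx/=.
  by rewrite mulr1 addr0.
by rewrite (negbTE ji) mulr0 mul0r.
Qed.

Lemma unit_vec_norm_le (i : 'I_N) : `|unit_vec i : V| <= 1.
Proof.
apply: normv_leP => // j; rewrite mxE eqxx/=.
by case: (j == i); rewrite ?normr1 ?normr0.
Qed.

(** The error is at most the modulus of continuity of the gradient under translations,
    in the square mean. *)
Lemma diff_quotient_null S W u g i (t : nat -> R) : H1ext S u g -> open W ->
  (forall n, 0 < t n) -> t @ \oo --> (0 : R) ->
  (forall n s x, 0 <= s <= 1 -> W x -> S (x + s *: (t n *: unit_vec i))) ->
  Lsqmean_null (fun n x => \1_W x * ((u (x + t n *: unit_vec i) - u x) / t n - g i x)).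
Proof.
move=> ug oW t0 tl WS; have [su sg _ _ _] := ug.
have sn n : Lsq (fun x => \1_W x * ((u (x + t n *: unit_vec i) - u x) / t n - g i x)).
  apply: Lsq_indicM; first exact: Lset_open.
  have := LsqZ (t n)^-1 (LsqB (Lsq_shift (t n *: unit_vec i) su) su).
  move=> /LsqB/(_ (sg i)); congr Lsq; apply/funext => x.
  by rewrite [_ / t n]mulrC.
apply/Lsqmean_nullE; split=> //; apply/cvgr0Pnorm_lt => e e0.
have e2 : 0 < e / 2 by rewrite divr_gt0.
have [d d0 dP] := shift_continuous (sg i) e2.
move/cvgr0Pnorm_lt : tl => /(_ _ d0); apply: filterS => n.
rewrite (ger0_norm (ltW (t0 n))) ger0_norm ?Lint_sq_ge0// => tnd.
have tn2 : 0 < t n ^+ 2 by rewrite exprn_gt0.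
suff : Lint (fun x => (\1_W x * (u (x + t n *: unit_vec i) - u x -
    dirsum (t n *: unit_vec i) g x)) ^+ 2) <= t n ^+ 2 * (e / 2).
  have -> : Lint (fun x => (\1_W x * (u (x + t n *: unit_vec i) - u x -
      dirsum (t n *: unit_vec i) g x)) ^+ 2) =
    t n ^+ 2 * Lint (fun x => (\1_W x * ((u (x + t n *: unit_vec i) - u x) / t n - g i x)) ^+ 2).
    rewrite -LintZ; last exact: Lsq_summable.
    apply: Lint_ext => x; rewrite dirsum_unit -exprMn; congr (_ ^+ 2).
    by field; rewrite gt_eqF.
  rewrite ler_pM2l// => /le_lt_trans; apply.
  by rewrite ltr_pdivrMr// ltr_pMr// ltr1n.
apply: (int_diff_quotient_le ug oW (WS n)) => s /andP[s0 s1].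
have := dP (s *: (t n *: unit_vec i)).
have -> : Lint (fun x => (dirsum (t n *: unit_vec i) g (x + s *: (t n *: unit_vec i)) -
      dirsum (t n *: unit_vec i) g x) ^+ 2) =
   t n ^+ 2 * Lint (fun x => (g i (x + s *: (t n *: unit_vec i)) - g i x) ^+ 2).
  rewrite -LintZ; last exact: (Lsq_summable (LsqB (Lsq_shift (s *: (t n *: unit_vec i)) (sg i)) (sg i))).
  by apply: Lint_ext => x; rewrite !dirsum_unit -mulrBr exprMn.
rewrite ler_pM2l// => h; apply/ltW/h.
rewrite !normrZ ger0_norm// (ger0_norm (ltW (t0 n))).
apply: le_lt_trans tnd.
apply: (@le_trans _ _ (1 * (t n * 1))); last by rewrite mul1r mulr1.
apply: ler_pM => //; first by rewrite mulr_ge0// ltW.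
by apply: ler_wpM2l; [exact: ltW|exact: unit_vec_norm_le].
Qed.

End weak_gradients.

(** * Truncations *)

Section truncations.
Context {R : realType}.
Implicit Types (G : R -> R) (a b c s t C M : R).

(** [G] is differentiable with a Lipschitz derivative [G'], in the form in which
    it enters the chain rule for difference quotients. *)
Definition quad_approx G G' C :=
  forall a b, `|G b - G a - G' a * (b - a)| <= C * (b - a) ^+ 2.

Lemma quad_approx_derivative_lip G G' C a b : quad_approx G G' C ->
  `|G' b - G' a| <= 2 * C * `|b - a|.
Proof.
move=> qG; have [->|ab] := eqVneq a b; first by rewrite !subrr normr0 mulr0.
have ba0 : 0 < `|b - a| by rewrite normr_gt0 subr_eq0 eq_sym.
rewrite -(ler_pM2r ba0) -normrM.
have -> : 2 * C * `|b - a| * `|b - a| = 2 * C * (b - a) ^+ 2.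
  by rewrite -[(b - a) ^+ 2]real_normK ?num_real//; ring.
have -> : (G' b - G' a) * (b - a) =
  (G b - G a - G' a * (b - a)) + (G a - G b - G' b * (a - b)) by ring.
have := qG a b; have := qG b a; rewrite -sqrrN opprB => h1 h2.
by rewrite (le_trans (ler_normD _ _))//; lra.
Qed.

Lemma lipschitz_fun_continuous G C : (forall a b, `|G b - G a| <= C * `|b - a|) ->
  continuous G.
Proof.
move=> lG a; apply/cvgrPdist_lt => e e0.
have C1 : 0 < `|C| + 1 by rewrite ltr_wpDl.
near=> b; rewrite distrC (le_lt_trans (lG _ _))//.
apply: (@le_lt_trans _ _ ((`|C| + 1) * `|b - a|)).
  by rewrite ler_wpM2r// (le_trans (ler_norm _))// lerDl.
rewrite mulrC -ltr_pdivlMr// distrC; near: b.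
by exists (e / (`|C| + 1)) => //=; rewrite divr_gt0.
Unshelve. all: by end_near. Qed.

Lemma quad_approx_derivative_continuous G G' C : quad_approx G G' C -> continuous G'.
Proof.
by move=> qG; apply: (@lipschitz_fun_continuous _ (2 * C)) => a b; exact: quad_approx_derivative_lip.
Qed.

(** Composed with a capacitary function, it vanishes where that function is at least
    [1], and it is close to [1] where the function is small. *)
Definition plateau s := if `|s| <= 1 then (1 - s ^+ 2) ^+ 2 else 0.
Definition plateau' s := if `|s| <= 1 then - 4 * s * (1 - s ^+ 2) else 0.

Lemma sqr_le1_norm s : `|s| <= 1 -> 0 <= 1 - s ^+ 2 <= 2 * (1 - `|s|).
Proof.
move=> s1; rewrite -[s ^+ 2]real_normK ?num_real//; have := normr_ge0 s.
by move: (`|s|) s1 => x *; apply/andP; split; nra.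
Qed.

Lemma plateau01 s : 0 <= plateau s <= 1.
Proof.
rewrite /plateau; case: ifP => [/sqr_le1_norm/andP[h1 _]|_]; last by rewrite lexx ler01.
have := sqr_ge0 s => h2; apply/andP; split; nra.
Qed.

Lemma plateau_deriv_le s : `|plateau' s| <= 4.
Proof.
rewrite /plateau'; case: ifP => [s1|_]; last by rewrite normr0.
have /andP[h1 _] := sqr_le1_norm s1; have h2 := sqr_ge0 s.
rewrite !normrM normrN (ger0_norm h1) (@ger0_norm _ 4)//.
by have := normr_ge0 s; move: (`|s|) s1 => x *; nra.
Qed.

Lemma plateau_ge1 s : 1 <= s -> plateau s = 0 /\ plateau' s = 0.
Proof.
rewrite /plateau /plateau'; case: ifP => // s1 s2.
have -> : s = 1 by apply/eqP; rewrite eq_le s2 (le_trans (ler_norm s)).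
by rewrite expr1n subrr mulr0 expr0n.
Qed.

Lemma plateau_near1 s : `|plateau s - 1| <= 2 * `|s|.
Proof.
have /andP[p0 p1] := plateau01 s; rewrite distrC ger0_norm ?subr_ge0//.
move: p0 p1; rewrite /plateau; case: ifPn => [s1 _ _|].
  rewrite -[s ^+ 2]real_normK ?num_real//; have := normr_ge0 s.
  by move: (`|s|) s1 => x *; nra.
by rewrite -ltNge => *; lra.
Qed.

Lemma plateau_quad : quad_approx plateau plateau' 12.
Proof.
move=> a b; rewrite /plateau /plateau'.
have d0 := sqr_ge0 (b - a).
case: ifPn => b1; case: ifPn => a1.
- have -> : (1 - b ^+ 2) ^+ 2 - (1 - a ^+ 2) ^+ 2 - - 4 * a * (1 - a ^+ 2) * (b - a) =
    (b ^+ 2 + 2 * (a * b) + 3 * a ^+ 2 - 2) * (b - a) ^+ 2 by ring.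
  rewrite normrM (ger0_norm d0) ler_wpM2r//.
  move: a1 b1; rewrite !ler_norml => /andP[? ?] /andP[? ?].
  by apply/andP; split; nra.
- rewrite mul0r !subr0 normrX; have /andP[h0 h1] := sqr_le1_norm b1.
  rewrite (ger0_norm h0); rewrite -ltNge in a1.
  have h2 : 1 - `|b| <= `|b - a| by have := ler_normB b (b - a); rewrite opprB addrCA subrr addr0; lra.
  rewrite -[(b - a) ^+ 2]real_normK ?num_real//.
  by have := normr_ge0 b; move: (`|b - a|) h2 => y *; nra.
- have /andP[h0 h1] := sqr_le1_norm a1; rewrite -ltNge in b1.
  have h2 : 1 - `|a| <= `|b - a|.
    by have := ler_normD (b - a) a; rewrite subrK; lra.
  rewrite sub0r (le_trans (ler_normB _ _))// normrN normrX !normrM (ger0_norm h0).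
  rewrite normrN (@ger0_norm _ 4)// -[(b - a) ^+ 2]real_normK ?num_real//.
  have := normr_ge0 a; have := normr_ge0 (b - a); move: (`|b - a|) h2 => y h2 y0 a0.
  have h3 : 1 - a ^+ 2 <= 2 * y by lra.
  have h4 : (1 - a ^+ 2) ^+ 2 <= 4 * y ^+ 2 by nra.
  have h5 : 4 * `|a| * (1 - a ^+ 2) * y <= 8 * y ^+ 2.
    have h6 : `|a| * (1 - a ^+ 2) <= 2 * y by nra.
    by nra.
  by lra.
by rewrite mul0r !subr0 normr0 mulr_ge0.
Qed.

Section pos_part.
Variable d : R.
Hypothesis d0 : 0 < d.

(** A substitute for the positive part of [s - d], with a Lipschitz derivative. *)
Definition excess s := if s <= d then 0 else (s - d) ^+ 2 / s.
Definition excess' s := if s <= d then 0 else 1 - d ^+ 2 / s ^+ 2.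

Lemma excess_ge0 s : 0 <= excess s.
Proof.
rewrite /excess; case: ifPn => //; rewrite -ltNge => ds.
by rewrite divr_ge0 ?sqr_ge0// ltW// (lt_trans d0).
Qed.

Lemma excess_lip_le a b : a <= b -> 0 <= excess b - excess a <= b - a.
Proof.
move=> ab; rewrite /excess; case: ifPn => bd.
  by rewrite (le_trans ab bd) subrr lexx/= subr_ge0.
rewrite -ltNge in bd; have b0 : 0 < b by exact: lt_trans bd.
case: ifPn => ad.
  rewrite subr0 divr_ge0 ?sqr_ge0 ?(ltW b0)//= ler_pdivrMr//.
  have bd0 : 0 <= b - d by lra.
  apply: (@le_trans _ _ ((b - d) * b)); last by apply: ler_wpM2r; [exact: ltW|lra].
  by rewrite expr2; apply: ler_wpM2l => //; rewrite gerBl ltW.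
rewrite -ltNge in ad; have a0 : 0 < a by exact: lt_trans ad.
have -> : (b - d) ^+ 2 / b - (a - d) ^+ 2 / a = (b - a) * (1 - d ^+ 2 / (a * b)).
  by field; rewrite !gt_eqF.
have h1 : 0 <= d ^+ 2 / (a * b) <= 1.
  have ab0 : 0 < a * b by rewrite mulr_gt0.
  rewrite divr_ge0 ?sqr_ge0 ?(ltW ab0)//= ler_pdivrMr// mul1r.
  by rewrite expr2 ler_pM// ltW.
by move: h1; move: (d ^+ 2 / _) => x /andP[? ?]; apply/andP; split; nra.
Qed.

Lemma excess_lip a b : `|excess b - excess a| <= `|b - a|.
Proof.
have [ab|ba] := leP a b.
  have /andP[h1 h2] := excess_lip_le ab.
  by rewrite ger0_norm// (ger0_norm (le_trans h1 h2)).
have /andP[h1 h2] := excess_lip_le (ltW ba).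
by rewrite distrC [leRHS]distrC ger0_norm// (ger0_norm (le_trans h1 h2)).
Qed.

Lemma excess_deriv01 s : 0 <= excess' s <= 1.
Proof.
rewrite /excess'; case: ifPn => [|]; first by rewrite lexx ler01.
rewrite -ltNge => ds; have s0 : 0 < s by exact: lt_trans ds.
have : 0 <= d ^+ 2 / s ^+ 2 <= 1.
  rewrite divr_ge0 ?sqr_ge0//= ler_pdivrMr ?exprn_gt0// mul1r.
  by rewrite lerXn2r ?nnegrE ?ltW.
by move=> /andP[? ?]; apply/andP; split; lra.
Qed.

Lemma sqr_div_le p q x : 0 <= p <= q -> d <= x -> 0 <= p ^+ 2 / x <= q ^+ 2 / d.
Proof.
move=> /andP[p0 pq] dx; have x0 : 0 < x by exact: lt_le_trans dx.
rewrite divr_ge0 ?sqr_ge0 ?(ltW x0)//= ler_pM ?sqr_ge0 ?invr_ge0 ?(ltW x0)//.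
  by rewrite lerXn2r ?nnegrE// (le_trans p0).
by rewrite lef_pV2 ?posrE.
Qed.

Lemma excess_quad : quad_approx excess excess' (3 / d).
Proof.
move=> a b; have D0 := sqr_ge0 (b - a).
have r0 : 0 <= 3 / d by rewrite divr_ge0 ?ltW.
rewrite /excess /excess'; case: ifPn => [bd|]; last rewrite -ltNge => bd.
  case: ifPn => [ad|]; last rewrite -ltNge => ad.
    by rewrite mul0r !subr0 normr0 mulr_ge0.
  have a0 : 0 < a by exact: lt_trans ad.
  have -> : 0 - (a - d) ^+ 2 / a - (1 - d ^+ 2 / a ^+ 2) * (b - a) =
      (a - d) * (a + d) / a ^+ 2 * (a - b) - (a - d) ^+ 2 / a.
    by field; rewrite gt_eqF.
  have h1 : 0 <= (a - d) ^+ 2 / a <= (b - a) ^+ 2 / d.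
    have -> : (b - a) ^+ 2 = (a - b) ^+ 2 by ring.
    by apply: sqr_div_le; [apply/andP; split; lra|exact: ltW].
  have h2 : 0 <= (a - d) * (a + d) / a ^+ 2 * (a - b) <= 2 * ((b - a) ^+ 2 / d).
    have h3 : 0 <= (a - d) * (a + d) / a ^+ 2 <= 2 * (a - b) / d.
      have h5 : 0 <= (a - d) * (a + d) by apply: mulr_ge0; [rewrite subr_ge0 ltW|rewrite addr_ge0 ?ltW].
      apply/andP; split; first by rewrite divr_ge0 ?sqr_ge0.
      rewrite ler_pdivrMr ?exprn_gt0// mulrAC ler_pdivlMr//.
      have e1 : (a - d) * (a + d) * d <= (a - b) * (2 * a) * d.
        apply: ler_wpM2r; first exact: ltW.
        apply: ler_pM; rewrite ?subr_ge0 ?(ltW ad) ?lerD2l ?lerN2//.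
          by rewrite addr_ge0 ?ltW.
        by rewrite mulr_natl mulr2n lerD2l ltW.
      have e2 : (a - b) * (2 * a) * d <= (a - b) * (2 * a) * a.
        by rewrite ler_wpM2l ?ltW// mulr_gt0; lra.
      by rewrite expr2; lra.
    have ab : 0 <= a - b by lra.
    move: h3 => /andP[h3 h4]; rewrite mulr_ge0//=.
    apply: (le_trans (ler_wpM2r ab h4)).
    rewrite le_eqVlt; apply/orP; left; apply/eqP; field.
    by rewrite gt_eqF.
  have -> : 3 / d * (b - a) ^+ 2 = 3 * ((b - a) ^+ 2 / d) by ring.
  move: h1 h2 => /andP[? ?] /andP[? ?].
  by rewrite ler_norml; apply/andP; split; lra.
have b0 : 0 < b by exact: lt_trans bd.
case: ifPn => [ad|]; last rewrite -ltNge => ad.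
  have /andP[h1 h2] : 0 <= (b - d) ^+ 2 / b <= (b - a) ^+ 2 / d.
    by apply: sqr_div_le; [apply/andP; split; lra|exact: ltW].
  rewrite mul0r !subr0 ger0_norm// (le_trans h2)//.
  have -> : 3 / d * (b - a) ^+ 2 = 3 * ((b - a) ^+ 2 / d) by ring.
  by lra.
have a0 : 0 < a by exact: lt_trans ad.
have -> : (b - d) ^+ 2 / b - (a - d) ^+ 2 / a - (1 - d ^+ 2 / a ^+ 2) * (b - a) =
    d ^+ 2 / (b * a ^+ 2) * (b - a) ^+ 2.
  by field; rewrite !gt_eqF.
rewrite normrM (ger0_norm D0) ler_wpM2r// ger0_norm; last first.
  by rewrite divr_ge0 ?sqr_ge0// mulr_ge0 ?sqr_ge0 ?ltW.
rewrite ler_pdivrMr ?mulr_gt0 ?exprn_gt0// mulrAC ler_pdivlMr//.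
have e1 : d ^+ 2 <= a ^+ 2 by rewrite lerXn2r ?nnegrE ?ltW.
have e2 : d ^+ 2 * d <= b * a ^+ 2.
  by rewrite mulrC; apply: ler_pM; [exact: ltW|exact: sqr_ge0|exact: ltW|].
have : 0 <= b * a ^+ 2 by rewrite mulr_ge0 ?sqr_ge0 ?ltW.
by move=> *; lra.
Qed.

(** The substitute is made bounded; as [d] tends to [0] it tends to the positive
    part. *)
Definition ptrunc s := excess s / (1 + d * excess s).
Definition ptrunc' s := excess' s / (1 + d * excess s) ^+ 2.

Let den s : 1 <= 1 + d * excess s.
Proof. by rewrite lerDl mulr_ge0 ?excess_ge0 ?ltW. Qed.

Let den0 s : 0 < 1 + d * excess s. Proof. exact: lt_le_trans (den s). Qed.

Lemma ptrunc_ge0 s : 0 <= ptrunc s.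
Proof. by rewrite divr_ge0 ?excess_ge0 ?ltW. Qed.

Lemma ptrunc_lip a b : `|ptrunc b - ptrunc a| <= `|b - a|.
Proof.
have -> : ptrunc b - ptrunc a =
    (excess b - excess a) / ((1 + d * excess b) * (1 + d * excess a)).
  by rewrite /ptrunc; field; rewrite !gt_eqF.
rewrite normrM (le_trans _ (excess_lip a b))// ler_piMr// normfV.
rewrite invf_le1 ?normr_gt0 ?gt_eqF ?mulr_gt0//.
rewrite ger0_norm; first by rewrite mulr_ege1.
by rewrite mulr_ge0// ltW.
Qed.

Lemma ptrunc0 s : s <= d -> ptrunc s = 0 /\ ptrunc' s = 0.
Proof. by move=> sd; rewrite /ptrunc /ptrunc' /excess /excess' sd !mul0r. Qed.

Lemma ptrunc_le s : ptrunc s <= `|s|.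
Proof.
have := ptrunc_lip 0 s; have [-> _] := ptrunc0 (ltW d0).
by rewrite !subr0; exact: le_trans (ler_norm _).
Qed.

Lemma ptrunc_bounded s : ptrunc s <= d^-1.
Proof.
by rewrite ler_pdivrMr// -ler_pdivrMl ?invr_gt0// invrK lerDr.
Qed.

Lemma ptrunc_deriv01 s : 0 <= ptrunc' s <= 1.
Proof.
have /andP[e0 e1] := excess_deriv01 s.
rewrite divr_ge0 ?sqr_ge0//= ler_pdivrMr ?exprn_gt0// mul1r (le_trans e1)//.
by rewrite expr_ge1// ltW.
Qed.

Lemma ptrunc_quad : quad_approx ptrunc ptrunc' (d + 3 / d).
Proof.
move=> a b; set x := excess a; set y := excess b.
have -> : ptrunc b - ptrunc a - ptrunc' a * (b - a) =
   - (d * (y - x) ^+ 2 / ((1 + d * y) * (1 + d * x) ^+ 2)) +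
   (y - x - excess' a * (b - a)) / (1 + d * x) ^+ 2.
  have dx : 1 + d * x != 0 by rewrite gt_eqF// den0.
  have dy : 1 + d * y != 0 by rewrite gt_eqF// den0.
  by rewrite /ptrunc /ptrunc' -/x -/y; field; rewrite dx dy.
rewrite [leRHS]mulrDl (le_trans (ler_normD _ _))// lerD//.
  have D1 : 1 <= (1 + d * y) * (1 + d * x) ^+ 2 by rewrite mulr_ege1 ?expr_ge1 ?den ?ltW ?den0.
  have D0 : 0 < (1 + d * y) * (1 + d * x) ^+ 2 by rewrite (lt_le_trans _ D1).
  rewrite normrN ger0_norm; last first.
    by apply: divr_ge0; [apply: mulr_ge0; [exact: ltW|exact: sqr_ge0]|exact: ltW].
  rewrite ler_pdivrMr//; apply: (@le_trans _ _ (d * (b - a) ^+ 2)).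
    apply: ler_wpM2l; first exact: ltW.
    rewrite -[(y - x) ^+ 2]real_normK ?num_real//.
    rewrite -[(b - a) ^+ 2]real_normK ?num_real//.
    by rewrite lerXn2r ?nnegrE//; exact: excess_lip.
  by rewrite ler_peMr// mulr_ge0 ?sqr_ge0 ?ltW.
rewrite normrM (le_trans _ (excess_quad a b))// ler_piMr// normfV.
rewrite invf_le1 ?normr_gt0 ?gt_eqF ?exprn_gt0//; last exact: den0.
by rewrite (ger0_norm (sqr_ge0 _)) expr2 mulr_ege1 ?den.
Qed.

Definition trunc s := ptrunc s - ptrunc (- s).
Definition trunc' s := ptrunc' s + ptrunc' (- s).

Lemma trunc_lip a b : `|trunc b - trunc a| <= 2 * `|b - a|.
Proof.
have -> : trunc b - trunc a = (ptrunc b - ptrunc a) - (ptrunc (- b) - ptrunc (- a)).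
  by rewrite /trunc; ring.
rewrite (le_trans (ler_normB _ _))//.
have := ptrunc_lip a b; have := ptrunc_lip (- a) (- b).
by rewrite -opprD normrN => *; lra.
Qed.

Lemma trunc_small s : `|s| <= d -> trunc s = 0 /\ trunc' s = 0.
Proof.
rewrite ler_norml => /andP[h1 h2]; rewrite /trunc /trunc'.
have [-> ->] := ptrunc0 h2; have [|-> ->] := @ptrunc0 (- s); first lra.
by rewrite subrr addr0.
Qed.

Lemma trunc_bounded s : `|trunc s| <= d^-1.
Proof.
have := ptrunc_ge0 s; have := ptrunc_ge0 (- s).
have := ptrunc_bounded s; have := ptrunc_bounded (- s); rewrite /trunc => *.
by rewrite ler_norml; apply/andP; split; lra.
Qed.

Lemma trunc_le s : `|trunc s| <= `|s|.
Proof.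
have := ptrunc_ge0 s; have := ptrunc_ge0 (- s).
have := ptrunc_le s; have := ptrunc_le (- s); rewrite /trunc normrN => *.
by rewrite ler_norml; apply/andP; split; lra.
Qed.

Lemma trunc_deriv_le s : `|trunc' s| <= 2.
Proof.
have /andP[? ?] := ptrunc_deriv01 s; have /andP[? ?] := ptrunc_deriv01 (- s).
by rewrite /trunc' ler_norml; apply/andP; split; lra.
Qed.

Lemma trunc_quad : quad_approx trunc trunc' (2 * (d + 3 / d)).
Proof.
move=> a b; have := ptrunc_quad a b; have := ptrunc_quad (- a) (- b).
have -> : (- b - - a) ^+ 2 = (b - a) ^+ 2 by ring.
have -> : trunc b - trunc a - trunc' a * (b - a) =
   (ptrunc b - ptrunc a - ptrunc' a * (b - a)) -
   (ptrunc (- b) - ptrunc (- a) - ptrunc' (- a) * (- b - - a)).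
  by rewrite /trunc /trunc'; ring.
move=> h1 h2; rewrite (le_trans (ler_normB _ _))//.
by move: h1 h2; set X := (b - a) ^+ 2; set Y := d + 3 / d; lra.
Qed.

End pos_part.

Let dn (n : nat) : R := n.+1%:R^-1.

Let dn_cvg : dn @ \oo --> (0 : R).
Proof. exact: cvg_harmonic. Qed.

Lemma ptrunc_limit_pos s : 0 < s ->
  (fun n => ptrunc (dn n) s) @ \oo --> s /\ (fun n => ptrunc' (dn n) s) @ \oo --> (1 : R).
Proof.
move=> s0; have sn0 : s != 0 by rewrite gt_eqF.
pose e (x : R) := (s - x) ^+ 2 / s.
have ce : (fun n => e (dn n)) @ \oo --> s.
  have h : (fun n => s - dn n) @ \oo --> s.
    by rewrite -[X in _ --> X]subr0; apply: cvgB => //; exact: cvg_cst.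
  have hh : (fun n => (s - dn n) * (s - dn n) * s^-1) @ \oo --> s * s * s^-1.
    by apply: cvgM; [exact: cvgM|exact: cvg_cst].
  by rewrite mulfK// in hh; exact: hh.
have cden : (fun n => 1 + dn n * e (dn n)) @ \oo --> (1 : R).
  rewrite -[X in _ --> X]addr0 -[X in _ --> _ + X](mul0r s).
  by apply: cvgD; [exact: cvg_cst|exact: cvgM].
have nears : \forall n \near \oo, (s <= dn n) = false.
  move/cvgrPdist_lt : dn_cvg => /(_ _ s0); apply: filterS => n.
  rewrite sub0r normrN ger0_norm; last by rewrite invr_ge0.
  by move=> h; apply/negbTE; rewrite -ltNge.
have one0 : (1 : R) != 0 by rewrite oner_eq0.
split.
  have : (fun n => e (dn n) / (1 + dn n * e (dn n))) @ \oo --> s.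
    by have := cvgM ce (cvgV one0 cden); rewrite invr1 mulr1; exact.
  apply: cvg_trans; apply: near_eq_cvg; apply: filterS nears => n sn.
  by rewrite /ptrunc /excess sn.
have ce' : (fun n => 1 - dn n ^+ 2 / s ^+ 2) @ \oo --> (1 : R).
  have h : (fun n => dn n * dn n * (s ^+ 2)^-1) @ \oo --> 0 * 0 * (s ^+ 2)^-1.
    by apply: cvgM; [exact: cvgM|exact: cvg_cst].
  rewrite !mul0r in h; rewrite -[X in _ --> X]subr0.
  by apply: cvgB; [exact: cvg_cst|exact: h].
have : (fun n => (1 - dn n ^+ 2 / s ^+ 2) / (1 + dn n * e (dn n)) ^+ 2) @ \oo --> (1 : R).
  have one20 : (1 * 1 : R) != 0 by rewrite mulr1 oner_eq0.
  by have := cvgM ce' (cvgV one20 (cvgM cden cden)); rewrite mulr1 invr1 mulr1; exact.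
apply: cvg_trans; apply: near_eq_cvg; apply: filterS nears => n sn.
by rewrite /ptrunc' /excess /excess' sn.
Qed.

Lemma ptrunc_limit_neg s : s <= 0 ->
  forall n, ptrunc (dn n) s = 0 /\ ptrunc' (dn n) s = 0.
Proof. by move=> s0 n; apply: ptrunc0; rewrite (le_trans s0)// invr_ge0. Qed.

(** At [0] the derivatives vanish for every level, and elsewhere they tend to [1]:
    in the limit the gradient of [u] only survives where [u] is nonzero. *)
Lemma trunc_limit s : (fun n => trunc (dn n) s) @ \oo --> s /\
  (fun n => trunc' (dn n) s) @ \oo --> ((s != 0)%:R : R).
Proof.
rewrite /trunc /trunc'; have [s0|s0|s0] := ltgtP s 0.
- have h1 := ptrunc_limit_neg (ltW s0).
  have ns : 0 < - s by rewrite oppr_gt0.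
  have [h3 h4] := ptrunc_limit_pos ns; split.
    under eq_fun do rewrite (h1 _).1 sub0r.
    by have := cvgN h3; rewrite opprK; exact.
  by under eq_fun do rewrite (h1 _).2 add0r.
- have ns : - s <= 0 by rewrite oppr_le0 ltW.
  have h1 := ptrunc_limit_neg ns; have [h3 h4] := ptrunc_limit_pos s0; split.
    by under eq_fun do rewrite (h1 _).1 subr0.
  by under eq_fun do rewrite (h1 _).2 addr0.
rewrite s0 oppr0 /=; have h1 := ptrunc_limit_neg (lexx 0).
split; first by under eq_fun do rewrite subrr; exact: cvg_cst.
by under eq_fun do rewrite (h1 _).2 addr0; exact: cvg_cst.
Qed.

(** The product rule with explicit errors. Every term on the right tends to [0] in
    the mean, since difference quotients converge in the square mean and the other
    terms carry the factor [t]. *)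
Lemma quotient_product_bound (G G' H H' : R -> R) C CH M a b c d g gam t :
  quad_approx G G' C -> quad_approx H H' CH ->
  (forall s, `|G' s| <= 2) -> (forall s, `|G s| <= M) ->
  (forall a b, `|G b - G a| <= 2 * `|b - a|) ->
  (forall s, 0 <= H s <= 1) -> (forall s, `|H' s| <= 4) ->
  0 <= C -> 0 <= CH -> 0 <= M -> 0 < t <= 1 ->
  `|(G b * H d - G a * H c) / t - (G' a * g * H c + G a * H' c * gam)| <=
  (2 * C + 2 * (M * CH) + 4 * M + 14) *
  (((b - a) / t - g) ^+ 2 + ((d - c) / t - gam) ^+ 2 +
   t * g ^+ 2 + t * gam ^+ 2 + `|(b - a) / t - g| + `|(d - c) / t - gam|).
Proof.
move=> qG qH G'2 GM Gl H01 H'4 C0 CH0 M0 /andP[t0 t1].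
set al := (b - a) / t; set be := (d - c) / t.
have ba : b - a = t * al by rewrite /al mulrC divfK// gt_eqF.
have dc : d - c = t * be by rewrite /be mulrC divfK// gt_eqF.
have tn : t != 0 by rewrite gt_eqF.
have -> : (G b * H d - G a * H c) / t - (G' a * g * H c + G a * H' c * gam) =
   H c * ((G b - G a - G' a * (b - a)) / t) + H c * G' a * (al - g) +
   G b * ((H d - H c - H' c * (d - c)) / t) + G b * H' c * (be - gam) +
   (G b - G a) * H' c * gam.
  by rewrite /al /be; field.
clearbody al be.
have Hc : `|H c| <= 1 by have /andP[? ?] := H01 c; rewrite ger0_norm.
have e1 : `|H c * ((G b - G a - G' a * (b - a)) / t)| <= C * (t * al ^+ 2).
  rewrite normrM -[leRHS]mul1r ler_pM// normrM normfV (gtr0_norm t0) ler_pdivrMr//.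
  rewrite (le_trans (qG a b))// ba le_eqVlt; apply/orP; left; apply/eqP; ring.
have e2 : `|H c * G' a * (al - g)| <= 2 * `|al - g|.
  rewrite !normrM ler_wpM2r// -[leRHS]mul1r ler_pM//.
have e3 : `|G b * ((H d - H c - H' c * (d - c)) / t)| <= M * CH * (t * be ^+ 2).
  rewrite normrM -mulrA ler_pM// normrM normfV (gtr0_norm t0) ler_pdivrMr//.
  rewrite (le_trans (qH c d))// dc le_eqVlt; apply/orP; left; apply/eqP; ring.
have e4 : `|G b * H' c * (be - gam)| <= 4 * M * `|be - gam|.
  by rewrite !normrM ler_wpM2r// mulrC ler_pM.
have e5 : `|(G b - G a) * H' c * gam| <= 8 * (t * (`|al| * `|gam|)).
  rewrite !normrM; apply: (@le_trans _ _ (2 * `|b - a| * 4 * `|gam|)).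
    by rewrite ler_wpM2r// ler_pM.
  have -> : `|b - a| = t * `|al| by rewrite ba normrM (gtr0_norm t0).
  by rewrite le_eqVlt; apply/orP; left; apply/eqP; ring.
have al2 : t * al ^+ 2 <= 2 * ((al - g) ^+ 2 + t * g ^+ 2).
  have h1 : al ^+ 2 <= 2 * ((al - g) ^+ 2 + g ^+ 2) by have := sqr_ge0 (al - 2 * g); nra.
  have h2 : t * (al - g) ^+ 2 <= (al - g) ^+ 2 by rewrite ler_piMl ?sqr_ge0.
  have := ler_wpM2l (ltW t0) h1; lra.
have be2 : t * be ^+ 2 <= 2 * ((be - gam) ^+ 2 + t * gam ^+ 2).
  have h1 : be ^+ 2 <= 2 * ((be - gam) ^+ 2 + gam ^+ 2) by have := sqr_ge0 (be - 2 * gam); nra.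
  have h2 : t * (be - gam) ^+ 2 <= (be - gam) ^+ 2 by rewrite ler_piMl ?sqr_ge0.
  have := ler_wpM2l (ltW t0) h1; lra.
have ag : 2 * (t * (`|al| * `|gam|)) <= t * al ^+ 2 + t * gam ^+ 2.
  rewrite -[al ^+ 2]real_normK ?num_real// -[gam ^+ 2]real_normK ?num_real//.
  have : 0 <= t * (`|al| - `|gam|) ^+ 2 by rewrite mulr_ge0 ?sqr_ge0 ?ltW.
  lra.
have C1 := ler_wpM2l C0 al2; have C2 := ler_wpM2l (mulr_ge0 M0 CH0) be2.
have p1 := sqr_ge0 (al - g); have p2 := sqr_ge0 (be - gam).
have p3 : 0 <= t * g ^+ 2 by rewrite mulr_ge0 ?sqr_ge0 ?ltW.
have p4 : 0 <= t * gam ^+ 2 by rewrite mulr_ge0 ?sqr_ge0 ?ltW.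
have p5 := normr_ge0 (al - g); have p6 := normr_ge0 (be - gam).
have norm5 (x1 x2 x3 x4 x5 : R) :
    `|x1 + x2 + x3 + x4 + x5| <= `|x1| + `|x2| + `|x3| + `|x4| + `|x5|.
  by do 4 (rewrite (le_trans (ler_normD _ _))// lerD2r).
apply: (le_trans (norm5 _ _ _ _ _)).
move: e1 e2 e3 e4 e5 C1 C2 ag al2 p1 p2 p3 p4 p5 p6.
move: (`|H c * ((G b - G a - G' a * (b - a)) / t)|) (`|H c * G' a * (al - g)|).
move: (`|G b * ((H d - H c - H' c * (d - c)) / t)|) (`|G b * H' c * (be - gam)|).
move: (`|(G b - G a) * H' c * gam|) (t * (`|al| * `|gam|)).
move: ((al - g) ^+ 2) ((be - gam) ^+ 2) (t * g ^+ 2) (t * gam ^+ 2) (`|al - g|) (`|be - gam|).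
move: (t * al ^+ 2) (t * be ^+ 2) (mulr_ge0 M0 CH0); move: (M * CH) => MC.
move=> X Y MC0 P1 P2 P3 P4 P5 P6 Z5 Q Z3 Z4 Z1 Z2 e1 e2 e3 e4 e5 C1 C2 ag al2 p1 p2 p3 p4 p5 p6.
clear -C0 MC0 M0 e1 e2 e3 e4 e5 C1 C2 ag al2 p1 p2 p3 p4 p5 p6.
have q1 : 0 <= C * (P2 + P4 + P5 + P6) by rewrite mulr_ge0 ?addr_ge0.
have q2 : 0 <= MC * (P1 + P3 + P5 + P6) by rewrite mulr_ge0 ?addr_ge0.
have q3 : 0 <= M * (P1 + P2 + P3 + P4 + P5) by rewrite mulr_ge0 ?addr_ge0.
by lra.
Qed.

End truncations.

(** * Splitting a Sobolev function along disjoint open sets *)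

Section splitting.
Context {R : realType} {N : nat}.
Notation V := 'rV[R]_N.
Notation mu := (@leb R N).
Implicit Types (u v w z : V -> R) (g : 'I_N -> V -> R) (A B K S U W : set V) (h x y : V).

Lemma compact_room K U : compact K -> open U -> K `<=` U ->
  exists2 r : R, 0 < r & forall x y, K x -> `|y - x| < r -> U y.
Proof.
move=> /compact_near_coveringP cK oU KU.
have : \forall r \near (0 : R)^'+, K `<=` [set x | forall y, `|y - x| < r -> U y].
  apply: (cK R ((0 : R)^'+) (fun r x => forall y, `|y - x| < r -> U y)) => x Kx.
  have /nbhs_ballP[e /= e0 eU] : nbhs x U by apply: open_nbhs_nbhs; split=> //; exact: KU.
  have e2 : 0 < e / 2 by rewrite divr_gt0.
  exists (ball x (e / 2), [set r | r < e / 2]).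
    split; first exact: nbhsx_ballx.
    by exact: nbhs_right_lt.
  move=> [x' r] /= [xx' re] y yx'; apply: eU; rewrite [e]splitr.
  apply: (ball_triangle xx'); rewrite -ball_normE /= distrC.
  exact: lt_trans re.
move=> hr; have [r [r0 rP]] : exists r : R, 0 < r /\ K `<=` [set x | forall y, `|y - x| < r -> U y].
  near (0 : R)^'+ => r; exists r; split; first by [].
  by near: r.
by exists r => // x y Kx; exact: rP.
Unshelve. all: by end_near. Qed.

Definition enlarge K (r : R) := [set y | exists2 x, K x & `|y - x| < r].

Lemma open_enlarge K (r : R) : open (enlarge K r).
Proof.
have -> : enlarge K r = \bigcup_(x in K) ball x r.
  by apply/seteqP; split=> y [x Kx xy]; exists x => //; move: xy; rewrite -ball_normE /= distrC.
by apply: bigcup_open => x _; exact: ball_open.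
Qed.

Lemma closure_enlarge K (r : R) : closure (enlarge K r) `<=` enlarge K (2 * r).
Proof.
move=> y cy; have [r0|r0] := ltP 0 r; last first.
  have [x [[x' _ xx'] _]] := cy setT filterT.
  by have := le_lt_trans (normr_ge0 _) (lt_le_trans xx' r0); rewrite ltxx.
have [x [[x' Kx' xx'] xy]] := cy (ball y r) (nbhsx_ballx y r r0).
exists x' => //; rewrite -(subrKA x) mulr_natl mulr2n (le_lt_trans (ler_normD _ _))// ltrD//.
by move: xy; rewrite -ball_normE.
Qed.

Lemma compact_closure_enlarge K (r : R) : compact K -> compact (closure (enlarge K r)).
Proof.
move=> cK; have [M M0 KM] := compact_in_ball cK.
apply: (@subclosed_compact _ _ [set y : V | `|y - 0| <= M + 2 * r]).
- exact: closed_closure.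
- exact: closed_ball_compact.
move=> y /closure_enlarge[x Kx xy] /=; rewrite -(subrKA x) addrC (le_trans (ler_normD _ _))//.
by rewrite lerD ?ltW//; exact: KM.
Qed.

(** A weak derivative can be computed by testing difference quotients, provided
    that these converge on the support of the test function. *)
Lemma weak_derivative_of_quotients K z dz (i : 'I_N) (t : nat -> R) phi :
  Lsq z -> class_C 1 phi -> compact K -> (forall x, ~ K x -> phi x = 0) ->
  (forall n, 0 < t n <= 1) -> t @ \oo --> (0 : R) ->
  Lsummable (fun x => dz x * phi x) ->
  Lmean_null (fun n x => ((z (x + t n *: unit_vec i) - z x) / t n - dz x) * phi x) ->
  Lint (fun x => z x * 'D_(unit_vec i) phi x) = - Lint (fun x => dz x * phi x).
Proof.
move=> sz [cphi C1phi] cK phi0 t01 tl sd qn; have [dphi cD] := C1phi i.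
have t0 n : 0 < t n by have /andP[] := t01 n.
have sphi : Lsq phi := Lsq_compact_support cphi cK phi0.
have D0 x : ~ K x -> 'D_(unit_vec i) phi x = 0 by exact: derive_off_support.
have [M M0 DM] := continuous_compact_support_bounded cD cK D0.
have [r r0 Kr] := compact_in_ball cK.
pose q n x := (phi (x - t n *: unit_vec i) - phi x) / t n.
have sq n : Lsq (q n).
  have := LsqZ (t n)^-1 (LsqB (Lsq_shift (- (t n *: unit_vec i)) sphi) sphi).
  by congr Lsq; apply/funext => x; rewrite /q mulrC.
have qM n x : `|q n x| <= M.
  have tn0 : - t n < 0 by rewrite oppr_lt0.
  pose f s := phi (x + s *: unit_vec i).
  have df s : is_derive (s : R) (1 : R) f ('D_(unit_vec i) phi (x + s *: unit_vec i)).
    by exact: is_derive_line.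
  have [|c _ E] := @MVT _ f (fun s => 'D_(unit_vec i) phi (x + s *: unit_vec i)) (- t n) 0 tn0.
    by apply: derivable_within_continuous => s _; have [] := df s.
  move: E; rewrite /f scale0r addr0 sub0r opprK => E.
  have -> : q n x = - 'D_(unit_vec i) phi (x + c *: unit_vec i).
    apply: (mulIf (lt0r_neq0 (t0 n))); rewrite /q divfK ?gt_eqF// mulNr -E opprB.
    by rewrite scaleNr.
  by rewrite normrN.
have ql x : (q ^~ x) @ \oo --> - 'D_(unit_vec i) phi x.
  have /cvgr_dnbhsP h := dphi x.
  have tn : forall n, - t n != 0 by move=> n; rewrite oppr_eq0 gt_eqF.
  have tnl : (fun n => - t n) @ \oo --> (0 : R).
    by rewrite -oppr0; exact: cvgN.
  have qE n : q n x = - ((- t n)^-1 *: ((phi \o shift x) (- t n *: unit_vec i) - phi x)).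
    by rewrite /q /= scaleNr [- _ + x]addrC invrN scaleNr opprK /GRing.scale /= mulrC.
  under eq_fun do rewrite qE.
  by apply: cvgN; exact: (h (fun n => - t n) (conj tn tnl)).
have e1 n : Lint (fun x => (z (x + t n *: unit_vec i) - z x) / t n * phi x) =
    Lint (fun x => z x * q n x).
  have i1 := LsqM sz (Lsq_shift (- (t n *: unit_vec i)) sphi).
  have i2 := LsqM sz sphi.
  have i3 := Lsummable_shift (t n *: unit_vec i) i1.
  have -> : Lint (fun x => z x * q n x) =
     (t n)^-1 * (Lint (fun x => z x * phi (x - t n *: unit_vec i)) - Lint (fun x => z x * phi x)).
    rewrite -LintB// -LintZ; last exact: LsummableB.
    by apply: Lint_ext => x; rewrite /q; ring.
  rewrite -(Lint_shift (t n *: unit_vec i) i1) -LintB// -LintZ; last exact: LsummableB.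
  by apply: Lint_ext => x; rewrite addrK; ring.
have l1 : (fun n => Lint (fun x => z x * q n x)) @ \oo --> Lint (fun x => dz x * phi x).
  under eq_fun do rewrite -e1; apply: Lmean_null_cvg => //.
  by move: qn; congr Lmean_null; apply/funext => n; apply/funext => x; rewrite mulrBl.
have sD : Lsq (fun x => 'D_(unit_vec i) phi x) := Lsq_compact_support cD cK D0.
have l2 : (fun n => Lint (fun x => z x * q n x)) @ \oo -->
    Lint (fun x => - (z x * 'D_(unit_vec i) phi x)).
  have i1 := LsqM sz sD.
  apply: Lmean_null_cvg; first exact: LsummableN.
  have mz := Lsq_mf sz; have mq n := Lsq_mf (sq n); have mD := Lsq_mf sD.
  pose h x := `|z x| * ((2 * M) * \1_[set y : V | `|y - 0| < r + 1] x).
  apply: (@Lmean_null_dct _ _ _ h) => [n||n|].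
  - exact: (LmeasB (LmeasM mz (mq n)) (LmeasN (LmeasM mz mD))).
  - exact: (LsqM (Lsq_norm sz) (Lsq_ball_indic _ _ _)).
  - apply: LaeW => x; rewrite opprK -mulrDr normrM /h ler_wpM2l//.
    rewrite indicE; case: (boolP (x \in _)) => [_|/negP xB] /=.
      rewrite mulr1 (le_trans (ler_normD _ _))//.
      by have := qM n x; have := DM x; move=> *; lra.
    have xr : r + 1 <= `|x|.
      by rewrite leNgt; apply/negP => h2; apply: xB; apply: mem_set; rewrite /= subr0.
    have nK y : r <= `|y| -> ~ K y.
      by move=> ry /Kr /=; rewrite subr0; apply/negP; rewrite -leNgt.
    rewrite D0 ?addr0; last by apply: nK; rewrite (le_trans _ xr)// lerDl.
    rewrite /q !phi0 ?subrr ?mul0r ?normr0 ?mulr0//.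
      by apply: nK; rewrite (le_trans _ xr)// lerDl.
    apply: nK; have := ler_normB (x - t n *: unit_vec i) (- (t n *: unit_vec i)).
    rewrite opprK subrK normrN normrZ (gtr0_norm (t0 n)) => h2.
    have : t n * `|unit_vec i : V| <= 1 * 1.
      have /andP[h3 h4] := t01 n.
      by apply: ler_pM => //; [exact: ltW|exact: unit_vec_norm_le].
    by move=> *; lra.
  apply: LaeW => x; rewrite -[X in _ --> X](subrr (- (z x * 'D_(unit_vec i) phi x))).
  apply: cvgB; last exact: cvg_cst.
  by rewrite -mulrN; apply: cvgM; [exact: cvg_cst|exact: ql].
have := cvg_unique _ l1 l2 => /(_ (@Rhausdorff R)) ->.
by rewrite LintN ?opprK//; exact: LsqM.
Qed.

Lemma Lmean_null_norm (f : nat -> V -> R) : Lmean_null f -> Lmean_null (fun n x => `|f n x|).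
Proof.
move=> /Lmean_nullE[fi fl]; apply/Lmean_nullE; split=> [n|]; first exact: Lsummable_norm.
by under eq_fun do under Lint_ext do rewrite normr_id.
Qed.

Lemma Lmean_null_scale (t : nat -> R) f : (forall n, 0 <= t n <= 1) -> t @ \oo --> (0 : R) ->
  Lsummable f -> Lmean_null (fun n x => t n * f x).
Proof.
move=> t01 tl sf; have mf := Lsummable_mf sf.
apply: (@Lmean_null_dct _ _ _ (fun x => `|f x|)) => [n||n|].
- exact: (LmeasM (Lmeas_cst _) mf).
- exact: Lsummable_norm.
- apply: LaeW => x; rewrite normrM; have /andP[h0 h1] := t01 n.
  by rewrite (ger0_norm h0) ler_piMl.
apply: LaeW => x; rewrite -[X in _ --> X](mul0r (f x)).
by apply: cvgM => //; exact: cvg_cst.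
Qed.

End splitting.

Section cut.
Context {R : realType} {N : nat}.
Notation V := 'rV[R]_N.
Variables (S A B E : set V) (u ut v : V -> R) (g gam : 'I_N -> V -> R) (d : R).
Hypotheses (oS : open S) (oA : open A) (oB : open B).
Hypothesis AB : forall x, A x -> B x -> False.
Hypothesis ug : H1ext S u g.
Hypothesis vgam : H1ext setT v gam.
Hypothesis oE : open E.
Hypothesis vE : Lae (fun x => E x -> 1 <= v x).
Hypothesis cut : {within S `\` E, continuous ut}.
Hypothesis utu : Lae (fun x => S x -> ut x = u x).
Hypothesis ut0 : forall x, S x -> ~ E x -> ~ A x -> ~ B x -> ut x = 0.
Hypothesis d0 : 0 < d.

Let live x := ~ E x /\ d <= `|ut x|.

(** Off [E] the function [ut] is continuous, so that a lower bound on its absolute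
    value is a closed condition. *)
Lemma closed_live (K : set V) : closed K -> K `<=` S -> closed [set x | K x /\ live x].
Proof.
move=> cK KS p cp.
have Kp : K p.
  by apply: cK => U /cp[x [[Kx _] Ux]]; exists x.
have Ep : ~ E p.
  move=> Ep; have /cp[x [[_ [nEx _]] Ex]] : nbhs p E by exact: open_nbhs_nbhs.
  exact: nEx.
split=> //; split=> //; rewrite leNgt; apply/negP => utd.
have SEp : (S `\` E) p by split => //; exact: KS.
have [h _] := subspace_continuousP (S `\` E) ut.
have /cvgrPdist_lt := h cut p SEp.
have e0 : 0 < d - `|ut p| by rewrite subr_gt0.
move=> /(_ _ e0) hn.
have [x [[Kx [nEx dx]] xn]] := cp _ hn.
have := xn (conj (KS _ Kx) nEx); have := ler_normB (ut p) (ut p - ut x).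
rewrite opprB addrCA subrr addr0 => h1 h2.
by have := lt_le_trans h2 (lerB dx (lexx `|ut p|)); lra.
Qed.

(** Where [ut] exceeds [d] off [E], a compact part of [S] decomposes into a compact
    part of [A] and a compact part of [B]; short translations do not mix them. *)
Lemma live_separation K : compact K -> K `<=` S -> exists tau : R, [/\ 0 < tau <= 1,
  forall x h, enlarge K tau x -> `|h| <= tau -> S (x + h) &
  forall x h, K x -> `|h| <= tau -> live x \/ live (x + h) -> A (x + h) <-> A x].
Proof.
move=> cK KS; have [r r0 rP] := compact_room cK oS KS.
pose K1 := closure (enlarge K (r / 3)).
have cK1 : compact K1 by exact: compact_closure_enlarge.
have K1S : K1 `<=` S.
  by move=> y /closure_enlarge[x Kx xy]; apply: (rP x y Kx); apply: lt_trans xy _; lra.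
pose F := [set x | K1 x /\ live x].
have clF : closed F by apply: closed_live => //; exact: closed_closure.
have FAB x : F x -> A x \/ B x.
  move=> [K1x [nEx dx]]; apply: contrapT => /not_orP[nA nB].
  by move: dx; rewrite ut0 ?normr0 ?leNgt ?d0//; exact: K1S.
have [rA rA0 rAP] : exists2 r : R, 0 < r & forall x y, (F `&` ~` B) x -> `|y - x| < r -> A y.
  apply: compact_room => //.
    apply: (subclosed_compact _ cK1) => [|x [[]]//].
    by apply: closedI => //; exact: open_closedC.
  by move=> x [/FAB[//|Bx] nB].
have [rB rB0 rBP] : exists2 r : R, 0 < r & forall x y, (F `&` ~` A) x -> `|y - x| < r -> B y.
  apply: compact_room => //.
    apply: (subclosed_compact _ cK1) => [|x [[]]//].
    by apply: closedI => //; exact: open_closedC.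
  by move=> x [/FAB[//|Bx] nB].
pose m := Num.min (Num.min 1 (r / 3)) (Num.min rA rB).
have m0 : 0 < m by rewrite !lt_min ltr01 rA0 rB0 divr_gt0.
have : m <= m by []; rewrite {2}/m !le_min => /andP[/andP[m1 mr] /andP[mA mB]].
have mm : m / 2 < m by rewrite ltr_pdivrMr// mulr_natr mulr2n ltrDl.
have near_pair x h : F x -> `|h| <= m / 2 -> A (x + h) <-> A x.
  move=> Fx hm; have hx : `|x + h - x| < m by rewrite addrC addKr (le_lt_trans hm).
  have [Ax|nAx] := pselect (A x).
    split=> // _; apply: (rAP x) => //; last exact: lt_le_trans mA.
    by split=> // Bx; exact: AB Ax Bx.
  split=> // Axh; have Bxh : B (x + h) by apply: (rBP x) => //; exact: lt_le_trans mB.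
  by have := AB Axh Bxh.
exists (m / 2); split.
- by rewrite divr_gt0//= (le_trans (ltW mm)).
- move=> x h [y Ky xy] hm; apply: (rP y) => //; rewrite addrAC (le_lt_trans (ler_normD _ _))//.
  by lra.
move=> x h Kx hm live_x.
have Kenl y : `|y - x| < r / 3 -> K1 y by move=> yx; apply: subset_closure; exists x.
case: live_x => [lx|lxh].
  by apply: near_pair => //; split=> //; apply: Kenl; rewrite subrr normr0 divr_gt0.
have Fxh : F (x + h).
  by split=> //; apply: Kenl; rewrite addrC addKr (le_lt_trans hm)// (lt_le_trans mm).
have /near_pair : F (x + h) by [].
by move=> /(_ (- h)); rewrite normrN addrK => /(_ hm) [? ?]; split.
Qed.

Let w x := trunc d (u x) * plateau (v x).
Let dw i x := trunc' d (u x) * g i x * plateau (v x) +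
  trunc d (u x) * plateau' (v x) * gam i x.

(** Each factor kills the product where it vanishes: [E] is dealt with by [v], and
    the points where [ut] is small by the truncation. *)
Lemma product_dead : Lae (fun x => S x -> ~ live x -> w x = 0).
Proof.
apply: LaeS2 vE utu => x vEx utux Sx /not_andP[/contrapT Ex|].
  by rewrite /w (plateau_ge1 (vEx Ex)).1 mulr0.
by move=> /negP; rewrite -ltNge utux// => /ltW/trunc_small[h _]; rewrite /w h mul0r.
Qed.

Lemma plateau_continuous : continuous (@plateau R).
Proof.
apply: (@lipschitz_fun_continuous _ _ 16) => a b.
have [h|h] := leP `|b - a| 1.
  have := plateau_quad a b; have := plateau_deriv_le a.
  have := ler_normD (plateau b - plateau a - plateau' a * (b - a)) (plateau' a * (b - a)).
  rewrite subrK normrM -[(b - a) ^+ 2]real_normK ?num_real//.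
  by have := normr_ge0 (b - a); move: (`|b - a|) h => y *; nra.
have /andP[? ?] := plateau01 a; have /andP[? ?] := plateau01 b.
apply: (@le_trans _ _ 1); last by lra.
by rewrite ler_norml; apply/andP; split; lra.
Qed.

Lemma plateau'_continuous : continuous (@plateau' R).
Proof. exact: quad_approx_derivative_continuous (@plateau_quad R). Qed.

Lemma trunc_continuous : continuous (trunc d).
Proof. exact: lipschitz_fun_continuous (trunc_lip d0). Qed.

Lemma trunc'_continuous : continuous (trunc' d).
Proof. exact: quad_approx_derivative_continuous (trunc_quad d0). Qed.

Let su : Lsq u. Proof. by case: ug. Qed.
Let sg i : Lsq (g i). Proof. by case: ug. Qed.
Let sv : Lsq v. Proof. by case: vgam. Qed.
Let sgam i : Lsq (gam i). Proof. by case: vgam. Qed.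
Let mu_ : Lmeas u. Proof. exact: Lsq_mf. Qed.
Let mv : Lmeas v. Proof. exact: Lsq_mf. Qed.
Let mG : Lmeas (fun x => trunc d (u x)). Proof. exact: (Lmeas_comp trunc_continuous). Qed.
Let mG' : Lmeas (fun x => trunc' d (u x)). Proof. exact: (Lmeas_comp trunc'_continuous). Qed.
Let mR : Lmeas (fun x => plateau (v x)). Proof. exact: (Lmeas_comp plateau_continuous). Qed.
Let mR' : Lmeas (fun x => plateau' (v x)). Proof. exact: (Lmeas_comp plateau'_continuous). Qed.
Let R01 x : `|plateau (v x)| <= 1.
Proof. by have /andP[? ?] := plateau01 (v x); rewrite ger0_norm. Qed.

Lemma product_Lsq : Lsq w.
Proof.
apply: (Lsq_dom (c := 1) (LmeasM mG mR) su); apply: LaeW => x.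
by rewrite mul1r normrM -[leRHS]mulr1; apply: ler_pM => //; exact: trunc_le.
Qed.

Lemma product_deriv_Lsq i : Lsq (dw i).
Proof.
apply: LsqD.
  have := Lsq_bdM (LmeasM mG' mR) (c := 2) _ (sg i).
  have h x : `|trunc' d (u x) * plateau (v x)| <= 2.
    by rewrite normrM -[leRHS]mulr1; apply: ler_pM => //; exact: trunc_deriv_le.
  by move=> /(_ h); congr Lsq; apply/funext => x; ring.
apply: (Lsq_bdM (LmeasM mG mR') (c := d^-1 * 4) _ (sgam i)) => x.
by rewrite normrM; apply: ler_pM => //; [exact: trunc_bounded|exact: plateau_deriv_le].
Qed.

(** The product of a truncation of [u] with a cut-off that vanishes on [E] keeps its
    weak derivatives when it is restricted to [A], because the restriction commutes
    with the difference quotients. *)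
Lemma product_restriction i phi : test_function S phi ->
  Lint (fun x => \1_A x * w x * 'D_(unit_vec i) phi x) =
  - Lint (fun x => \1_A x * dw i x * phi x).
Proof.
move=> tphi; have [_ [K [cK KS phi0]]] := tphi; have sphi := test_Lsq tphi.
have [tau [/andP[tau0 tau1] tauS tauA]] := live_separation cK KS.
have mA : Lset A by exact: Lset_open.
have cphi : continuous phi by have [h _] := tphi; exact: (h 0%N).
have [M M0 phiM] := continuous_compact_support_bounded cphi cK phi0.
pose t (n : nat) := tau * n.+1%:R^-1.
have t0 n : 0 < t n by rewrite mulr_gt0 ?invr_gt0.
have ttau n : t n <= tau by rewrite ler_piMr ?(ltW tau0)// invf_le1 ?ler1n.
have t01 n : 0 < t n <= 1 by rewrite t0 (le_trans (ttau n)).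
have tl : t @ \oo --> (0 : R).
  by rewrite -(mulr0 tau); apply: cvgM; [exact: cvg_cst|exact: cvg_harmonic].
have te n : `|t n *: unit_vec i : V| <= tau.
  rewrite normrZ (gtr0_norm (t0 n)) -[leRHS]mulr1; apply: ler_pM => //; first exact: ltW.
  exact: unit_vec_norm_le.
pose W := enlarge K tau.
have oW : open W by exact: open_enlarge.
have KW x : K x -> W x by move=> Kx; exists x => //; rewrite subrr normr0.
pose e1 n x := \1_W x * ((u (x + t n *: unit_vec i) - u x) / t n - g i x).
pose e2 n x := \1_W x * ((v (x + t n *: unit_vec i) - v x) / t n - gam i x).
have ne1 : Lsqmean_null e1.
  apply: (diff_quotient_null ug oW t0 tl) => n s x /andP[s0 s1] Wx; apply: tauS => //.
  by rewrite normrZ (ger0_norm s0) (le_trans _ (te n))// ler_piMl.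
have ne2 : Lsqmean_null e2.
  by apply: (diff_quotient_null vgam oW t0 tl).
have nphi (e : nat -> V -> R) : Lsqmean_null e -> Lmean_null (fun n x => `|e n x * phi x|).
  move=> ne; apply: Lmean_null_norm.
  by apply: (@Lsqmean_nullM _ _ e (fun=> phi) (Lint (fun x => phi x ^+ 2))) ne _ _.
have t01' n : 0 <= t n <= 1 by rewrite ltW//=; have /andP[] := t01 n.
pose C := 2 * (2 * (d + 3 / d)) + 2 * (d^-1 * 12) + 4 * d^-1 + 14.
pose H n x := C * (M * (e1 n x) ^+ 2 + M * (e2 n x) ^+ 2 + M * (t n * g i x ^+ 2) +
  M * (t n * gam i x ^+ 2) + `|e1 n x * phi x| + `|e2 n x * phi x|).
have nH : Lmean_null H.
  have n1 := Lmean_nullZ M (Lsqmean_null_sq ne1).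
  have n2 := Lmean_nullZ M (Lsqmean_null_sq ne2).
  have n3 := Lmean_nullZ M (Lmean_null_scale t01' tl (Lsq_summable (sg i))).
  have n4 := Lmean_nullZ M (Lmean_null_scale t01' tl (Lsq_summable (sgam i))).
  have n12 := Lmean_nullD (Lmean_nullD (Lmean_nullD n1 n2) n3) n4.
  exact: (Lmean_nullZ C (Lmean_nullD (Lmean_nullD n12 (nphi _ ne1)) (nphi _ ne2))).
have sz : Lsq (fun x => \1_A x * w x) by exact: (Lsq_indicM mA product_Lsq).
have sdz : Lsq (fun x => \1_A x * dw i x) by exact: (Lsq_indicM mA (product_deriv_Lsq i)).
apply: (weak_derivative_of_quotients sz (tphi.1 1%N) cK phi0 t01 tl (LsqM sdz sphi)).
apply: (Lmean_null_dom _ nH) => [n|n].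
  have mz := Lsq_mf sz; have mzt := Lmeas_shift (t n *: unit_vec i) mz.
  exact: (LmeasM (LmeasB (LmeasM (LmeasB mzt mz) (Lmeas_cst _)) (Lsq_mf sdz)) (Lsq_mf sphi)).
apply: LaeS2 product_dead (Lae_shift (t n *: unit_vec i) product_dead) => x dead1 dead2.
have [Kx|nKx] := pselect (K x); last first.
  rewrite phi0// mulr0 normr0 /H phi0// !mulr0 !normr0 !addr0.
  have C0 : 0 <= C by rewrite !addr_ge0 ?mulr_ge0 ?addr_ge0 ?divr_ge0 ?invr_ge0 ?(ltW d0).
  by rewrite mulr_ge0// !addr_ge0// mulr_ge0 ?sqr_ge0// mulr_ge0 ?sqr_ge0// ltW.
have Wx := KW _ Kx.
have Sxh : S (x + t n *: unit_vec i) by exact: tauS.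
(* If the product is nonzero at one of the two points, both lie on the same side;
   otherwise both sides of the identity vanish. *)
have zE : \1_A (x + t n *: unit_vec i) * w (x + t n *: unit_vec i) - \1_A x * w x =
    \1_A x * (w (x + t n *: unit_vec i) - w x).
  have [lv|/not_orP[d1 d2]] := pselect (live x \/ live (x + t n *: unit_vec i)); last first.
    by rewrite (dead1 (KS _ Kx) d1) (dead2 Sxh d2) !mulr0 !subr0 mulr0.
  have -> : \1_A (x + t n *: unit_vec i) = \1_A x :> R.
    have hA := tauA _ _ Kx (te n) lv; rewrite !indicE.
    have [Ax|nAx] := pselect (A x); first by rewrite !mem_set//; exact/hA.
    by rewrite !memNset// => /hA.
  by rewrite mulrBr.
have k1 : `|(w (x + t n *: unit_vec i) - w x) / t n - dw i x| <=
    C * ((e1 n x) ^+ 2 + (e2 n x) ^+ 2 + t n * g i x ^+ 2 + t n * gam i x ^+ 2 +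
         `|e1 n x| + `|e2 n x|).
  rewrite /e1 /e2 indicE mem_set// !mul1r.
  have := @quotient_product_bound R (trunc d) (trunc' d) plateau plateau'
    (2 * (d + 3 / d)) 12 d^-1 (u x) (u (x + t n *: unit_vec i)) (v x)
    (v (x + t n *: unit_vec i)) (g i x) (gam i x) (t n) (trunc_quad d0) (@plateau_quad R).
  apply => //.
  - exact: trunc_deriv_le.
  - exact: trunc_bounded.
  - exact: trunc_lip.
  - exact: plateau01.
  - exact: plateau_deriv_le.
  - by rewrite mulr_ge0// addr_ge0 ?divr_ge0 ?(ltW d0).
  - by rewrite invr_ge0 ltW.
rewrite zE -mulrA -mulrBr !normrM.
have k2 : `|\1_A x : R| <= 1 by have /andP[? ?] := indic01 A x; rewrite ger0_norm.
rewrite -mulrA; apply: (@le_trans _ _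
  (1 * (`|(w (x + t n *: unit_vec i) - w x) / t n - dw i x| * `|phi x|))).
  by apply: ler_wpM2r => //; rewrite mulr_ge0.
rewrite mul1r; apply: (le_trans (ler_wpM2r (normr_ge0 _) k1)); rewrite /H.
have C0 : 0 <= C by rewrite !addr_ge0 ?mulr_ge0 ?addr_ge0 ?divr_ge0 ?invr_ge0 ?(ltW d0).
rewrite -[leLHS]mulrA; apply: ler_wpM2l => //.
move: (e1 n x) (e2 n x) => a1 a2; rewrite !normrM !mulrDl.
have hM p : 0 <= p -> p * `|phi x| <= M * p by move=> p0; rewrite mulrC ler_wpM2r.
have tg (q : R) : 0 <= t n * q ^+ 2 by rewrite mulr_ge0 ?sqr_ge0// ltW.
by rewrite !lerD// hM// sqr_ge0.
Qed.

End cut.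

Section restriction.
Context {R : realType} {N : nat}.
Notation V := 'rV[R]_N.
Variables (S A B : set V) (u ut : V -> R) (g : 'I_N -> V -> R).
Hypotheses (oS : open S) (oA : open A) (oB : open B).
Hypothesis AB : forall x, A x -> B x -> False.
Hypothesis ug : H1ext S u g.
Hypothesis utu : Lae (fun x => S x -> ut x = u x).

(** Off open sets of arbitrarily small capacity, [ut] is continuous and lives in
    the union of [A] and [B]. *)
Hypothesis small_exceptional_set : forall k : nat, exists E v gam,
  [/\ open E, H1ext setT v gam, Lae (fun x => E x -> 1 <= v x),
      {within S `\` E, continuous ut} &
      [/\ forall x, S x -> ~ E x -> ~ A x -> ~ B x -> ut x = 0,
      Lint (fun x => v x ^+ 2) <= k.+1%:R^-1 &
      forall i : 'I_N, Lint (fun x => gam i x ^+ 2) <= k.+1%:R^-1]].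

Let su : Lsq u. Proof. by case: ug. Qed.
Let sg i : Lsq (g i). Proof. by case: ug. Qed.
Let mu_ : Lmeas u. Proof. exact: Lsq_mf. Qed.
Let mA : Lmeas (\1_A : V -> R). Proof. exact/Lmeas_indic/Lset_open. Qed.
Let A1 x : `|\1_A x : R| <= 1.
Proof. by have /andP[? ?] := indic01 A x; rewrite ger0_norm. Qed.

Let Lsqmean_null_small (f : nat -> V -> R) : (forall k, Lsq (f k)) ->
  (forall k, Lint (fun x => f k x ^+ 2) <= k.+1%:R^-1) -> Lsqmean_null f.
Proof.
move=> sf fk; apply/Lsqmean_nullE; split=> //.
apply: (@cvg0_le _ _ (fun k => k.+1%:R^-1)); last exact: cvg_harmonic.
by move=> n; rewrite Lint_sq_ge0 fk.
Qed.

(** Along exceptional sets of vanishing capacity the cut-offs tend to [1], and their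
    gradients to [0], in the square mean. *)
Lemma truncation_restriction d i phi : 0 < d -> test_function S phi ->
  Lint (fun x => \1_A x * trunc d (u x) * 'D_(unit_vec i) phi x) =
  - Lint (fun x => \1_A x * (trunc' d (u x) * g i x) * phi x).
Proof.
move=> d0 tphi; have sphi := test_Lsq tphi; have sD := test_derive_Lsq i tphi.
have [_ [K [cK _ phi0]]] := tphi.
have cphi : continuous phi by have [h _] := tphi; exact: (h 0%N).
have [M M0 phiM] := continuous_compact_support_bounded cphi cK phi0.
have /choice[E /choice[v /choice[gam P]]] := small_exceptional_set.
have sv k : Lsq (v k) by have [_ []] := P k.
have sgam k : Lsq (gam k i) by have [_ []] := P k.
have nv : Lsqmean_null v by apply: Lsqmean_null_small => // k; have [_ _ _ _ []] := P k.
have ng : Lsqmean_null (fun k => gam k i).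
  by apply: Lsqmean_null_small => // k; have [_ _ _ _ []] := P k.
have mG : Lmeas (fun x => trunc d (u x)) := Lmeas_comp (trunc_continuous d0) mu_.
have mG' : Lmeas (fun x => trunc' d (u x)) := Lmeas_comp (trunc'_continuous d0) mu_.
have mR k : Lmeas (fun x => plateau (v k x)).
  exact: (Lmeas_comp plateau_continuous (Lsq_mf (sv k))).
have mR' k : Lmeas (fun x => plateau' (v k x)).
  exact: (Lmeas_comp plateau'_continuous (Lsq_mf (sv k))).
have sAG : Lsq (fun x => \1_A x * trunc d (u x)).
  apply: (Lsq_dom (c := 1) (LmeasM mA mG) su); apply: LaeW => x.
  by rewrite normrM; apply: ler_pM => //; exact: trunc_le.
have sAG' : Lsq (fun x => \1_A x * (trunc' d (u x) * g i x)).
  apply: (Lsq_bdM mA A1); apply: (Lsq_bdM mG' _ (sg i)) => x; exact: trunc_deriv_le.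
have nM (e : nat -> V -> R) f : Lsqmean_null e -> Lsq f ->
    Lmean_null (fun k x => `|e k x * f x|).
  move=> ne sf; apply: Lmean_null_norm.
  by apply: (@Lsqmean_nullM _ _ e (fun=> f) (Lint (fun x => f x ^+ 2))) ne _ _.
have R1 k x : `|plateau (v k x) - 1| <= 2 * `|v k x| by exact: plateau_near1.
have l1 : (fun k => Lint (fun x => \1_A x * (trunc d (u x) * plateau (v k x)) *
      'D_(unit_vec i) phi x)) @ \oo -->
    Lint (fun x => \1_A x * trunc d (u x) * 'D_(unit_vec i) phi x).
  apply: Lmean_null_cvg; first exact: (LsqM sAG sD).
  apply: (Lmean_null_dom _ (Lmean_nullZ (d^-1 * 2) (nM _ _ nv sD))) => k.
    have mD := Lsq_mf sD.
    exact: (LmeasB (LmeasM (LmeasM mA (LmeasM mG (mR k))) mD) (LmeasM (LmeasM mA mG) mD)).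
  apply: LaeW => x; rewrite (_ : _ - _ = \1_A x * trunc d (u x) *
    (plateau (v k x) - 1) * 'D_(unit_vec i) phi x); last by ring.
  rewrite !normrM mulrA; apply: ler_wpM2r => //; rewrite -[leRHS]mulrA.
  apply: ler_pM => //; rewrite -[leRHS]mul1r; apply: ler_pM => //; exact: trunc_bounded.
have l2 : (fun k => Lint (fun x => \1_A x * (trunc' d (u x) * g i x * plateau (v k x) +
      trunc d (u x) * plateau' (v k x) * gam k i x) * phi x)) @ \oo -->
    Lint (fun x => \1_A x * (trunc' d (u x) * g i x) * phi x).
  apply: Lmean_null_cvg; first exact: (LsqM sAG' sphi).
  have n1 := Lmean_nullZ (4 * M) (nM _ _ nv (sg i)).
  have n2 := Lmean_nullZ (d^-1 * 4) (nM _ _ ng sphi).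
  apply: (Lmean_null_dom _ (Lmean_nullD n1 n2)) => k.
    have mphi := Lsq_mf sphi; have mgi := Lsq_mf (sg i); have mgk := Lsq_mf (sgam k).
    apply: LmeasB; apply: LmeasM => //; apply: (LmeasM mA); last exact: (LmeasM mG' mgi).
    exact: (LmeasD (LmeasM (LmeasM mG' mgi) (mR k)) (LmeasM (LmeasM mG (mR' k)) mgk)).
  apply: LaeW => x; rewrite (_ : _ - _ = \1_A x * (trunc' d (u x) *
    (plateau (v k x) - 1) * g i x * phi x + trunc d (u x) * plateau' (v k x) * gam k i x * phi x));
    last by ring.
  rewrite normrM -[leRHS]mul1r; apply: ler_pM => //.
  rewrite (le_trans (ler_normD _ _))//; apply: lerD.
    have h1 := trunc_deriv_le d0 (u x); have h2 := R1 k x; have h3 := phiM x.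
    have h4 : `|trunc' d (u x)| * `|plateau (v k x) - 1| <= 2 * (2 * `|v k x|) by exact: ler_pM.
    rewrite !normrM (_ : 4 * M * _ = 2 * (2 * `|v k x|) * `|g i x| * M); last by ring.
    by apply: ler_pM => //; exact: ler_wpM2r.
  rewrite !normrM -[leLHS]mulrA; apply: ler_wpM2r; first by rewrite mulr_ge0.
  by apply: ler_pM => //; [exact: trunc_bounded|exact: plateau_deriv_le].
apply: (cvg_unique (@Rhausdorff R) l1).
have -> : (fun k => Lint (fun x => \1_A x * (trunc d (u x) * plateau (v k x)) *
    'D_(unit_vec i) phi x)) = (fun k => - Lint (fun x => \1_A x *
    (trunc' d (u x) * g i x * plateau (v k x) +
      trunc d (u x) * plateau' (v k x) * gam k i x) * phi x)).
  apply/funext => k; have [oE vgam vE cut [ut0 _ _]] := P k.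
  exact: (product_restriction oS oA oB AB ug vgam oE vE cut utu ut0 d0 i tphi).
exact: cvgN.
Qed.

(** The factor that tests [u x != 0] is the limit of the derivatives of the
    truncations. *)
Definition restricted_gradient i x := \1_A x * ((u x != 0)%:R * g i x).

Let dn (n : nat) : R := n.+1%:R^-1.
Let dn0 n : 0 < dn n. Proof. by rewrite invr_gt0. Qed.

(** The truncation level tends to [0]. *)
Lemma restriction_weak_gradient : H1ext S (fun x => \1_A x * u x) restricted_gradient.
Proof.
have [_ _ u0 g0 _] := ug.
have mN : Lmeas (fun x => (u x != 0)%:R).
  apply: (@Lmeas_cvg _ _ (fun n x => trunc' (dn n) (u x))) => [n|x].
    exact: (Lmeas_comp (trunc'_continuous (dn0 n)) mu_).
  exact: (trunc_limit (u x)).2.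
have N1 x : `|(u x != 0)%:R : R| <= 1 by case: eqP; rewrite ?normr0 ?normr1.
have sAg i : Lsq (restricted_gradient i).
  by apply: (Lsq_bdM mA A1); exact: (Lsq_bdM mN N1 (sg i)).
split; [exact: (Lsq_bdM mA A1 su)|exact: sAg|..].
- by move=> x /u0 ->; rewrite mulr0.
- by move=> i x /g0 h; rewrite /restricted_gradient h !mulr0.
move=> i phi tphi; have sphi := test_Lsq tphi; have sD := test_derive_Lsq i tphi.
have mD := Lsq_mf sD; have mphi := Lsq_mf sphi; have mgi := Lsq_mf (sg i).
have mG n : Lmeas (fun x => trunc (dn n) (u x)) := Lmeas_comp (trunc_continuous (dn0 n)) mu_.
have mG' n : Lmeas (fun x => trunc' (dn n) (u x)) := Lmeas_comp (trunc'_continuous (dn0 n)) mu_.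
have sAu : Lsq (fun x => \1_A x * u x) := Lsq_bdM mA A1 su.
have l1 : (fun n => Lint (fun x => \1_A x * trunc (dn n) (u x) * 'D_(unit_vec i) phi x)) @ \oo -->
    Lint (fun x => \1_A x * u x * 'D_(unit_vec i) phi x).
  apply: Lmean_null_cvg; first exact: (LsqM sAu sD).
  apply: (Lmean_null_dct _ (Lsummable_norm (LsummableZ 2 (LsqM su sD)))) => [n|n|].
  - exact: (LmeasB (LmeasM (LmeasM mA (mG n)) mD) (LmeasM (LmeasM mA mu_) mD)).
  - apply: LaeW => x; rewrite (_ : _ - _ = \1_A x * ((trunc (dn n) (u x) - u x) *
      'D_(unit_vec i) phi x)); last by ring.
    rewrite normrM -[leRHS]mul1r; apply: ler_pM => //.
    rewrite mulrA !normrM; apply: ler_wpM2r => //.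
    rewrite (le_trans (ler_normB _ _))// (@ger0_norm _ 2)//.
    by have := trunc_le (dn0 n) (u x); lra.
  apply: LaeW => x.
  rewrite -[X in _ --> X](subrr (\1_A x * u x * 'D_(unit_vec i) phi x)).
  apply: cvgB; last exact: cvg_cst.
  apply: cvgM; last exact: cvg_cst.
  by apply: cvgM; [exact: cvg_cst|exact: (trunc_limit (u x)).1].
have l2 : (fun n => Lint (fun x => \1_A x * (trunc' (dn n) (u x) * g i x) * phi x)) @ \oo -->
    Lint (fun x => restricted_gradient i x * phi x).
  apply: Lmean_null_cvg; first exact: (LsqM (sAg i) sphi).
  apply: (Lmean_null_dct _ (Lsummable_norm (LsummableZ 3 (LsqM (sg i) sphi)))) => [n|n|].
  - exact: (LmeasB (LmeasM (LmeasM mA (LmeasM (mG' n) mgi)) mphi) (LmeasM (Lsq_mf (sAg i)) mphi)).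
  - apply: LaeW => x; rewrite (_ : _ - _ = \1_A x * ((trunc' (dn n) (u x) - (u x != 0)%:R) *
      (g i x * phi x))); last by rewrite /restricted_gradient; ring.
    rewrite normrM -[leRHS]mul1r; apply: ler_pM => //.
    rewrite [leLHS]normrM [leRHS]normrM; apply: ler_wpM2r => //.
    rewrite (le_trans (ler_normB _ _))// (@ger0_norm _ 3)//.
    by have := trunc_deriv_le (dn0 n) (u x); have := N1 x; lra.
  apply: LaeW => x; rewrite -[X in _ --> X](subrr (restricted_gradient i x * phi x)).
  apply: cvgB; last exact: cvg_cst.
  apply: cvgM; last exact: cvg_cst.
  apply: cvgM; first exact: cvg_cst.
  by apply: cvgM; [exact: (trunc_limit (u x)).2|exact: cvg_cst].
apply: (cvg_unique (@Rhausdorff R) l1).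
have -> : (fun n => Lint (fun x => \1_A x * trunc (dn n) (u x) * 'D_(unit_vec i) phi x)) =
    (fun n => - Lint (fun x => \1_A x * (trunc' (dn n) (u x) * g i x) * phi x)).
  by apply/funext => n; exact: truncation_restriction.
exact: cvgN.
Qed.

End restriction.

(** * Capacity *)

Section capacity_facts.
Context {R : realType} {N : nat}.
Notation V := 'rV[R]_N.
Notation mu := (@leb R N).
Implicit Types (u v w : V -> R) (gam : 'I_N -> V -> R) (E U S : set V).

(** Meant for capacitary functions, hence on the whole space. *)
Lemma chain_weak_gradient v gam (G G' : R -> R) C L : quad_approx G G' C -> 0 <= C ->
  continuous G -> (forall s, `|G s| <= L * `|s|) -> (forall s, `|G' s| <= L) ->
  H1ext setT v gam ->
  H1ext setT (fun x => G (v x)) (fun i x => G' (v x) * gam i x).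
Proof.
move=> qG C0 cG GL G'L vgam; have [sv sgam _ _ _] := vgam.
have mv := Lsq_mf sv.
have L0 : 0 <= L by exact: le_trans (normr_ge0 _) (G'L 0).
have mG : Lmeas (fun x => G (v x)) := Lmeas_comp cG mv.
have mG' : Lmeas (fun x => G' (v x)) := Lmeas_comp (quad_approx_derivative_continuous qG) mv.
have sG : Lsq (fun x => G (v x)).
  by apply: (Lsq_dom (c := L) mG sv); apply: LaeW => x; exact: GL.
have sG' i : Lsq (fun x => G' (v x) * gam i x).
  by apply: (Lsq_bdM mG' (c := L) _ (sgam i)) => x; exact: G'L.
split; [exact: sG|exact: sG'|by move=> x []|by move=> i x []|].
move=> i phi tphi; have [_ [K [cK _ phi0]]] := tphi; have sphi := test_Lsq tphi.
have cphi : continuous phi by have [h _] := tphi; exact: (h 0%N).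
have [M M0 phiM] := continuous_compact_support_bounded cphi cK phi0.
pose t (n : nat) : R := n.+1%:R^-1.
have t0 n : 0 < t n by rewrite invr_gt0.
have t1 n : 0 <= t n <= 1 by rewrite ltW//= invf_le1 ?ler1n.
have t01 n : 0 < t n <= 1 by rewrite t0; have /andP[] := t1 n.
have tl : t @ \oo --> (0 : R) by exact: cvg_harmonic.
pose e n x := \1_[set: V] x * ((v (x + t n *: unit_vec i) - v x) / t n - gam i x).
have ne : Lsqmean_null e by apply: (diff_quotient_null vgam openT t0 tl).
have eE n x : e n x = (v (x + t n *: unit_vec i) - v x) / t n - gam i x.
  by rewrite /e indicE mem_set// mul1r.
have nphi : Lmean_null (fun n x => `|e n x * phi x|).
  apply: Lmean_null_norm.
  by apply: (@Lsqmean_nullM _ _ e (fun=> phi) (Lint (fun x => phi x ^+ 2))) ne _ _.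
have n1 := Lmean_nullZ (2 * C * M) (Lsqmean_null_sq ne).
have n2 := Lmean_nullZ (2 * C * M) (Lmean_null_scale t1 tl (Lsq_summable (sgam i))).
have n3 := Lmean_nullD (Lmean_nullD n1 n2) (Lmean_nullZ L nphi).
apply: (weak_derivative_of_quotients sG (tphi.1 1%N) cK phi0 t01 tl (LsqM (sG' i) sphi)).
apply: (Lmean_null_dom _ n3) => n.
  have mGt := Lmeas_shift (t n *: unit_vec i) mG.
  exact: (LmeasM (LmeasB (LmeasM (LmeasB mGt mG) (Lmeas_cst _)) (Lsq_mf (sG' i))) (Lsq_mf sphi)).
apply: LaeW => x; rewrite eE.
set a := v x; set b := v (x + _); set q := (b - a) / t n.
have ba : b - a = t n * q by rewrite /q mulrC divfK// gt_eqF.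
have -> : ((G b - G a) / t n - G' a * gam i x) * phi x =
    (G b - G a - G' a * (b - a)) / t n * phi x + G' a * ((q - gam i x) * phi x).
  by rewrite ba; field; rewrite gt_eqF.
rewrite (le_trans (ler_normD _ _))//; apply: lerD; last first.
  by rewrite normrM; apply: ler_wpM2r.
have h1 : `|(G b - G a - G' a * (b - a)) / t n| <= C * (t n * q ^+ 2).
  rewrite normrM normfV (gtr0_norm (t0 n)) ler_pdivrMr// (le_trans (qG a b))// ba.
  by rewrite le_eqVlt; apply/orP; left; apply/eqP; ring.
have h2 : t n * q ^+ 2 <= 2 * ((q - gam i x) ^+ 2 + t n * gam i x ^+ 2).
  have h3 : q ^+ 2 <= 2 * ((q - gam i x) ^+ 2 + gam i x ^+ 2).
    by have := sqr_ge0 (q - 2 * gam i x); nra.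
  have h4 : t n * (q - gam i x) ^+ 2 <= (q - gam i x) ^+ 2.
    by rewrite ler_piMl ?sqr_ge0//; have /andP[] := t1 n.
  by have := ler_wpM2l (ltW (t0 n)) h3; lra.
have h5 := le_trans h1 (ler_wpM2l C0 h2).
rewrite normrM; apply: (@le_trans _ _ (C * (2 * ((q - gam i x) ^+ 2 + t n * gam i x ^+ 2)) * M)).
  by apply: ler_pM.
by rewrite le_eqVlt; apply/orP; left; apply/eqP; ring.
Qed.

(** Small capacity, with the function and its gradient bounded separately: this form
    is stable under unions and dilations up to constants. *)
Definition capped (e : R) E := exists U v gam,
  [/\ open U, E `<=` U, H1ext setT v gam, Lae (fun x => U x -> 1 <= v x) &
      Lint (fun x => v x ^+ 2) <= e /\ forall i, Lint (fun x => gam i x ^+ 2) <= e].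

Lemma capped_mono e e' E E' : e <= e' -> E `<=` E' -> capped e E' -> capped e' E.
Proof.
move=> ee EE [U [v [gam [oU EU vg vU [h1 h2]]]]]; exists U, v, gam; split=> //.
  exact: subset_trans EU.
by split=> [|i]; [exact: le_trans h1 ee|exact: le_trans (h2 i) ee].
Qed.

Let energy v gam x := v x ^+ 2 + \sum_(i < N) gam i x ^+ 2.

Lemma dot_sqE (x : V) : dot x x = \sum_(i < N) x 0 i ^+ 2.
Proof. by apply: eq_bigr => i _; rewrite expr2. Qed.

Let energy_summable v gam : H1ext setT v gam -> Lsummable (energy v gam).
Proof.
move=> [sv sg _ _ _]; apply: LsummableD; first exact: Lsq_summable.
by apply: Lsummable_sum => i; exact: Lsq_summable.
Qed.

Lemma capacity_capped (e : R) E : (capacity E < e%:E)%E -> capped e E.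
Proof.
move=> /ereal_inf_lt[_ [v [g [U [vg [oU EU] vU ->]]]]] ce.
have pT (f : V -> R) : f \_ [set: V] = f by apply/funext => x; rewrite patchE mem_set.
have := H1_ext openT vg; rewrite pT.
have -> : (fun i : 'I_N => (fun x => g x 0 i) \_ [set: V]) = (fun i x => g x 0 i).
  by apply/funext => i; rewrite pT.
move=> vg'; have [sv sg _ _ _] := vg'.
have ei := energy_summable vg'.
have cE : (\int[mu]_x (v x ^+ 2 + dot (g x) (g x))%:E =
    (Lint (energy v (fun i x => g x 0 i)))%:E)%E.
  by rewrite LEFin_int//; apply: eq_integral => x _; rewrite dot_sqE.
move: ce; rewrite cE lte_fin => /ltW ce.
exists U, v, (fun i x => g x 0 i); split; [by []|by []|exact: vg'|exact/LaeP|].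
have g0 x : 0 <= \sum_(i < N) g x 0 i ^+ 2 by apply: sumr_ge0 => i _; exact: sqr_ge0.
split=> [|i]; apply: le_trans ce; apply: Lle_int => //; try exact: Lsq_summable.
  by apply: LaeW => x; rewrite lerDl.
apply: LaeW => x; rewrite /energy (bigD1 i)//=.
rewrite addrCA lerDl addr_ge0 ?sqr_ge0//; apply: sumr_ge0 => j _; exact: sqr_ge0.
Qed.

Lemma capped_capacity (e : R) E : capped e E -> (capacity E <= (N.+1%:R * e)%:E)%E.
Proof.
move=> [U [v [gam [oU EU vg vU [h1 h2]]]]].
have [sv sg _ _ _] := vg.
apply: (@le_trans _ _ (Lint (energy v gam))%:E).
  apply: ereal_inf_lbound; exists v, (fun x => \row_i gam i x), U.
  split; [exact: (ext_H1 openT vg)|by split|exact/LaeP|].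
  rewrite LEFin_int; last exact: energy_summable.
  apply: eq_integral => x _; rewrite dot_sqE; congr (_ + _)%:E.
  by apply: eq_bigr => i _; rewrite mxE.
rewrite lee_fin LintD; [|exact: Lsq_summable|by apply: Lsummable_sum => i; exact: Lsq_summable].
rewrite Lint_sum; last by move=> i; exact: Lsq_summable.
rewrite -natr1 mulrDl mul1r addrC lerD// mulr_natl -[X in _ *+ X](card_ord N) -sumr_const.
exact: ler_sum.
Qed.

Lemma capacity_ge0 E : (0 <= capacity E)%E.
Proof.
apply: le_ereal_inf_tmp => _ [v [g [U [_ _ _ ->]]]]; apply: integral_ge0 => x _.
rewrite lee_fin addr_ge0 ?sqr_ge0// dot_sqE; apply: sumr_ge0 => i _; exact: sqr_ge0.
Qed.

Lemma capacity0P E : capacity E = 0%E <-> forall e, 0 < e -> capped e E.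
Proof.
split=> [E0 e e0|h]; first by apply: capacity_capped; rewrite E0 lte_fin.
apply/eqP; rewrite eq_le capacity_ge0 andbT; apply/lee_addgt0Pr => e e0; rewrite add0e.
have e1 : 0 < e / N.+1%:R by rewrite divr_gt0.
by apply: (le_trans (capped_capacity (h _ e1))); rewrite lee_fin mulrC divfK.
Qed.

Lemma capped0 e : 0 <= e -> capped e (set0 : set V).
Proof.
have s0 : Lsq (fun _ : V => 0 : R).
  by split; [exact: Lmeas_cst|under eq_fun do rewrite expr0n; exact: Lsummable0].
move=> e0; exists set0, (fun=> 0), (fun _ => fun=> 0); split.
- exact: open0.
- by [].
- split; [exact: s0|by move=> i; exact: s0|by []|by []|].
  by move=> i phi _; under Lint_ext do rewrite mul0r;
    under [in RHS]Lint_ext do rewrite mul0r; rewrite Lint0 oppr0.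
- by apply: LaeW.
by split=> [|i]; under Lint_ext do rewrite expr0n; rewrite Lint0.
Qed.

Lemma capacity0_set0 : capacity (set0 : set V) = 0%E.
Proof. by apply/capacity0P => e /ltW; exact: capped0. Qed.

Let bend (s : R) := 1 - plateau s.

(** Capacitary functions need not be nonnegative, so they are first composed with
    a function vanishing at [0] and equal to [1] beyond [1]. *)
Lemma capped_nonneg e E : capped e E -> exists U v gam,
  [/\ open U, E `<=` U, H1ext setT v gam & [/\ forall x, 0 <= v x,
      Lae (fun x => U x -> 1 <= v x), Lint (fun x => v x ^+ 2) <= 16 * e &
      forall i, Lint (fun x => gam i x ^+ 2) <= 16 * e]].
Proof.
move=> [U [v [gam [oU EU vg vU [h1 h2]]]]]; have [sv sg _ _ _] := vg.
have qb : quad_approx bend (fun s => - plateau' s) 12.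
  move=> a b; have := plateau_quad a b; rewrite -normrN; congr (_ <= _); congr `|_|.
  by rewrite /bend; ring.
have bl (s : R) : `|bend s| <= 4 * `|s|.
  rewrite /bend distrC (le_trans (plateau_near1 s))//.
  by apply: ler_wpM2r => //; rewrite ler_nat.
have bl' (s : R) : `|- plateau' s| <= 4 by rewrite normrN plateau_deriv_le.
have cb : continuous bend.
  by move=> s; apply: cvgB; [exact: cvg_cst|exact: plateau_continuous].
have ch := chain_weak_gradient qb (ler0n _ _) cb bl bl' vg; have [s1 s2 _ _ _] := ch.
have sqle a b : `|a| <= 4 * `|b| -> a ^+ 2 <= 16 * b ^+ 2 :> R.
  move=> ab; rewrite -[a ^+ 2]real_normK ?num_real// -[b ^+ 2]real_normK ?num_real//.
  by have := normr_ge0 a; nra.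
exists U, (fun x => bend (v x)), (fun i x => - plateau' (v x) * gam i x); split=> //; split.
- by move=> x; rewrite subr_ge0; have /andP[] := plateau01 (v x).
- by apply: LaeS vU => x vx /vx /plateau_ge1[h _]; rewrite /bend h subr0.
- apply: (@le_trans _ _ (16 * Lint (fun x => v x ^+ 2))); last by rewrite ler_wpM2l.
  rewrite -LintZ; last exact: Lsq_summable.
  apply: Lle_int; [exact: Lsq_summable|exact/LsummableZ/Lsq_summable|].
  by apply: LaeW => x; exact: sqle.
- move=> i; apply: (@le_trans _ _ (16 * Lint (fun x => gam i x ^+ 2))); last by rewrite ler_wpM2l.
  rewrite -LintZ; last exact: Lsq_summable.
  apply: Lle_int; [exact: Lsq_summable|exact/LsummableZ/Lsq_summable|].
  by apply: LaeW => x; apply: sqle; rewrite normrM ler_wpM2r.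
Qed.

Lemma H1extD u v (g h : 'I_N -> V -> R) S : H1ext S u g -> H1ext S v h ->
  H1ext S (fun x => u x + v x) (fun i x => g i x + h i x).
Proof.
move=> [su sg u0 g0 wu] [sv sh v0 h0 wv].
split; [exact: LsqD|by move=> i; exact: LsqD|by move=> x Sx; rewrite u0// v0// addr0| |].
  by move=> i x Sx; rewrite g0// h0// addr0.
move=> i phi tphi; have sphi := test_Lsq tphi; have sD := test_derive_Lsq i tphi.
under Lint_ext do rewrite mulrDl; under [in RHS]Lint_ext do rewrite mulrDl.
rewrite !LintD; [|exact: LsqM..].
by rewrite wu// wv// opprD.
Qed.

(** The sum of two nonnegative capacitary functions is a capacitary function for the
    union. *)
Lemma cappedU e E1 E2 : capped e E1 -> capped e E2 -> capped (64 * e) (E1 `|` E2).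
Proof.
move=> /capped_nonneg[U1 [v1 [g1 [oU1 EU1 vg1 [v10 vU1 h1 k1]]]]].
move=> /capped_nonneg[U2 [v2 [g2 [oU2 EU2 vg2 [v20 vU2 h2 k2]]]]].
have [s1 t1 _ _ _] := vg1; have [s2 t2 _ _ _] := vg2.
exists (U1 `|` U2), (fun x => v1 x + v2 x), (fun i x => g1 i x + g2 i x); split.
- exact: openU.
- exact: setUSS.
- exact: H1extD.
- apply: LaeS2 vU1 vU2 => x w1 w2 [/w1|/w2] h; first by have := v20 x; lra.
  by have := v10 x; lra.
split=> [|i]; first by have := Lint_sq_add_le s1 s2; lra.
by have := Lint_sq_add_le (t1 i) (t2 i); have := k1 i; have := k2 i; lra.
Qed.

(** Where a capacitary function is at least [1], so is its square. *)
Lemma capped_measure (e : R) E : capped e E -> (leb_outer E <= e%:E)%E.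
Proof.
move=> [U [v [gam [oU EU [sv _ _ _ _] vU [h1 _]]]]].
have mU : Lset U by exact: Lset_open.
have dU : Lae (fun x => `|\1_U x| <= v x ^+ 2).
  apply: LaeS vU => x vUx; rewrite indicE; case: (boolP (x \in U)) => [|_].
    rewrite in_setE => /vUx v1; rewrite normr1.
    have v0 : 0 <= v x by exact: le_trans v1.
    by have := ler_pM ler01 ler01 v1 v1; rewrite mulr1 expr2.
  by rewrite normr0 sqr_ge0.
have iU : Lsummable \1_U by exact: (Lsummable_dom (Lmeas_indic mU) (Lsq_summable sv) dU).
apply: (@le_trans _ _ (mu U)); first exact: le_outer_measure.
apply: (@le_trans _ _ (Lint \1_U)%:E).
  by rewrite LEFin_int// integral_indic ?setIT//; exact/LsetP.
rewrite lee_fin; apply: le_trans h1; apply: Lle_int => //; first exact: Lsq_summable.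
by apply: LaeS dU => x; apply: le_trans; exact: ler_norm.
Qed.

Lemma capacity0_null E : capacity E = 0%E -> leb_outer E = 0%E.
Proof.
move=> /capacity0P h; apply/eqP; rewrite eq_le outer_measure_ge0 andbT.
by apply/lee_addgt0Pr => e e0; rewrite add0e; apply: capped_measure; exact: h.
Qed.

End capacity_facts.

Section H10_split.
Context {R : realType} {N : nat}.
Notation V := 'rV[R]_N.
Notation mu := (@leb R N).
Implicit Types (u : V -> R) (g : V -> V) (A B S O Omega : set V).

Definition extgrad S g : 'I_N -> V -> R := fun i => (fun x => g x 0 i) \_ S.

(** The sets of small capacity needed to restrict [u] come from the quasi-continuity of
    its representative [ut], from the points off [Omega] where [ut] is nonzero, and
    from the points of [Omega] outside [A] and [B]. The product of [ut] with the
    indicator of [A] is again quasi-continuous, because [ut] vanishes at the points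
    outside [A] and [B]. *)
Lemma H10_restriction S Omega A B u g : open S -> open A -> open B ->
  (forall x, A x -> B x -> False) -> capacity (Omega `\` (A `|` B)) = 0%E ->
  H10 S Omega u g ->
  H10 S A (fun x => \1_A x * (u \_ S) x)
    (fun x => \row_i restricted_gradient A (u \_ S) (extgrad S g) i x).
Proof.
move=> oS oA oB AB cOm [ug [ut [qut utu ut0]]].
have ug' := H1_ext oS ug.
have small e : 0 < e -> exists E v gam,
  [/\ open E, H1ext setT v gam, Lae (fun x => E x -> 1 <= v x),
      {within S `\` E, continuous ut} &
      [/\ forall x, S x -> ~ E x -> ~ A x -> ~ B x -> ut x = 0,
      Lint (fun x => v x ^+ 2) <= e &
      forall i : 'I_N, Lint (fun x => gam i x ^+ 2) <= e]].
  move=> e0; pose d := e / 64 / 64 / 2.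
  have d0 : 0 < d by rewrite !divr_gt0.
  have [E1 [oE1 cE1 cut]] := qut d d0.
  have k1 : capped (64 * (2 * d)) E1.
    apply: (@capped_mono _ _ (2 * d) _ _ E1) => //; first by rewrite ler_peMl ?ler1n// mulr_ge0// ltW.
    by apply: capacity_capped; apply: le_lt_trans cE1 _; rewrite lte_fin ltr_pMl// ltr1n.
  have d20 : 0 < 2 * d by rewrite mulr_gt0.
  have k2 := cappedU ((capacity0P _).1 ut0 _ d20) ((capacity0P _).1 cOm _ d20).
  have [E [v [gam [oE EE vg vE [h1 h2]]]]] := cappedU k1 k2.
  have de : 64 * (64 * (2 * d)) = e by rewrite /d; field.
  rewrite de in h1 h2; exists E, v, gam; split; [by []|exact: vg|exact: vE| |split=> //].
    by apply: continuous_subspaceW cut => x [Sx nEx]; split=> // E1x; apply/nEx/EE; left.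
  move=> x Sx nEx nAx nBx; apply: contrapT => utx; apply/nEx/EE; right.
  have [Ox|nOx] := pselect (Omega x); first by right; split=> // -[].
  by left.
have utu' : Lae (fun x => S x -> ut x = (u \_ S) x).
  by apply: (LaeS _ ((LaeP _).2 utu)) => x h Sx; rewrite h// patchE mem_set.
have rg := restriction_weak_gradient oS oA oB AB ug' utu'
  (fun k => small k.+1%:R^-1 (eq_ind_r _ (ltr0Sn _ k) (invr_gt0 _))).
split; first exact: (ext_H1 oS rg).
exists (fun x => \1_A x * ut x); split.
- move=> e e0; have e1 : 0 < e / N.+1%:R by rewrite divr_gt0.
  have [E [v [gam [oE vg vE cut [utAB h1 h2]]]]] := small _ e1.
  exists E; split=> //.
    have : capped (e / N.+1%:R) E by exists E, v, gam; split.
    by move=> /capped_capacity; rewrite mulrC divfK.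
  apply/subspace_continuousP => p [Sp nEp].
  have [h _] := subspace_continuousP (S `\` E) ut.
  have cp := h cut p (conj Sp nEp).
  have near_eq (c : R) (U : set V) : open U -> U p -> (forall x, U x -> \1_A x = c) ->
      \1_A x * ut x @[x --> within (S `\` E) (nbhs p)] --> \1_A p * ut p.
    move=> oU Up Uc; rewrite Uc//.
    have : c * ut x @[x --> within (S `\` E) (nbhs p)] --> c * ut p.
      by apply: cvgM => //; exact: cvg_cst.
    apply: cvg_trans; apply: near_eq_cvg.
    have : nbhs p U by exact: open_nbhs_nbhs.
    by apply: filterS => x Ux _; rewrite Uc.
  have [Ap|nAp] := pselect (A p).
    by apply: (near_eq 1 A) => // x Ax; rewrite indicE mem_set.
  have [Bp|nBp] := pselect (B p).
    by apply: (near_eq 0 B) => // x Bx; rewrite indicE memNset// => /AB; apply.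
  rewrite /from_subspace /= (utAB p)// mulr0; apply/cvgr0Pnorm_lt => d d0.
  move/cvgrPdist_lt : cp => /(_ _ d0); apply: filterS => x hx.
  rewrite utAB// sub0r normrN in hx; apply: le_lt_trans hx.
  by rewrite normrM ler_piMl//; have /andP[? ?] := indic01 A x; rewrite ger0_norm.
- by apply/LaeP; apply: LaeS utu' => x h Sx; rewrite h.
- rewrite (_ : [set x | _] = set0) ?capacity0_set0//.
  apply/seteqP; split=> // x [[_ nAx] []]; rewrite indicE memNset// mul0r.
  by [].
Qed.

End H10_split.

(** * Poincare inequality in a Lipschitz cone *)

Section sums.
Context {R : realType} {N : nat}.

Lemma sum_sq_le (a : 'I_N -> R) : (\sum_i a i) ^+ 2 <= N%:R * \sum_i a i ^+ 2.
Proof.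
have h : \sum_i \sum_j (a i * a j) <= \sum_(i < N) \sum_(j < N) ((a i ^+ 2 + a j ^+ 2) / 2).
  apply: ler_sum => i _; apply: ler_sum => j _.
  by have := sqr_ge0 (a i - a j); lra.
have -> : (\sum_i a i) ^+ 2 = \sum_i \sum_j (a i * a j).
  by rewrite expr2 mulr_suml; apply: eq_bigr => i _; rewrite mulr_sumr.
apply: (le_trans h); rewrite le_eqVlt; apply/orP; left; apply/eqP.
have e1 : \sum_(i < N) \sum_(j < N) (a i ^+ 2 / 2) = N%:R * (\sum_i a i ^+ 2) / 2.
  under eq_bigr do rewrite sumr_const card_ord.
  by rewrite sumrMnl -mulr_suml -[LHS]mulr_natl mulrA.
have e2 : \sum_(i < N) \sum_(j < N) (a j ^+ 2 / 2) = N%:R * (\sum_i a i ^+ 2) / 2.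
  by rewrite exchange_big.
under eq_bigr do under eq_bigr do rewrite mulrDl.
under eq_bigr do rewrite big_split /=.
by rewrite big_split /= e1 e2; field.
Qed.

End sums.

Section leb_instance.
Context {R : realType} {N : nat}.
HB.instance Definition _ :=
  Measure_isSigmaFinite.Build _ (lebT R N) R (@leb R N) (@leb_sigma_finite R N).
End leb_instance.

Lemma ge0_le_integralT d (T : measurableType d) (R : realType)
    (mu : {measure set T -> \bar R}) (f1 f2 : T -> \bar R) :
  (forall x, 0 <= f1 x)%E -> measurable_fun setT f1 -> measurable_fun setT f2 ->
  (forall x, f1 x <= f2 x)%E -> (\int[mu]_x f1 x <= \int[mu]_x f2 x)%E.
Proof. by move=> f10 mf1 mf2 f12; apply: ge0_le_integral. Qed.

Section poincare.
Context {R : realType} {N : nat}.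
Notation V := 'rV[R]_N.
Notation T := (lebT R N).
Notation mu := (@leb R N).
Implicit Types (S B Q : set V) (u : V -> R) (g : 'I_N -> V -> R) (e h k x y : V).

(** Boxes are handled through coordinates. For an arbitrary Lebesgue null set the
    preimage under addition need not be measurable in the product sigma-algebra. *)
Lemma measurable_sum_box (F : nat -> option (V * V)) :
  measurable ([set z | (\bigcup_k box (F k)) (z.2 + z.1)] : set (T * T)).
Proof.
have -> : [set z : T * T | (\bigcup_k box (F k)) ((z.2 : V) + z.1)] =
    \bigcup_k [set z : T * T | box (F k) ((z.2 : V) + z.1)].
  by apply/seteqP; split=> z [k _ h]; exists k.
apply: bigcupT_measurable => k; case: (F k) => [[a b]|] /=; last first.
  by rewrite (_ : [set _ | _] = set0)//; apply/seteqP; split.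
have -> : [set z : T * T | forall i, a 0 i < ((z.2 : V) + z.1) 0 i /\
      ((z.2 : V) + z.1) 0 i <= b 0 i] =
    \bigcap_(i in [set: 'I_N])
      ((fun z : T * T => (z.2 : V) 0 i + (z.1 : V) 0 i) @^-1` `]a 0 i, b 0 i]).
  apply/seteqP; split=> z /= h i.
    by move=> _ /=; have [] := h i; rewrite mxE in_itv /= => -> ->.
  by have := h i I; rewrite /= in_itv/= mxE => /andP[].
apply: fin_bigcap_measurable => // i _.
have mf : measurable_fun [set: T * T] (fun z : T * T => (z.2 : V) 0 i + (z.1 : V) 0 i : R).
  apply: measurable_funD.
    exact: (measurableT_comp (mf_coord i) measurable_snd).
  exact: (measurableT_comp (mf_coord i) measurable_fst).
by rewrite -[X in measurable X]setTI; exact: mf.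
Qed.

(** By Tonelli, the average over [k] in [Q] of the mass of [u] on the translate of [B]
    by [- k] is at most the total mass times the measure of [B] over that of [Q]. *)
Lemma mass_escapes (F : nat -> option (V * V)) Q u (q : R) : let B := \bigcup_k box (F k) in
  (mu B < +oo)%E -> Lset Q -> mu Q = q%:E -> 4 * fine (mu B) < q -> Lsq u ->
  0 < Lint (fun x => u x ^+ 2) ->
  exists2 k, Q k & Lint (fun y => \1_B (y + k) * u y ^+ 2) <= 4^-1 * Lint (fun y => u y ^+ 2).
Proof.
move=> B Boo mQ Qq Bq su I0; set I := Lint _ in I0 *.
have mB : Lset B by apply: Lset_bigcup => k; exact: Lset_box.
apply: contrapT => noQ.
have big k : Q k -> 4^-1 * I <= Lint (fun y => \1_B (y + k) * u y ^+ 2).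
  move=> Qk; rewrite leNgt; apply/negP => h; apply: noQ; exists k => //; exact: ltW.
have ui := Lsq_summable su.
have mBk k : Lmeas (fun y => \1_B (y + k)).
  exact: (Lmeas_shift k (Lmeas_indic mB)).
have B1 x : `|\1_B x : R| <= 1 by have /andP[? ?] := indic01 B x; rewrite ger0_norm.
have Bi k : Lsummable (fun y => \1_B (y + k) * u y ^+ 2).
  by apply: (Lsummable_bdM (mBk k) (c := 1) _ ui) => x; exact: B1.
pose G (z : T * T) := (\1_Q z.1 * (\1_B ((z.2 : V) + z.1) * u z.2 ^+ 2))%:E.
have G0 z : (0 <= G z)%E.
  have /andP[h1 _] := indic01 Q z.1; have /andP[h2 _] := indic01 B ((z.2 : V) + z.1).
  by rewrite lee_fin; apply: mulr_ge0 => //; apply: mulr_ge0 => //; exact: sqr_ge0.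
have mG : measurable_fun [set: T * T] G.
  apply/measurable_EFinP; apply: measurable_funM.
    exact: (measurableT_comp (measurable_indic ((LsetP _).1 mQ)) measurable_fst).
  apply: measurable_funM.
    have -> : (fun z : T * T => \1_B ((z.2 : V) + z.1) : R) =
        \1_[set z : T * T | B ((z.2 : V) + z.1)].
      by apply/funext => z; rewrite !indicE; congr (nat_of_bool _)%:R; apply/idP/idP;
        rewrite !in_setE.
    by apply: measurable_indic; exact: measurable_sum_box.
  by apply: measurable_funX; exact: (measurableT_comp ((LmeasP _).1 (Lsq_mf su)) measurable_snd).
have drop_factor (x y z : R) : 0 <= x <= 1 -> 0 <= y -> 0 <= z -> x * (y * z) <= z * y.
  by move=> /andP[x0 x1] y0 z0; rewrite [leRHS]mulrC ler_piMl// mulr_ge0.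
have tonelli := @fubini_tonelli _ _ T T R mu mu G mG G0.
have lower : ((4^-1 * I * q)%:E <= \int[mu]_k \int[mu]_y G (k, y))%E.
  have mF := @measurable_fun_fubini_tonelli_F _ _ T T R mu G mG G0.
  have -> : (4^-1 * I * q)%:E = (\int[mu]_k (4^-1 * I * \1_Q k)%:E)%E.
    have Qoo : (mu Q < +oo)%E by rewrite Qq ltry.
    have iQ := Lsummable_indic mQ Qoo.
    rewrite -LEFin_int; last exact: LsummableZ.
    by rewrite (LintZ _ iQ) [RHS]EFinM (EFin_Lint_indic mQ Qoo) Qq -EFinM.
  refine (@ge0_le_integralT _ T R mu _ _ _ _ mF _).
  - move=> k; rewrite lee_fin; have /andP[h _] := indic01 Q k.
    have c0 : 0 <= 4^-1 * I by rewrite mulr_ge0 ?(ltW I0)// invr_ge0.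
    exact: mulr_ge0 c0 h.
  - apply/measurable_EFinP/(measurable_funM (measurable_cst _)).
    exact: (measurable_indic ((LsetP _).1 mQ)).
  move=> k; rewrite /fubini_F; have -> : (\int[mu]_y G (k, y))%E =
      (\1_Q k * Lint (fun y => \1_B (y + k) * u y ^+ 2))%:E.
    by rewrite -(LintZ _ (Bi k)) LEFin_int; [by []|exact: LsummableZ].
  rewrite lee_fin mulrC indicE; case: (boolP (k \in Q)) => [|_]; last by rewrite !mul0r.
  by rewrite in_setE !mul1r; exact: big.
have upper : (\int[mu]_y \int[mu]_k G (k, y) <= (fine (mu B) * I)%:E)%E.
  rewrite -(LintZ _ ui) LEFin_int; last exact: LsummableZ.
  have mF := @measurable_fun_fubini_tonelli_G _ _ T T R mu G mG G0.
  refine (@ge0_le_integralT _ T R mu _ _ _ mF _ _).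
  - by move=> y; apply: integral_ge0.
  - apply/measurable_EFinP/(measurable_funM (measurable_cst _)).
    exact/LmeasP/(Lsummable_mf ui).
  move=> y; rewrite /fubini_G; have iB := Lsummable_indic mB Boo.
  have iBy : Lsummable (fun k => \1_B (k + y)) by exact: Lsummable_shift.
  have -> : fine (mu B) = Lint (fun k => \1_B (k + y)).
    by rewrite (Lint_shift _ iB) -(EFin_Lint_indic mB Boo).
  rewrite mulrC -(LintZ _ iBy) LEFin_int; last exact: LsummableZ.
  refine (@ge0_le_integralT _ T R mu _ _ _ _ _ _).
  - by move=> k; exact: G0.
  - apply/measurable_EFinP/LmeasP; rewrite /=.
    apply: LmeasM; first exact: Lmeas_indic.
    apply: LmeasM; last exact: Lmeas_cst.
    have := Lmeas_shift y (Lmeas_indic mB); congr Lmeas; apply/funext => k.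
    by rewrite addrC.
  - by apply/measurable_EFinP/LmeasP; exact: (LmeasM (Lmeas_cst _) (Lsummable_mf iBy)).
  move=> k; rewrite /G /= lee_fin [X in _ * (X * _)](_ : _ = \1_B (k + y)); last by rewrite addrC.
  have h1 := indic01 Q k; have /andP[h3 h4] := indic01 B (k + y); have h5 := sqr_ge0 (u y).
  exact: drop_factor.
have h : 4^-1 * q <= fine (mu B).
  have := le_trans lower (eq_ind_r (fun z => z <= _)%E upper tonelli).
  by rewrite lee_fin mulrAC (ler_pM2r I0).
move: h; by move: (fine (mu B)) Bq => b Bq h; clear -Bq h; lra.
Qed.

(** Some translation in the solid cone moves most of the mass of [u] off its carrier,
    and the cost of that translation is controlled by the gradient. *)
Lemma poincare S (F : nat -> option (V * V)) e (rho : R) :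
  open S -> 0 < rho -> (0 < N)%N ->
  (forall x h s, S x -> `|h - e| < rho -> 0 <= s -> S (x + s *: h)) ->
  (0 < @leb_outer R N setT)%E -> (mu (\bigcup_k box (F k)) < +oo)%E ->
  exists2 C, 0 < C & forall u g, H1ext S u g ->
    (forall x, ~ (\bigcup_k box (F k)) x -> u x = 0) ->
    Lint (fun x => u x ^+ 2) <= C * Lint (fun x => \sum_i g i x ^+ 2).
Proof.
move=> oS rho0 N0 SC muT; set B := \bigcup_k _ => Boo.
pose Q0 : set V := [set k | `|k - - e| < rho].
have mQ0 : Lset Q0 by exact: Lset_ball.
have Q0oo : (mu Q0 < +oo)%E by exact: leb_ball_lty.
have Q0gt : (0 < mu Q0)%E.
  apply: leb_open_gt0 => //; last by exists (- e); rewrite /Q0 /= subrr normr0.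
  have -> : Q0 = enlarge [set - e] rho.
    by apply/seteqP; split=> x; [exists (- e)|move=> [_ ->]].
  exact: open_enlarge.
pose c := fine (mu Q0).
have cE : mu Q0 = c%:E by rewrite fineK// ge0_fin_numE// ltW.
have c0 : 0 < c by rewrite -lte_fin -cE.
pose b := fine (mu B); have b0 : 0 <= b by exact: fine_ge0.
(* A dilation factor that makes the ball of translations large compared with [B]. *)
pose t := Num.max 1 ((4 * b + 1) / c).
have t1 : 1 <= t by rewrite le_max lexx.
have t0 : 0 < t by exact: lt_le_trans t1.
pose Q : set V := dilate t^-1 0 @^-1` Q0.
have QE k : Q k -> `|- k - t *: e| < t * rho.
  rewrite /Q /Q0 /= /dilate addr0 opprK => h.
  have -> : - k - t *: e = - (t *: (t^-1 *: k + e)).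
    by rewrite scalerDr scalerA divff ?gt_eqF// scale1r opprD.
  by rewrite normrN normrZ gtr0_norm// ltr_pM2l.
have Qq : mu Q = (t ^+ N * c)%:E.
  have := @leb_outer_dilate R N t^-1 0 Q0; rewrite invr_gt0 invrK => /(_ t0) h.
  by rewrite [LHS]h EFinM -cE.
have mQ : Lset Q.
  have ti : 0 < t^-1 by rewrite invr_gt0.
  apply/LsetP; have := dilate_measurable 0 ti measurableT ((LsetP _).1 mQ0).
  by rewrite setTI.
have bq : 4 * fine (mu B) < t ^+ N * c.
  have h1 : t <= t ^+ N by rewrite -(prednK N0) ler_eXnr.
  have h2 : (4 * b + 1) / c <= t by rewrite le_max lexx orbT.
  rewrite ler_pdivrMr// in h2; rewrite -/b.
  by have := ler_wpM2r (ltW c0) h1; lra.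
pose H := t * rho + t * `|e|.
have H0 : 0 < H by rewrite ltr_pwDl ?mulr_gt0// mulr_ge0// ltW.
exists (4 * N%:R * H ^+ 2); first by rewrite !mulr_gt0 ?ltr0n// exprn_gt0.
move=> u g ug uB; have [su sg u0 g0 _] := ug.
have sgi : Lsummable (fun x => \sum_i g i x ^+ 2).
  by apply: Lsummable_sum => i; exact: Lsq_summable.
have gI0 : 0 <= Lint (fun x => \sum_i g i x ^+ 2).
  by apply: Lint_ge0 => x; apply: sumr_ge0 => i _; exact: sqr_ge0.
have [I0|I0] := leP (Lint (fun x => u x ^+ 2)) 0.
  by apply: (le_trans I0); rewrite mulr_ge0// !mulr_ge0 ?sqr_ge0// ltW.
have [k Qk kI] := mass_escapes Boo mQ Qq bq su I0.
pose h := - k.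
have hH : `|h| <= H.
  have := ler_normD (h - t *: e) (t *: e); rewrite subrK normrZ (gtr0_norm t0).
  by have := QE _ Qk; rewrite -/h /H => *; lra.
have Sh s x : 0 <= s <= 1 -> S x -> S (x + s *: h).
  move=> /andP[s0 _] Sx; have -> : s *: h = (s * t) *: (t^-1 *: h).
    by rewrite scalerA -mulrA divff ?gt_eqF// mulr1.
  apply: SC => //; last by rewrite mulr_ge0// ltW.
  have -> : t^-1 *: h - e = t^-1 *: (h - t *: e).
    by rewrite scalerBr scalerA mulVf ?gt_eqF// scale1r.
  rewrite normrZ gtr0_norm ?invr_gt0// mulrC ltr_pdivrMr// mulrC.
  exact: QE.
have diff := int_diff_sq_le ug oS Sh.
have mB : Lset B by apply: Lset_bigcup => j; exact: Lset_box.
have sh := Lsq_shift h su.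
have B1 x : `|\1_B x : R| <= 1 by have /andP[? ?] := indic01 B x; rewrite ger0_norm.
have sBu : Lsq (fun x => \1_B x * u (x + h)) := Lsq_bdM (Lmeas_indic mB) B1 sh.
have sd : Lsq (fun x => \1_S x * (u (x + h) - u x)).
  by apply: Lsq_indicM; [exact: Lset_open|exact: LsqB].
have shiftE : Lint (fun x => (\1_B x * u (x + h)) ^+ 2) = Lint (fun y => \1_B (y + k) * u y ^+ 2).
  have sB2 : Lsummable (fun y => \1_B (y + k) * u y ^+ 2).
    apply: (Lsummable_bdM (c := 1) _ _ (Lsq_summable su)).
      exact: (Lmeas_shift k (Lmeas_indic mB)).
    by move=> y; exact: B1.
  rewrite -(Lint_shift h sB2); apply: Lint_ext => x; rewrite /h subrK exprMn; congr (_ * _).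
  by rewrite indicE; case: (x \in B); rewrite ?expr1n ?expr0n.
have e1 : Lint (fun x => u x ^+ 2) <= 2 * Lint (fun x => (\1_B x * u (x + h)) ^+ 2) +
    2 * Lint (fun x => (\1_S x * (u (x + h) - u x)) ^+ 2).
  have i1 := LsummableZ 2 (Lsq_summable sBu); have i2 := LsummableZ 2 (Lsq_summable sd).
  rewrite -(LintZ _ (Lsq_summable sBu)) -(LintZ _ (Lsq_summable sd)) -(LintD i1 i2).
  apply: (Lle_int (Lsq_summable su) (LsummableD i1 i2)); apply: LaeW => x.
  have rhs0 : 0 <= 2 * (\1_B x * u (x + h)) ^+ 2 + 2 * (\1_S x * (u (x + h) - u x)) ^+ 2.
    by apply: addr_ge0; apply: mulr_ge0 => //; exact: sqr_ge0.
  have [Sx|nSx] := pselect (S x); last by apply: le_trans rhs0; rewrite u0// expr0n.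
  have [Bx|nBx] := pselect (B x); last by apply: le_trans rhs0; rewrite uB// expr0n.
  rewrite !indicE !mem_set// !mul1r.
  by have := sqr_ge0 (2 * u (x + h) - u x); nra.
have e2 : Lint (fun x => dirsum h g x ^+ 2) <= N%:R * H ^+ 2 * Lint (fun x => \sum_i g i x ^+ 2).
  rewrite -(LintZ _ sgi); apply: Lle_int.
  - by apply: Lsq_summable; exact: dirsum_Lsq.
  - exact: LsummableZ.
  apply: LaeW => x; apply: (le_trans (sum_sq_le _)); rewrite -mulrA ler_wpM2l//.
  rewrite mulr_sumr; apply: ler_sum => i _; rewrite exprMn ler_wpM2r ?sqr_ge0//.
  rewrite -[h 0 i ^+ 2]real_normK ?num_real// lerXn2r ?nnegrE ?(ltW H0)//.
  exact: le_trans (coord_le_normv _ _) hH.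
move: e1 e2 diff kI; rewrite shiftE.
move: (Lint (fun x => u x ^+ 2)) (Lint (fun y => \1_B (y + k) * u y ^+ 2)).
move: (Lint (fun x => \sum_i g i x ^+ 2)) (Lint (fun x => dirsum h g x ^+ 2)).
move: (Lint (fun x => (\1_S x * (u (x + h) - u x)) ^+ 2)) => D G X I J.
have -> : 4 * N%:R * H ^+ 2 * G = 4 * (N%:R * H ^+ 2 * G) by ring.
by move: (N%:R * H ^+ 2 * G) => Y; clear; lra.
Qed.

End poincare.

Lemma continuous_compose (T U W : topologicalType) (f : T -> U) (g : U -> W) :
  continuous f -> continuous g -> continuous (fun x => g (f x)).
Proof. by move=> cf cg x; exact: (continuous_comp (cf x) (cg _)). Qed.

Section continuity.
Context {R : realType} (T : topologicalType).
Implicit Types f g : T -> R.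

Lemma continuous_mul f g : continuous f -> continuous g -> continuous (fun x => f x * g x).
Proof. by move=> cf cg x; apply: cvgM; [exact: cf|exact: cg]. Qed.

Lemma continuous_add f g : continuous f -> continuous g -> continuous (fun x => f x + g x).
Proof. by move=> cf cg x; apply: cvgD; [exact: cf|exact: cg]. Qed.

Lemma continuous_sub f g : continuous f -> continuous g -> continuous (fun x => f x - g x).
Proof. by move=> cf cg x; apply: cvgB; [exact: cf|exact: cg]. Qed.

Lemma continuous_sum (I : Type) (s : seq I) (F : I -> T -> R) :
  (forall i, continuous (F i)) -> continuous (fun x => \sum_(i <- s) F i x).
Proof.
move=> cF; elim: s => [|i s IH].
  by under eq_fun do rewrite big_nil; exact: cst_continuous.
under eq_fun do rewrite big_cons.
by move=> x; apply: cvgD; [exact: cF|exact: IH].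
Qed.

End continuity.

Section cone_translations.
Context {R : realType} {N : nat}.
Notation V := 'rV[R]_N.
Implicit Types (D S : set V) (e h x y : V).

Lemma dotDl x y e : dot (x + y) e = dot x e + dot y e.
Proof. by rewrite -big_split; apply: eq_bigr => i _; rewrite mxE mulrDl. Qed.

Lemma dotZl (s : R) x e : dot (s *: x) e = s * dot x e.
Proof. by rewrite /dot mulr_sumr; apply: eq_bigr => i _; rewrite mxE mulrA. Qed.

Lemma dotC x y : dot x y = dot y x.
Proof. by apply: eq_bigr => i _; rewrite mulrC. Qed.

Lemma dotNl x e : dot (- x) e = - dot x e.
Proof. by rewrite -scaleN1r dotZl mulN1r. Qed.

Lemma dot_ge0 x : 0 <= dot x x.
Proof. by apply: sumr_ge0 => i _; rewrite -expr2 sqr_ge0. Qed.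

Lemma enormZ (s : R) x : enorm (s *: x) = `|s| * enorm x.
Proof.
by rewrite /enorm dotZl dotC dotZl mulrA -expr2 sqrtrM ?sqr_ge0// sqrtr_sqr.
Qed.

Lemma enorm_ge0 x : 0 <= enorm x. Proof. exact: sqrtr_ge0. Qed.

Lemma dot_continuous (f g : V -> V) : continuous f -> continuous g ->
  continuous (fun x => dot (f x) (g x)).
Proof.
move=> cf cg; apply: continuous_sum => i; apply: continuous_mul.
  exact: (continuous_compose cf (@coord_continuous _ _ _ _ _)).
exact: (continuous_compose cg (@coord_continuous _ _ _ _ _)).
Qed.

Lemma cone_scale D (s : R) x : 0 < s -> cone D x -> cone D (s *: x).
Proof.
move=> s0 [r [q [r0 Dq ->]]]; exists (s * r), q; split=> //; first exact: mulr_gt0.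
by rewrite scalerA.
Qed.

Lemma cone_scaleP D (s : R) x : 0 < s -> cone D (s *: x) -> cone D x.
Proof.
move=> s0 /(@cone_scale D s^-1); rewrite invr_gt0 scalerA mulVf ?gt_eqF// scale1r.
exact.
Qed.

Lemma cone_not0 D : D `<=` usphere -> ~ cone D (0 : V).
Proof.
move=> Ds [r [q [r0 /Ds qs /eqP]]]; rewrite eq_sym scaler_eq0 (gt_eqF r0) /= => /eqP q0.
move: qs; rewrite /usphere /= q0 /enorm -(scale0r (0 : V)) dotZl mul0r sqrtr0.
by move/eqP; rewrite eq_sym oner_eq0.
Qed.

Lemma cone_vertex D : D `<=` usphere -> cone D !=set0 ->
  (closure (cone D) `\` interior (cone D)) (0 : V).
Proof.
move=> Ds [x Dx]; split; last by move=> /interior_subset; exact: cone_not0.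
move=> U /nbhs_ballP[d /= d0 dU]; pose s := d / 2 / (`|x| + 1).
have x1 : 0 < `|x| + 1 by rewrite ltr_wpDl.
have s0 : 0 < s by rewrite !divr_gt0.
exists (s *: x); split; first exact: cone_scale.
apply: dU; rewrite -ball_normE /= sub0r normrN normrZ gtr0_norm//.
rewrite /s mulrAC ltr_pdivrMr// mulrAC -mulrA ltr_pM2l//.
by have := normr_ge0 x; lra.
Qed.

(** The Lipschitz graph condition at the vertex involves a fixed ball only, but any two
    points of the cone can be dilated into it: a solid cone of directions around [e]
    therefore leads from [S] into [S]. *)
Lemma cone_translations D : D `<=` usphere -> cone D !=set0 ->
  uniformly_lipschitz (cone D) -> exists e (rho : R), 0 < rho /\
  forall x h s, cone D x -> `|h - e| < rho -> 0 <= s -> cone D (x + s *: h).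
Proof.
move=> Ds D0 [r [L [r0 lip]]]; have [e [f [e1 fL graph]]] := lip _ (cone_vertex Ds D0).
have ee : dot e e = 1 by rewrite -(sqr_sqrtr (dot_ge0 e)) -/(enorm e) e1 expr1n.
pose flat x := x - dot x e *: e.
(* [flat] is the orthogonal projection onto the hyperplane of the graph. *)
have flat_dot x : dot (flat x) e = 0 by rewrite /flat dotDl dotNl dotZl ee mulr1 subrr.
have flatD x y : flat (x + y) = flat x + flat y.
  by rewrite /flat dotDl scalerDl opprD addrACA.
have flatZ s x : flat (s *: x) = s *: flat x.
  by rewrite /flat dotZl -scalerA -scalerBr.
pose gap h := dot h e - `|L| * enorm (flat h).
have cgap : continuous gap.
  have cd : continuous (fun h => dot h e).
    have ci : continuous (id : V -> V) by move=> y; exact: cvg_id.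
    have ce : continuous ((fun=> e) : V -> V) by exact: cst_continuous.
    exact: (dot_continuous ci ce).
  apply: continuous_sub => //; apply: continuous_mul; first exact: cst_continuous.
  have ci : continuous (id : V -> V) by move=> y; exact: cvg_id.
  have -> : (fun h => enorm (flat h)) = (fun h => Num.sqrt (dot h h - dot h e * dot h e)).
    apply/funext => h; congr Num.sqrt; rewrite {1}/flat dotDl dotNl dotZl.
    rewrite [dot e _]dotC flat_dot mulr0 subr0 dotC /flat dotDl dotNl dotZl.
    by rewrite [dot e h]dotC.
  apply: (@continuous_compose _ _ _ (fun h => dot h h - dot h e * dot h e)).
    apply: continuous_sub; first exact: (dot_continuous ci ci).
    by apply: continuous_mul.
  exact: sqrt_continuous.
have gape : gap e = 1.
  rewrite /gap /flat ee scale1r subrr /enorm -(scale0r (0 : V)) dotZl mul0r sqrtr0.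
  by rewrite mulr0 subr0.
have stable x h : cone D x -> 0 < gap h -> cone D (x + h).
  (* [r / M] dilates both [x] and [x + h] into the ball of radius [r]. *)
  move=> Dx gh; pose M := enorm x + enorm (x + h) + 1.
  have M0 : 0 < M by rewrite ltr_wpDl// addr_ge0 ?enorm_ge0.
  pose s := r / M; have s0 : 0 < s by exact: divr_gt0.
  have in_ball y : enorm y < M -> eball 0 r (s *: y).
    move=> yM; rewrite /eball /= subr0 enormZ (gtr0_norm s0) /s mulrAC ltr_pdivrMr//.
    by rewrite ltr_pM2l.
  have inS y : enorm y < M -> cone D (s *: y) <-> f (flat (s *: y)) < dot (s *: y) e.
    move=> /in_ball yb.
    have : (cone D `&` eball 0 r) (s *: y) <->
      (eball 0 r `&` [set y | f (y - dot y e *: e) < dot y e]) (s *: y) by rewrite graph.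
    by move=> [h1 h2]; split=> h3; [have [] := h1 (conj h3 yb)|have [] := h2 (conj yb h3)].
  have xM : enorm x < M by have := enorm_ge0 (x + h); rewrite /M; lra.
  have xhM : enorm (x + h) < M by have := enorm_ge0 x; rewrite /M; lra.
  apply: (cone_scaleP s0); apply/(inS _ xhM).
  have fx := (inS _ xM).1 (cone_scale s0 Dx).
  have := fL (flat (s *: (x + h))) (flat (s *: x)) (flat_dot _) (flat_dot _).
  rewrite [s *: (x + h)]scalerDr flatD [flat _ + _]addrC addrK flatZ enormZ (gtr0_norm s0).
  move=> /(le_trans (ler_norm _)) h1.
  have h2 : L * (s * enorm (flat h)) <= s * (`|L| * enorm (flat h)).
    rewrite mulrCA ler_wpM2l ?(ltW s0)// ler_wpM2r ?enorm_ge0//; exact: ler_norm.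
  have h3 : s * (`|L| * enorm (flat h)) < s * dot h e.
    by rewrite ltr_pM2l// -subr_gt0.
  by rewrite dotDl [dot (s *: h) e]dotZl; lra.
have /nbhs_ballP[rho /= rho0 rhoP] : nbhs e [set h | 0 < gap h].
  apply: (cgap e [set y | 0 < y]); rewrite gape; apply: open_nbhs_nbhs.
  by split; [exact: open_gt|exact: ltr01].
exists e, rho; split=> // x h s Dx he; rewrite le_eqVlt => /predU1P[<-|s0].
  by rewrite scale0r addr0.
apply: stable => //; rewrite /gap flatZ dotZl enormZ (gtr0_norm s0) mulrCA -mulrBr mulr_gt0//.
by apply: rhoP; rewrite -ball_normE /= distrC.
Qed.

End cone_translations.

(** * Dilations *)

Lemma continuous_scale (K : numFieldType) (W : normedModType K) (r : K) :
  continuous (fun x : W => r *: x).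
Proof. by move=> x; apply: cvgZl_tmp; exact: cvg_id. Qed.

Lemma within_continuous_comp (T U W : topologicalType) (f : T -> U) (h : U -> W)
    (A : set T) (B : set U) : continuous f -> (forall x, A x -> B (f x)) ->
  {within B, continuous h} -> {within A, continuous (fun x => h (f x))}.
Proof.
move=> cf AB ch; apply/subspace_continuousP => p Ap.
have [ch' _] := subspace_continuousP B h.
move=> Z hZ; have h1 := ch' ch _ (AB _ Ap) Z hZ.
have h2 : nbhs p (f @^-1` [set y | B y -> Z (h y)]) := cf p _ h1.
have h3 : nbhs p [set x | A x -> Z (h (f x))].
  by apply: filterS h2 => x hx Ax; apply: hx; exact: AB.
exact: h3.
Qed.

Section dilations.
Context {R : realType} {N : nat}.
Notation V := 'rV[R]_N.
Notation mu := (@leb R N).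
Implicit Types (u v : V -> R) (g gam : 'I_N -> V -> R) (A S E : set V) (x y : V).

Lemma is_derive_scale (f : V -> R) (r : R) (v x : V) : r != 0 -> derivable f (r *: x) v ->
  is_derive x v (fun x => f (r *: x)) (r * 'D_v f (r *: x)).
Proof.
move=> r0 /cvgr_dnbhsP df.
pose q h : R := h^-1 *: (((fun x => f (r *: x)) \o shift x) (h *: v) - f (r *: x)).
have ql : q @ (0 : R)^' --> r * 'D_v f (r *: x).
  apply/cvgr_dnbhsP => w [wn0 w0].
  have wr0 n : r * w n != 0 by rewrite mulf_neq0.
  have wrl : (fun n => r * w n) @ \oo --> (0 : R).
    by rewrite -[X in _ --> X](mulr0 r); apply: cvgM => //; exact: cvg_cst.
  have h := df (fun n => r * w n) (conj wr0 wrl).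
  have -> : (fun n => q (w n)) = (fun n => r * ((r * w n)^-1 *:
      ((f \o shift (r *: x)) ((r * w n) *: v) - f (r *: x)))).
    apply/funext => n; rewrite /q /= [r *: (_ + _)]scalerDr scalerA /GRing.scale /=.
    by rewrite invfM mulrA mulrA divff// mul1r.
  by apply: cvgM; [exact: cvg_cst|exact: h].
by split; [apply/cvg_ex; exists (r * 'D_v f (r *: x))|apply/cvg_lim].
Qed.

Lemma class_C_scale k (f : V -> R) (r c : R) : r != 0 -> class_C k f ->
  class_C k (fun x => c * f (r *: x)).
Proof.
move=> r0; have cr : continuous (fun x : V => r *: x).
  exact: continuous_scale.
have cc (h : V -> R) (a : R) : continuous h -> continuous (fun x => a * h (r *: x)).
  by move=> ch; apply: continuous_mul; [exact: cst_continuous|exact: (continuous_compose cr ch)].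
elim: k f c => [|k IH] f c /=; first exact: cc.
move=> [cf df]; split; first exact: cc.
move=> i; have [di Ci] := df i.
have dfi x := is_derive_scale r0 (di (r *: x)).
have dci x : is_derive x (unit_vec i) (fun x => c * f (r *: x))
    (c * (r * 'D_(unit_vec i) f (r *: x))).
  exact: (is_deriveZ c (dfi x)).
split=> [x|]; first by have [] := dci x.
have -> : (fun x => 'D_(unit_vec i) (fun x => c * f (r *: x)) x) =
    (fun x => (c * r) * 'D_(unit_vec i) f (r *: x)).
  by apply/funext => x; have [_ ->] := dci x; rewrite mulrA.
exact: (IH (fun x => 'D_(unit_vec i) f x) (c * r) Ci).
Qed.

Variable s : R.
Hypothesis s0 : 0 < s.

Let sn0 : s != 0. Proof. by rewrite gt_eqF. Qed.
Let si0 : s^-1 != 0. Proof. by rewrite invr_eq0. Qed.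

Lemma test_function_scale S (phi : V -> R) : test_function [set x | S (s *: x)] phi ->
  test_function S (fun y => phi (s^-1 *: y)).
Proof.
move=> [sphi [K [cK KS phi0]]]; split.
  move=> k; have := class_C_scale 1 si0 (sphi k); congr class_C.
  by apply/funext => y; rewrite mul1r.
exists [set s *: x | x in K]; split.
- apply: continuous_compact => //; apply: continuous_subspaceT; exact: continuous_scale.
- by move=> _ [x Kx <-]; exact: KS.
- move=> y nKy; apply: phi0 => Ky; apply: nKy; exists (s^-1 *: y) => //.
  by rewrite scalerA divff// scale1r.
Qed.

Lemma H1ext_scale S u g : H1ext S u g ->
  H1ext [set x | S (s *: x)] (fun x => u (s *: x)) (fun i x => s * g i (s *: x)).
Proof.
move=> [su sg u0 g0 wg].
split; [exact: Lsq_scale|by move=> i; exact/LsqZ/Lsq_scale|by move=> x /u0| |].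
  by move=> i x /g0 ->; rewrite mulr0.
move=> i phi tphi; pose psi y := phi (s^-1 *: y).
have tpsi : test_function S psi by exact: test_function_scale.
have dphi x : derivable phi x (unit_vec i) by have [_ /(_ i)[]] := tphi.1 1%N.
have dpsi y : 'D_(unit_vec i) psi y = s^-1 * 'D_(unit_vec i) phi (s^-1 *: y).
  by have [_ ->] := is_derive_scale si0 (dphi (s^-1 *: y)).
have sK (x : V) : s^-1 *: (s *: x) = x by rewrite scalerA mulVf// scale1r.
have i1 := LsqM su (test_derive_Lsq i tpsi); have i2 := LsqM (sg i) (test_Lsq tpsi).
have -> : Lint (fun x => u (s *: x) * 'D_(unit_vec i) phi x) =
    s * Lint (fun x => u (s *: x) * 'D_(unit_vec i) psi (s *: x)).
  rewrite -(LintZ _ (Lsummable_scale s0 i1)); apply: Lint_ext => x.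
  by rewrite dpsi sK; field.
have -> : Lint (fun x => s * g i (s *: x) * phi x) =
    s * Lint (fun x => g i (s *: x) * psi (s *: x)).
  rewrite -(LintZ _ (Lsummable_scale s0 i2)); apply: Lint_ext => x.
  by rewrite /psi sK mulrA.
by rewrite (Lint_scale s0 i1) (Lint_scale s0 i2) wg// !mulrN.
Qed.

Lemma open_scale A : open A -> open [set x : V | A (s *: x)].
Proof.
by move=> oA; have /continuousP := @continuous_scale R V s; apply.
Qed.

Lemma capped_scale : exists2 c, 0 < c & forall e E, capped e E ->
  capped (c * e) [set x : V | E (s *: x)].
Proof.
have c0 : 0 < s ^- N by rewrite invr_gt0 exprn_gt0.
have d0 : 0 < 1 + s ^+ 2 by rewrite ltr_pwDl ?sqr_ge0.
exists (s ^- N * (1 + s ^+ 2)) => [|e E]; first exact: mulr_gt0.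
move=> [U [v [gam [oU EU vg vU [h1 h2]]]]]; have [sv sg _ _ _] := vg.
have e0 : 0 <= e by exact: le_trans (Lint_sq_ge0 _) h1.
exists [set x | U (s *: x)], (fun x => v (s *: x)), (fun i x => s * gam i (s *: x)); split.
- exact: open_scale.
- by move=> x; exact: EU.
- exact: (H1ext_scale vg).
- exact: (Lae_scale s0 vU).
have key (a b : R) : 0 <= a <= e -> 0 <= b <= 1 + s ^+ 2 ->
    s ^- N * (b * a) <= s ^- N * (1 + s ^+ 2) * e.
  move=> /andP[a0 ae] /andP[b0 bs]; rewrite -mulrA; apply: ler_wpM2l; first exact: ltW.
  exact: ler_pM.
split=> [|i].
  rewrite (Lint_scale s0 (Lsq_summable sv)) -[Lint _]mul1r; apply: key.
    by rewrite Lint_sq_ge0.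
  by rewrite ler01 lerDl sqr_ge0.
have -> : Lint (fun x => (s * gam i (s *: x)) ^+ 2) =
   s ^- N * (s ^+ 2 * Lint (fun x => gam i x ^+ 2)).
  have i1 := Lsummable_scale s0 (Lsq_summable (sg i)).
  rewrite mulrCA -(Lint_scale s0 (Lsq_summable (sg i))) -(LintZ _ i1).
  by apply: Lint_ext => x; rewrite exprMn.
by apply: key; [rewrite Lint_sq_ge0 h2|rewrite sqr_ge0 lerDr ler01].
Qed.

Lemma H10_scale S A u (g : V -> V) : open S -> (forall x, S (s *: x) <-> S x) -> H10 S A u g ->
  H10 S [set x | A (s *: x)] (fun x => (u \_ S) (s *: x))
    (fun x => \row_i (s * extgrad S g i (s *: x))).
Proof.
move=> oS Ss [ug [ut [qut utu ut0]]].
have SE : [set x | S (s *: x)] = S by apply/seteqP; split=> x /Ss.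
have [c c0 cP] := capped_scale.
have capP (E : set V) : capacity E = 0%E -> capacity [set x : V | E (s *: x)] = 0%E.
  move=> /capacity0P h; apply/capacity0P => d d0.
  have dc : 0 < d / c by rewrite divr_gt0.
  by have := cP _ _ (h _ dc); rewrite mulrC divfK// gt_eqF.
have := H1ext_scale (H1_ext oS ug); rewrite SE => vg.
split; first exact: (ext_H1 oS vg).
exists (fun x => ut (s *: x)); split.
- move=> e e0; pose d := e / N.+1%:R / c / 2.
  have d0 : 0 < d by rewrite !divr_gt0.
  have [E [oE cE cut]] := qut d d0.
  exists [set x | E (s *: x)]; split; first exact: open_scale.
    have k1 : capped (2 * d) E.
      by apply: capacity_capped; apply: le_lt_trans cE _; rewrite lte_fin ltr_pMl// ltr1n.
    have := capped_capacity (cP _ _ k1).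
    by rewrite (_ : N.+1%:R * (c * (2 * d)) = e)// /d; field; rewrite gt_eqF//= addrC natr1 pnatr_eq0.
  apply: (within_continuous_comp (@continuous_scale R V s) _ cut) => x [Sx nEx].
  by split=> //; exact/Ss.
- apply/LaeP; have := Lae_scale s0 ((LaeP _).2 utu); apply: LaeS => x h Sx.
  by rewrite h; [rewrite patchE mem_set//; exact/Ss|exact/Ss].
- have := capP _ ut0; congr (capacity _ = _).
  by apply/seteqP; split=> x [[Sx nAx] h3]; (split; [split|]) => //; exact/Ss.
Qed.

End dilations.

(** * First eigenvalues *)

Section eigenvalues.
Context {R : realType} {N : nat}.
Notation V := 'rV[R]_N.
Notation mu := (@leb R N).
Implicit Types (u : V -> R) (g : V -> V) (A S O E : set V) (x y : V) (m : R).

Definition mass S u := Lint (fun x => (u \_ S) x ^+ 2).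
Definition dirichlet S E g := Lint (fun x => \1_E x * \sum_i extgrad S g i x ^+ 2).

Lemma dirichlet_summable S E u g : open S -> Lset E -> H1 S u g ->
  Lsummable (fun x => \1_E x * \sum_i extgrad S g i x ^+ 2).
Proof.
move=> oS mE ug; have [_ sg _ _ _] := H1_ext oS ug.
have sgi : Lsummable (fun x => \sum_i extgrad S g i x ^+ 2).
  by apply: Lsummable_sum => i; exact: (Lsq_summable (sg i)).
apply: (Lsummable_bdM (Lmeas_indic mE) (c := 1) _ sgi) => x.
by have /andP[? ?] := indic01 E x; rewrite ger0_norm.
Qed.

Lemma dirichlet_ge0 S E g : 0 <= dirichlet S E g.
Proof.
apply: Lint_ge0 => x; apply: mulr_ge0; first by have /andP[] := indic01 E x.
by apply: sumr_ge0 => i _; exact: sqr_ge0.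
Qed.

Lemma massE S u g : open S -> H1 S u g ->
  (\int[mu]_(x in S) (u x ^+ 2)%:E = (mass S u)%:E)%E.
Proof.
move=> oS ug; have [su _ u0 _ _] := H1_ext oS ug.
rewrite /mass -(@Lint_setE _ _ S _ (Lsq_summable su)) => [|x Sx]; last by rewrite u0// expr0n.
apply: eq_integral => x; rewrite in_setE => Sx; by rewrite patchE mem_set.
Qed.

Lemma dirichletE S E u g : open S -> Lset E -> E `<=` S -> H1 S u g ->
  (\int[mu]_(x in E) (dot (g x) (g x))%:E = (dirichlet S E g)%:E)%E.
Proof.
move=> oS mE ES ug.
rewrite /dirichlet -(@Lint_setE _ _ E _ (dirichlet_summable oS mE ug)) => [|x Ex]; last first.
  by rewrite indicE memNset// mul0r.
apply: eq_integral => x; rewrite in_setE => Ex; rewrite indicE mem_set// mul1r dot_sqE.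
by congr _%:E; apply: eq_bigr => i _; rewrite /extgrad patchE mem_set//; exact: ES.
Qed.

Lemma H10_scalar S A u g (c : R) : open S -> H10 S A u g ->
  H10 S A (fun x => c * (u \_ S) x) (fun x => \row_i (c * extgrad S g i x)).
Proof.
move=> oS [ug [ut [qut utu ut0]]]; have [su sg u0 g0 wg] := H1_ext oS ug.
split.
  apply: (@ext_H1 _ _ S _ (fun i x => c * extgrad S g i x) oS).
  split; [exact: LsqZ|by move=> i; exact: (LsqZ c (sg i))| | |].
  - by move=> x /u0 ->; rewrite mulr0.
  - by move=> i x Sx; rewrite /extgrad g0// mulr0.
  move=> i phi tphi; have := wg i phi tphi.
  have i1 := LsqM su (test_derive_Lsq i tphi); have i2 := LsqM (sg i) (test_Lsq tphi).
  move=> h; have -> : Lint (fun x => c * (u \_ S) x * 'D_(unit_vec i) phi x) =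
      c * Lint (fun x => (u \_ S) x * 'D_(unit_vec i) phi x).
    by rewrite -(LintZ _ i1); apply: Lint_ext => x; rewrite mulrA.
  rewrite h mulrN -(LintZ _ i2); congr (- _).
  by apply: Lint_ext => x; rewrite mulrA.
exists (fun x => c * ut x); split.
- move=> e e0; have [E [oE cE cut]] := qut e e0; exists E; split=> //.
  apply/subspace_continuousP => p pS.
  have [h _] := subspace_continuousP (S `\` E) ut.
  by apply: cvgM; [exact: cvg_cst|exact: (h cut p pS)].
- apply/LaeP; move/LaeP : utu; apply: LaeS => x h Sx.
  by rewrite h// patchE mem_set.
- have cmono (E F : set V) : E `<=` F -> capacity F = 0%E -> capacity E = 0%E.
    by move=> EF /capacity0P h; apply/capacity0P => e /h; exact: capped_mono.
  by apply: cmono ut0 => x [h1 h2]; split=> // h3; apply: h2; rewrite h3 mulr0.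
Qed.

Lemma lambda1_le S E u g : open S -> Lset E -> E `<=` S -> H10 S E u g ->
  0 < mass S u -> (lambda1 S E <= (dirichlet S E g / mass S u)%:E)%E.
Proof.
move=> oS mE ES ug a0; set a := mass S u in a0 *.
pose c := Num.sqrt a^-1; have c2 : c ^+ 2 = a^-1 by rewrite sqr_sqrtr// invr_ge0 ltW.
have cug := H10_scalar c oS ug; have [H _] := cug; have [Hu _] := ug.
have [su _ u0 _ _] := H1_ext oS Hu.
apply: ereal_inf_lbound.
exists (fun x => c * (u \_ S) x), (fun x => \row_i (c * extgrad S g i x)); split=> //.
- rewrite (massE oS H) -[1%E]/(1%:E); congr _%:E.
  rewrite -[RHS](mulVf (lt0r_neq0 a0)) -c2 /a -(LintZ _ (Lsq_summable su)).
  apply: Lint_ext => x; rewrite patchE; case: ifPn => [|/negP xS]; first by rewrite exprMn.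
  by rewrite u0 ?expr0n ?mulr0// => /mem_set.
- rewrite (dirichletE oS mE ES H); congr _%:E.
  rewrite mulrC -c2 -(LintZ _ (dirichlet_summable oS mE Hu)); apply: Lint_ext => x.
  rewrite mulrCA; congr (_ * _); rewrite mulr_sumr; apply: eq_bigr => i _.
  rewrite {2}/extgrad patchE; case: ifPn => [|xS]; first by rewrite mxE exprMn.
  by rewrite /extgrad patchE (negbTE xS) !expr0n mulr0.
Qed.

Lemma lambda1_lt S E (c : R) : open S -> Lset E -> E `<=` S ->
  (lambda1 S E < c%:E)%E -> exists u g,
  [/\ H10 S E u g, mass S u = 1 & dirichlet S E g < c].
Proof.
move=> oS mE ES /ereal_inf_lt[_ [u [g [ug u1 ->]]]] gc; exists u, g.
have [H _] := ug; split=> //.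
  by move: u1; rewrite (massE oS H) => -[].
by move: gc; rewrite (dirichletE oS mE ES H) lte_fin.
Qed.

Lemma lambda1_ge0 S E : (0 <= lambda1 S E)%E.
Proof.
apply: le_ereal_inf_tmp => _ [u [g [_ _ ->]]]; apply: integral_ge0 => x _.
by rewrite lee_fin dot_ge0.
Qed.

Lemma cone_open (D : set V) U : open U -> D = usphere `&` U -> open (cone D).
Proof.
move=> oU DU; have ci : continuous (id : V -> V) by move=> y; exact: cvg_id.
have ce : continuous (@enorm R N).
  apply: (@continuous_compose _ _ _ (fun x : V => dot x x)); last exact: sqrt_continuous.
  exact: (dot_continuous ci ci).
rewrite openE => x [r [q [r0 Dq xE]]].
have qs : enorm q = 1 by move: Dq; rewrite DU => -[].
have ex : enorm x = r by rewrite xE enormZ qs mulr1 gtr0_norm.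
pose P : set V := [set y | 0 < enorm y] `&` [set y | U ((enorm y)^-1 *: y)].
have PD : P `<=` cone D.
  move=> y [y0 Uy]; exists (enorm y), ((enorm y)^-1 *: y); split=> //; last first.
    by rewrite scalerA divff ?gt_eqF// scale1r.
  rewrite DU; split=> //; rewrite /usphere /= enormZ gtr0_norm ?invr_gt0//.
  by rewrite mulVf// gt_eqF.
have hP : nbhs x P.
  apply: filterI; first by apply: (ce x [set y | 0 < y]); rewrite ex; apply: open_nbhs_nbhs;
    split; [exact: open_gt|].
  have cinv : {for x, continuous (fun y : V => (enorm y)^-1 *: y)}.
    apply: continuousZ; last exact: ci.
    by apply: continuousV; [rewrite ex gt_eqF|exact: ce].
  apply: cinv; rewrite ex xE scalerA mulVf ?gt_eqF// scale1r.
  by apply: open_nbhs_nbhs; split=> //; move: Dq; rewrite DU => -[].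
exact: (filterS PD hP).
Qed.

(** Mass and energy scale with exponents that differ by [2]. *)
Lemma lambda1_dilate (D : set V) A u g (s : R) : let S := cone D in
  open S -> open A -> A `<=` S -> 0 < s -> H10 S A u g -> 0 < mass S u ->
  (lambda1 S [set x | A (s *: x)] <= (s ^+ 2 * (dirichlet S A g / mass S u))%:E)%E.
Proof.
move=> S oS oA AS s0 ug a0; have [H _] := ug; have [su sg u0 g0 _] := H1_ext oS H.
have Ss x : S (s *: x) <-> S x by split=> [/(cone_scaleP s0)|/(cone_scale s0)].
have mA : Lset A by exact: Lset_open.
have osA := open_scale (s := s) oA.
have sug := H10_scale s0 oS Ss ug.
have sA : [set x | A (s *: x)] `<=` S by move=> x /AS/Ss.
have c0 : 0 < s ^- N by rewrite invr_gt0 exprn_gt0.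
have mE : mass S (fun x => (u \_ S) (s *: x)) = s ^- N * mass S u.
  rewrite -(Lint_scale s0 (Lsq_summable su)); apply: Lint_ext => x.
  rewrite patchE; case: ifPn => // xS; rewrite [in RHS]u0//.
  by move=> /Ss/mem_set; apply/negP.
have dE : dirichlet S [set x | A (s *: x)] (fun x => \row_i (s * extgrad S g i (s *: x))) =
    s ^- N * (s ^+ 2 * dirichlet S A g).
  have i1 := dirichlet_summable oS mA H; have i2 := Lsummable_scale s0 i1.
  rewrite mulrCA -(Lint_scale s0 i1) -(LintZ _ i2); apply: Lint_ext => x.
  rewrite [RHS]mulrCA; congr (_ * _); rewrite mulr_sumr; apply: eq_bigr => i _; rewrite {1}/extgrad patchE.
  case: ifPn => [_|xS]; first by rewrite mxE exprMn.
  have : ~ S (s *: x) by move=> /Ss/mem_set; apply/negP.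
  by move=> /(g0 i); rewrite /extgrad => ->; rewrite !expr0n mulr0.
have := lambda1_le oS (Lset_open osA) sA sug; rewrite mE dE mulr_gt0// => /(_ isT).
congr (_ <= _%:E)%E; field.
by rewrite (gt_eqF a0) expf_neq0 ?gt_eqF.
Qed.

End eigenvalues.

Section admissible.
Context {R : realType} {N : nat}.
Notation V := 'rV[R]_N.
Notation mu := (@leb R N).
Implicit Types (f phi psi : V -> R) (A S O E K : set V) (x y : V).

(** Tested against a function that is constant near the support of [f]. *)
Lemma int_derive0 f K (i : 'I_N) : class_C 1 f -> compact K ->
  (forall x, ~ K x -> f x = 0) -> Lint (fun x => 'D_(unit_vec i) f x) = 0.
Proof.
move=> Cf cK f0; have [r r0 Kr] := compact_in_ball cK.
(* The indicator of a ball that contains the translates of [K] by vectors of norm at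
   most [1]: its difference quotients vanish on [K]. *)
pose z x := 1 * (\1_[set y : V | `|y - 0| < r + 1] x : R).
pose t (n : nat) : R := n.+1%:R^-1.
have t0 n : 0 < t n by rewrite invr_gt0.
have t1 n : t n <= 1 by rewrite invf_le1 ?ler1n.
have t01 n : 0 < t n <= 1 by rewrite t0 t1.
have zK x h : K x -> `|h| <= 1 -> z (x + h) = 1.
  move=> Kx h1; rewrite /z mul1r indicE mem_set//= subr0.
  by apply: (le_lt_trans (ler_normD _ _)); have := Kr _ Kx; rewrite /= subr0; lra.
have zero n x : ((z (x + t n *: unit_vec i) - z x) / t n - 0) * f x = 0.
  have [Kx|Kx] := pselect (K x); last by rewrite f0// mulr0.
  have h0 : z x = 1 by rewrite -[x]addr0 zK// normr0.
  rewrite zK//; first by rewrite h0 subrr mul0r subrr mul0r.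
  rewrite normrZ (gtr0_norm (t0 n)) -[leRHS]mulr1; apply: ler_pM => //.
    exact: ltW.
  exact: unit_vec_norm_le.
have := @weak_derivative_of_quotients R N K z (fun=> 0) i t f (Lsq_ball_indic _ _ _) Cf cK f0
  t01 cvg_harmonic.
have E0 : (fun x => 0 * f x) = fun=> 0 by apply/funext => x; rewrite mul0r.
rewrite E0 Lint0 => h.
have <- : Lint (fun x => z x * 'D_(unit_vec i) f x) = Lint (fun x => 'D_(unit_vec i) f x).
  apply: Lint_ext => x; have [Kx|Kx] := pselect (K x).
    by rewrite -[x in z x]addr0 zK ?normr0// mul1r.
  by rewrite (derive_off_support _ cK f0 Kx) mulr0.
rewrite -[RHS]oppr0; apply: h; first exact: Lsummable0.
apply/Lmean_nullE; split=> [n|].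
  by under eq_fun do rewrite zero; exact: Lsummable0.
under eq_fun do under Lint_ext do rewrite zero normr0.
by under eq_fun do rewrite Lint0; exact: cvg_cst.
Qed.

Lemma bump_class_H1ext S phi : bump_class S phi ->
  H1ext S phi (fun i x => 'D_(unit_vec i) phi x).
Proof.
move=> bphi; have [ephi [K [cK KS phi0]]] := bphi; have tphi := bump_class_test bphi.
have cphi := elementary_continuous ephi.
split.
- exact: bump_class_Lsq bphi.
- by move=> i; exact: test_derive_Lsq tphi.
- by move=> x nSx; apply: phi0 => /KS.
- by move=> i x nSx; apply: (derive_off_support _ cK phi0) => /KS.
move=> i psi tpsi; have [Cpsi _] := tpsi.
have [cpsi dpsi] := Cpsi 1%N.
have D j x : is_derive x (unit_vec j) (fun x => phi x * psi x)
    (phi x * 'D_(unit_vec j) psi x + psi x * 'D_(unit_vec j) phi x).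
  have h1 := @elementary_derivable R N phi x (unit_vec j) ephi; have h2 := (dpsi j).1 x.
  have -> : (fun x => phi x * psi x) = phi * psi by apply/funext.
  by split; [exact: (derivableM h1 h2)|exact: (deriveM h1 h2)].
have DE j : (fun x => 'D_(unit_vec j) (fun x => phi x * psi x) x) =
    (fun x => phi x * 'D_(unit_vec j) psi x + psi x * 'D_(unit_vec j) phi x).
  by apply/funext => x; have [_ ->] := D j x.
have C1 : class_C 1 (fun x => phi x * psi x).
  split; first exact: continuous_mul.
  move=> j; split=> [x|]; first by have [] := D j x.
  rewrite DE; have c1 := continuous_mul cphi (dpsi j).2.
  have c2 := continuous_mul cpsi (test_derive_continuous (i := j) tphi).
  exact: (continuous_add c1 c2).
have fK x : ~ K x -> phi x * psi x = 0 by move=> /phi0 ->; rewrite mul0r.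
have := int_derive0 i C1 cK fK; rewrite DE LintD.
- move=> h; apply/eqP; rewrite -addr_eq0 -h; apply/eqP; congr (_ + _).
  by apply: Lint_ext => x; rewrite mulrC.
- exact: (LsqM (bump_class_Lsq bphi) (test_derive_Lsq i tpsi)).
- exact: (LsqM (test_Lsq tpsi) (test_derive_Lsq i tphi)).
Qed.

Lemma open_quasi_open E : open E -> quasi_open E.
Proof.
move=> oE e e0; exists set0; split; [exact: open0|by rewrite setU0|].
by rewrite capacity0_set0 lee_fin ltW.
Qed.

Lemma capacity0_mono E F : E `<=` F -> capacity F = 0%E -> capacity E = 0%E.
Proof. by move=> EF /capacity0P h; apply/capacity0P => e /h; exact: capped_mono. Qed.

Lemma continuous_int_sq_gt0 f (c : V) : (0 < @leb_outer R N setT)%E -> continuous f ->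
  Lsq f -> 0 < f c -> 0 < Lint (fun x => f x ^+ 2).
Proof.
move=> muT cf sf fc; pose k := f c / 2; have k0 : 0 < k by rewrite divr_gt0.
pose U := f @^-1` [set y | k < y].
have oU : open U by move/continuousP : cf; apply; exact: open_gt.
have Uc : U c by rewrite /U /= /k ltr_pdivrMr// ltr_pMr// ltr1n.
have mU : Lset U by exact: Lset_open.
have fU x : k ^+ 2 * \1_U x <= f x ^+ 2.
  rewrite indicE; case: (boolP (x \in U)) => [|_]; last by rewrite mulr0 sqr_ge0.
  rewrite in_setE /U /= => kx; rewrite mulr1 lerXn2r ?nnegrE ?ltW//.
  exact: lt_trans kx.
have k2 : 0 < k ^+ 2 by rewrite exprn_gt0.
have iU : Lsummable \1_U.
  apply: (Lsummable_dom (Lmeas_indic mU) (LsummableZ (k ^+ 2)^-1 (Lsq_summable sf))).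
  apply: LaeW => x; have /andP[h _] := indic01 U x.
  by rewrite ger0_norm// ler_pdivlMl.
have U0 : (0 < mu U)%E by apply: leb_open_gt0 => //; exists c.
have UE : mu U = (Lint \1_U)%:E.
  by rewrite LEFin_int// integral_indic ?setIT//; exact/LsetP.
rewrite UE lte_fin in U0.
apply: (@lt_le_trans _ _ (k ^+ 2 * Lint \1_U)); first exact: mulr_gt0.
rewrite -(LintZ _ iU); apply: Lle_int; [exact: LsummableZ|exact: Lsq_summable|].
exact: LaeW.
Qed.

(** A bump function inside [O] is admissible. *)
Lemma lambda1_finite S O E : open S -> open O -> O !=set0 -> O `<=` S -> Lset E -> E `<=` S ->
  (0 < @leb_outer R N setT)%E -> capacity (O `\` E) = 0%E -> (lambda1 S E < +oo)%E.
Proof.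
move=> oS oO [c Oc] OS mE ES muT cap0.
have /nbhs_ballP[d /= d0 dO] : nbhs c O by exact: open_nbhs_nbhs.
have d2 : 0 < d / 2 by rewrite divr_gt0.
have ballO y : `|y - c| <= d / 2 -> O y.
  move=> yc; apply: dO; rewrite -ball_normE /= distrC (le_lt_trans yc)//.
  by rewrite ltr_pdivrMr// ltr_pMr// ltr1n.
have bO : bump_class O (bump c (d / 2)) by exact: bump_class_bump.
have bS : bump_class S (bump c (d / 2)).
  by apply: bump_class_bump => // y /ballO; exact: OS.
have ug := ext_H1 oS (bump_class_H1ext bS).
have cphi : continuous (bump c (d / 2)) by have [e _] := bS; exact: elementary_continuous.
have uS : bump c (d / 2) \_ S = bump c (d / 2).
  apply/funext => x; rewrite patchE; case: ifPn => // /negP xS.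
  by have [_ _ -> //] := bump_class_H1ext bS => Sx; apply: xS; apply: mem_set.
have H : H10 S E (bump c (d / 2)) (fun x => \row_i 'D_(unit_vec i) (bump c (d / 2)) x).
  split=> //; exists (bump c (d / 2)); split.
  - move=> e e0; exists set0; split; first exact: open0.
      by rewrite capacity0_set0 lee_fin ltW.
    exact: continuous_subspaceT.
  - by apply/LaeP; apply: LaeW.
  - apply: capacity0_mono cap0 => x [[Sx nEx] h]; split=> //; apply: contrapT => nOx.
    by apply: h; have [_ _ ->] := bump_class_H1ext bO.
have m0 : 0 < mass S (bump c (d / 2)).
  rewrite /mass uS; apply: (continuous_int_sq_gt0 muT cphi (bump_class_Lsq bS)).
  by apply: (@bump_gt0 _ _ c (d / 2) c); rewrite subrr normr0.
by apply: (le_lt_trans (lambda1_le oS mE ES H m0)); rewrite ltry.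
Qed.

End admissible.

Section pieces.
Context {R : realType} {N : nat}.
Notation V := 'rV[R]_N.
Notation mu := (@leb R N).
Variables (S A : set V).
Hypothesis AS : A `<=` S.

Definition piece (A : set V) (u : V -> R) (x : V) : R := \1_A x * (u \_ S) x.
Definition piece_grad (A : set V) (u : V -> R) (g : V -> V) (x : V) : V :=
  \row_i restricted_gradient A (u \_ S) (extgrad S g) i x.

Lemma null_Lae (E : set V) : capacity E = 0%E -> Lae (fun x => ~ E x).
Proof.
move=> /capacity0_null E0; apply/LaeP; exists E; split=> //.
  exact: leb_outer_null_measurable.
by move=> x /contrapT.
Qed.

Lemma piece_ext u : piece A u \_ S = piece A u.
Proof.
apply/funext => x; rewrite patchE; case: ifPn => // /negP xS.
by rewrite /piece indicE memNset ?mul0r// => /AS/mem_set.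
Qed.

Lemma piece_grad_ext u g i :
  extgrad S (piece_grad A u g) i = restricted_gradient A (u \_ S) (extgrad S g) i.
Proof.
apply/funext => x; rewrite /extgrad patchE; case: ifPn => [_|/negP xS]; first by rewrite mxE.
by rewrite /restricted_gradient indicE memNset ?mul0r// => /AS/mem_set.
Qed.

Lemma piece_dirichlet u g :
  dirichlet S A (piece_grad A u g) =
  Lint (fun x => \sum_i extgrad S (piece_grad A u g) i x ^+ 2).
Proof.
apply: Lint_ext => x; rewrite indicE; case: (boolP (x \in A)) => xA; first by rewrite mul1r.
rewrite mul0r big1// => i _; rewrite piece_grad_ext /restricted_gradient indicE (negbTE xA).
by rewrite mul0r expr0n.
Qed.

End pieces.

Section splitting_energy.
Context {R : realType} {N : nat}.
Notation V := 'rV[R]_N.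
Variables (S Omega A B : set V) (u : V -> R) (g : V -> V).
Hypotheses (oS : open S) (oA : open A) (oB : open B).
Hypotheses (AB : forall x, A x -> B x -> False) (AS : A `<=` S) (BS : B `<=` S).
Hypotheses (capO : capacity (Omega `\` (A `|` B)) = 0%E).
Hypotheses (capO' : capacity ((A `|` B) `\` Omega) = 0%E).
Hypothesis mOmega : Lset Omega.
Hypothesis ug : H10 S Omega u g.

Let BA x : B x -> A x -> False. Proof. by move=> Bx Ax; exact: AB Ax Bx. Qed.
Let capBA : capacity (Omega `\` (B `|` A)) = 0%E. Proof. by rewrite setUC. Qed.

Lemma piece_H10 : H10 S A (piece S A u) (piece_grad S A u g) /\
  H10 S B (piece S B u) (piece_grad S B u g).
Proof.
split; first exact: (H10_restriction oS oA oB AB capO ug).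
exact: (H10_restriction oS oB oA BA capBA ug).
Qed.

Let indic_cases (P : R -> R -> Prop) x : P 1 0 -> P 0 1 -> (~ A x -> ~ B x -> P 0 0) ->
  P (\1_A x) (\1_B x).
Proof.
move=> h1 h2 h3; have [Ax|nAx] := pselect (A x).
  by rewrite !indicE mem_set// memNset// => /(AB Ax).
have [Bx|nBx] := pselect (B x); rewrite !indicE (memNset nAx) ?(memNset nBx) ?(mem_set Bx)//.
exact: h3.
Qed.

(** Almost everywhere off [A] and [B] the function [u] vanishes: outside [Omega] by the
    boundary condition, inside [Omega] because sets of zero capacity are null. *)
Lemma mass_pieces : mass S u = mass S (piece S A u) + mass S (piece S B u).
Proof.
have [[H1u _] [H2u _]] := piece_H10; have [Hu [ut [_ utu ut0]]] := ug.
have [su _ u0 _ _] := H1_ext oS Hu.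
have [s1 _ _ _ _] := H1_ext oS H1u; have [s2 _ _ _ _] := H1_ext oS H2u.
have i1 := Lsq_summable s1; have i2 := Lsq_summable s2.
rewrite /mass -(LintD i1 i2).
apply: (Leq_int (Lsummable_mf (Lsq_summable su)) (Lsummable_mf (LsummableD i1 i2))).
apply: LaeS2 (null_Lae ut0) (LaeS2 (fun x a b => conj a b) ((LaeP _).2 utu) (null_Lae capO)).
move=> x n1 [n2 n3].
have uO : ~ A x -> ~ B x -> (u \_ S) x = 0.
  move=> nAx nBx; rewrite patchE; case: ifPn => //; rewrite in_setE => Sx.
  rewrite -n2//; apply: contrapT => utx; apply: n1; split=> //; split=> // Omx.
  by apply: n3; split=> // -[].
rewrite !piece_ext// /piece.
apply: (indic_cases (P := fun a b => (u \_ S) x ^+ 2 = (a * (u \_ S) x) ^+ 2 + (b * (u \_ S) x) ^+ 2)).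
- by rewrite mul1r mul0r expr0n addr0.
- by rewrite mul1r mul0r expr0n add0r.
by move=> nAx nBx; rewrite uO// mul0r expr0n addr0.
Qed.

(** The gradients of the two pieces live in [A] and in [B], which lie in [Omega] up to
    a null set. *)
Lemma dirichlet_pieces : dirichlet S A (piece_grad S A u g) +
  dirichlet S B (piece_grad S B u g) <= dirichlet S Omega g.
Proof.
have [[H1u _] [H2u _]] := piece_H10; have [Hu _] := ug.
have mA : Lset A by exact: Lset_open. have mB : Lset B by exact: Lset_open.
have i1 := dirichlet_summable oS mA H1u; have i2 := dirichlet_summable oS mB H2u.
have i0 := dirichlet_summable oS mOmega Hu.
rewrite /dirichlet -(LintD i1 i2); apply: (Lle_int (LsummableD i1 i2) i0).
apply: LaeS (null_Lae capO') => x nO.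
have le_grad (E : set V) : E `<=` S -> E x ->
    \sum_i extgrad S (piece_grad S E u g) i x ^+ 2 <= \sum_i extgrad S g i x ^+ 2.
  move=> ES Ex; apply: ler_sum => i _; rewrite piece_grad_ext// /restricted_gradient.
  rewrite indicE mem_set// mul1r; case: eqP => _; rewrite ?mul1r// mul0r expr0n.
  exact: sqr_ge0.
have inO : A x \/ B x -> Omega x.
  by move=> ABx; apply: contrapT => nOx; apply: nO; split; [exact: ABx|exact: nOx].
have [Ax|nAx] := pselect (A x).
  have nBx : ~ B x by exact: AB.
  rewrite !indicE (mem_set Ax) (memNset nBx) (mem_set (inO (or_introl Ax))).
  by rewrite !mul1r mul0r addr0 le_grad.
rewrite [\1_A x]indicE (memNset nAx) mul0r add0r.
have [Bx|nBx] := pselect (B x).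
  rewrite !indicE (mem_set Bx) (mem_set (inO (or_intror Bx))) !mul1r.
  exact: le_grad.
rewrite [\1_B x]indicE (memNset nBx) mul0r; apply: mulr_ge0.
  by have /andP[] := indic01 Omega x.
by apply: sumr_ge0 => i _; exact: sqr_ge0.
Qed.

End splitting_energy.

(** * Minimizers are connected *)

Section minimizers.
Context {R : realType} {N : nat}.
Notation V := 'rV[R]_N.
Notation mu := (@leb R N).
Implicit Types (D S A B O E Omega : set V).

Lemma nth_root (y : R) : (0 < N)%N -> 0 < y < 1 -> exists2 s, 0 < s < 1 & s ^+ N = y.
Proof.
move=> N0 /andP[y0 y1]; have s0 : 0 < powR y (N%:R^-1) by exact: powR_gt0.
have sN : powR y (N%:R^-1) ^+ N = y.
  rewrite -powR_mulrn ?ltW// -powRrM mulVf; first exact/powRr1/ltW.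
  by rewrite pnatr_eq0 -lt0n.
exists (powR y (N%:R^-1)) => //; rewrite s0 ltNge; apply/negP => s1.
by move: y1; rewrite -sN ltNge exprn_ege1.
Qed.

Lemma finite_box_cover E : (@leb_outer R N E < +oo)%E ->
  exists2 F : nat -> option (V * V), E `<=` \bigcup_k box (F k) & (mu (\bigcup_k box (F k)) < +oo)%E.
Proof.
move=> /ereal_inf_lt[_ [F EF <-] Foo]; exists F => //.
apply: le_lt_trans Foo; apply: (@le_trans _ _ (\sum_(k <oo) leb_outer (box (F k)))%E).
  exact: outer_measure_sigma_subadditive.
by apply: lee_nneseries => k *; [exact: outer_measure_ge0|exact: leb_box_le].
Qed.

Lemma null_symdiff_measure (E O : set V) : Lset O -> leb_outer (E `\` O) = 0%E ->
  leb_outer (O `\` E) = 0%E -> Lset E /\ leb_outer E = leb_outer O.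
Proof.
move=> mO EO OE.
have m1 : Lset (E `\` O) by apply/LsetP; exact: leb_outer_null_measurable.
have m2 : Lset (O `\` E) by apply/LsetP; exact: leb_outer_null_measurable.
have EE : E = (O `\` (O `\` E)) `|` (E `\` O).
  apply/seteqP; split=> x.
    by move=> Ex; have [Ox|nOx] := pselect (O x); [left; split=> // -[]|right].
  by move=> [[Ox nOE]|[]//]; apply: contrapT => nEx; exact: nOE.
have mE : Lset E by rewrite EE; apply: LsetU => //; exact: LsetD.
split=> //.
have h1 := @measureU0 _ _ R mu E (O `\` E) ((LsetP _).1 mE) ((LsetP _).1 m2) OE.
have h2 := @measureU0 _ _ R mu O (E `\` O) ((LsetP _).1 mO) ((LsetP _).1 m1) EO.
have e : E `|` (O `\` E) = O `|` (E `\` O).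
  by rewrite !setDE !setUIr !setUCr !setIT setUC.
rewrite e in h1; rewrite /leb in h1 h2.
exact: etrans (esym h1) h2.
Qed.

(** Otherwise both energies would be at least [c] times the masses, and so would
    their sum. *)
Lemma best_piece (a1 a2 b1 b2 c : R) : 0 <= a1 -> 0 <= a2 -> 0 <= b1 -> 0 <= b2 -> 0 < c ->
  a1 + a2 = 1 -> b1 + b2 < c -> (0 < a1 /\ b1 < c * a1) \/ (0 < a2 /\ b2 < c * a2).
Proof.
move=> a10 a20 b10 b20 c0 a12 b12; have [h1|h1] := ltP b1 (c * a1).
  left; split=> //; rewrite lt_neqAle a10 andbT eq_sym; apply/eqP => a1E.
  by move: h1; rewrite a1E mulr0 ltNge b10.
have h2 : b2 < c * a2 by have -> : a2 = 1 - a1 by [lra]; lra.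
right; split=> //; rewrite lt_neqAle a20 andbT eq_sym; apply/eqP => a2E.
by move: h2; rewrite a2E mulr0 ltNge b20.
Qed.

(** The level [c] exceeds the eigenvalue [l] by the factor that the less favourable of
    the two dilations gains. *)
Lemma minimizer_not_split D Omega A B (m : R) : let S := cone D in
  open S -> D `<=` usphere -> uniformly_lipschitz S -> (0 < N)%N -> 0 < m ->
  is_minimizer S m Omega -> open A -> open B -> A !=set0 -> B !=set0 ->
  (forall x, A x -> B x -> False) -> A `<=` S -> B `<=` S ->
  capacity (Omega `\` (A `|` B)) = 0%E -> capacity ((A `|` B) `\` Omega) = 0%E -> False.
Proof.
move=> S oS Ds lipS N0 m0 [OmS _ Omm minOm] oA oB An0 Bn0 AB AS BS cap1 cap2.
have mA : Lset A by exact: Lset_open. have mB : Lset B by exact: Lset_open.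
have oAB : open (A `|` B) by exact: openU.
have [mOm OmAB] := null_symdiff_measure (Lset_open oAB) (capacity0_null cap1) (capacity0_null cap2).
have muAB : leb_outer (A `|` B) = m%:E by rewrite -OmAB -Omm.
have muT : (0 < @leb_outer R N setT)%E.
  by apply: (@lt_le_trans _ _ m%:E); rewrite ?lte_fin// -muAB; exact: le_outer_measure.
have add : (leb_outer A + leb_outer B)%E = m%:E.
  rewrite -muAB; apply/esym; apply: (@measureU _ _ _ mu); [exact/LsetP..|].
  by apply/seteqP; split=> x // [] /AB.
have A0 : (0 < leb_outer A)%E by exact: leb_open_gt0.
have B0 : (0 < leb_outer B)%E by exact: leb_open_gt0.
have finE (E : set V) : E `<=` A `|` B -> leb_outer E = (fine (leb_outer E))%:E.
  move=> EAB; rewrite fineK// ge0_fin_numE ?outer_measure_ge0//.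
  by apply: (@le_lt_trans _ _ m%:E); rewrite ?ltry// -muAB; exact: le_outer_measure.
pose al := fine (leb_outer A); pose be := fine (leb_outer B).
have alE : leb_outer A = al%:E by apply: finE; left.
have beE : leb_outer B = be%:E by apply: finE; right.
have al0 : 0 < al by move: A0; rewrite alE lte_fin.
have be0 : 0 < be by move: B0; rewrite beE lte_fin.
have albe : al + be = m by move: add; rewrite alE beE => -[].
have [|sA /andP[sA0 sA1] sAN] := @nth_root (al / m) N0.
  by rewrite divr_gt0//= ltr_pdivrMr// mul1r; lra.
have [|sB /andP[sB0 sB1] sBN] := @nth_root (be / m) N0.
  by rewrite divr_gt0//= ltr_pdivrMr// mul1r; lra.
have [x0 Ax0] := An0.
have [e [rho [rho0 SC]]] := cone_translations Ds (ex_intro _ x0 (AS _ Ax0)) lipS.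
have [F ABF Foo] : exists2 F : nat -> option (V * V),
    A `|` B `<=` \bigcup_k box (F k) & (mu (\bigcup_k box (F k)) < +oo)%E.
  by apply: finite_box_cover; rewrite muAB ltry.
have [C C0 poincareC] := poincare oS rho0 N0 SC muT Foo.
have poincare_piece (E : set V) u g : E `<=` A `|` B -> E `<=` S ->
    H10 S E (piece S E u) (piece_grad S E u g) ->
    mass S (piece S E u) <= C * dirichlet S E (piece_grad S E u g).
  move=> EAB ES [Hu _]; rewrite piece_dirichlet//.
  apply: (poincareC _ _ (H1_ext oS Hu)) => x nF; rewrite piece_ext// /piece.
  by rewrite indicE memNset ?mul0r// => /EAB/ABF.
have capBA : capacity (Omega `\` (B `|` A)) = 0%E by rewrite setUC.
have lpos : (((2 * C)^-1)%:E <= lambda1 S Omega)%E.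
  rewrite leNgt; apply/negP => /(lambda1_lt oS mOm OmS)[u [g [ug u1 gC]]].
  have [H1 H2] := piece_H10 oS oA oB AB cap1 ug.
  have M := mass_pieces oS oA oB AB AS BS cap1 ug.
  have De := dirichlet_pieces oS oA oB AB AS BS cap1 cap2 mOm ug.
  have p1 := poincare_piece A u g (fun x h => or_introl h) AS H1.
  have p2 := poincare_piece B u g (fun x h => or_intror h) BS H2.
  have h : C * dirichlet S Omega g < 2^-1.
    by rewrite -ltr_pdivlMl// mulrC -invfM.
  have h' := ler_wpM2l (ltW C0) De; rewrite mulrDr in h'.
  by rewrite u1 in M; lra.
have lfin : (lambda1 S Omega < +oo)%E.
  apply: (lambda1_finite oS oAB) => //; first by exists x0; left.
  by move=> x [/AS|/BS].
pose l := fine (lambda1 S Omega).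
have lE : lambda1 S Omega = l%:E by rewrite fineK// ge0_fin_numE// lambda1_ge0.
have l0 : 0 < l.
  by move: lpos; rewrite lE lee_fin; apply: lt_le_trans; rewrite invr_gt0 mulr_gt0.
pose sg := Num.max sA sB.
have sg0 : 0 < sg by rewrite lt_max sA0.
have sg1 : sg < 1 by rewrite gt_max sA1 sB1.
pose c := l / sg ^+ 2.
have lc : l < c.
  rewrite /c ltr_pdivlMr ?exprn_gt0// -[ltRHS]mulr1 ltr_pM2l//.
  by rewrite expr2 mulr_ilt1// ltW.
have [u [g [ug u1 gc]]] : exists u g, [/\ H10 S Omega u g, mass S u = 1 & dirichlet S Omega g < c].
  by apply: lambda1_lt => //; rewrite lE lte_fin.
have [H1 H2] := piece_H10 oS oA oB AB cap1 ug.
have M := mass_pieces oS oA oB AB AS BS cap1 ug; rewrite u1 in M.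
have De := dirichlet_pieces oS oA oB AB AS BS cap1 cap2 mOm ug.
have final (E : set V) s eps w h : open E -> E `<=` S -> leb_outer E = eps%:E -> 0 < eps ->
    0 < s <= sg -> s ^+ N = eps / m -> H10 S E w h -> 0 < mass S w ->
    dirichlet S E h < c * mass S w -> False.
  move=> oE ES Eeps eps0 /andP[s0 ssg] sN wh w0 hc.
  have osE := open_scale (s := s) oE.
  have sES : [set x | E (s *: x)] `<=` S by move=> x /ES; exact: cone_scaleP.
  have mE : leb [set x | E (s *: x)] = m%:E.
    rewrite /leb leb_outer_scale// sN Eeps -EFinM; congr _%:E.
    by field; rewrite !gt_eqF.
  have := minOm _ sES (open_quasi_open osE) mE.
  have /(le_trans _) h1 := lambda1_dilate oS oE ES s0 wh w0.
  move=> /h1; rewrite lE lee_fin leNgt => /negP; apply.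
  have s2 : 0 < s ^+ 2 by rewrite exprn_gt0.
  apply: (@lt_le_trans _ _ (s ^+ 2 * c)).
    by rewrite ltr_pM2l// ltr_pdivrMr.
  rewrite /c mulrA ler_pdivrMr ?exprn_gt0// mulrC ler_pM2l//.
  by rewrite lerXn2r ?nnegrE// ltW.
have ge0 v : 0 <= mass S v by exact: Lint_sq_ge0.
have [[a0 hc]|[a0 hc]] := best_piece (ge0 (piece S A u)) (ge0 (piece S B u))
  (dirichlet_ge0 S A _) (dirichlet_ge0 S B _) (lt_trans l0 lc) (esym M) (le_lt_trans De gc).
- have sAg : 0 < sA <= sg by rewrite sA0 le_max lexx.
  exact: (final A sA al _ _ oA AS alE al0 sAg sAN H1 a0 hc).
- have sBg : 0 < sB <= sg by rewrite sB0 le_max lexx orbT.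
  exact: (final B sB be _ _ oB BS beE be0 sBg sBN H2 a0 hc).
Qed.

End minimizers.

Theorem proposition5p9 (R : realType) (N : nat) (D : set 'rV[R]_N) (m : R)
    (Omega O : set 'rV[R]_N) :
  (3 <= N)%N ->
  smooth_domain D ->
  uniformly_lipschitz (cone D) ->
  0 < m ->
  is_minimizer (cone D) m Omega ->
  open_representative (cone D) Omega O ->
  connected O.
Proof.
move=> N3 [Ds [U oU DU] _ _ _] lipS m0 minOm [oO OS cap0] A A0 [C oC AC] [C' cC' AC'].
apply: contrapT => AO; pose B := O `&` ~` C'.
have oA : open A by rewrite AC; exact: openI.
have oB : open B by apply: openI => //; exact: closed_openC.
have ABO : A `|` B = O.
  apply/seteqP; split=> x; first by move=> [|[]//]; rewrite AC => -[].
  move=> Ox; have [C'x|nC'x] := pselect (C' x); last by right.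
  by left; rewrite AC'.
have B0 : B !=set0.
  apply: contrapT => B0; apply: AO; rewrite -ABO; apply/seteqP; split=> x; first by left.
  by move=> [//|Bx]; case: B0; exists x.
have AS : A `<=` cone D by move=> x Ax; apply: OS; rewrite -ABO; left.
have BS : B `<=` cone D by move=> x Bx; apply: OS; rewrite -ABO; right.
have N0 : (0 < N)%N by exact: leq_trans N3.
apply: (minimizer_not_split (cone_open oU DU) Ds lipS N0 m0 minOm oA oB A0 B0) => //.
- by move=> x; rewrite AC' => -[_ C'x] [_].
- by rewrite ABO; apply: capacity0_mono cap0 => x; left.
- by rewrite ABO; apply: capacity0_mono cap0 => x; right.
Qed.
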